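(* Fix a prime $p$ and integers $d$ and $n$ so that either $n=2$ and $d\ge10$, or $n\ge3$ and $d\ge3$. Let $F$ be the free group on $d$ generators and let $d_n$ be the rank of $F_n/F_{n+1}$. Let $$K=\begin{cases}C(p)^5D(p)^4p^{17/4} & \text{if } n=2 \text{ and } d\ge10,\\ C(p)^2D(p)p^{3/4} & \text{if } n\ge3,\end{cases}\qquad x=\begin{cases}-d & \text{if } n=2,\\ d^2-d_n/2 & \text{if } n\ge3.\end{cases}$$ Then (a) $$1\le\frac{|\mathfrak{C}_{d,n}|\cdot|\mathrm{GL}(d,\mathbb{F}_p)|}{|\mathcal{C}_{d,n}|}\le 1+Kp^x.$$ (b) $$1\le\frac{|\mathfrak{C}_{d,n}|}{|\mathfrak{D}_{d,n}|}\le\frac{1+Kp^x}{1-Kp^x}.$$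
   Context: For a prime $p$ and a group $H$, the lower $p$-series $H=H_1\ge H_2\ge\cdots$ is defined by $H_{i+1}=H_i^p[H_i,H]$, where $H_i^p$ is the subgroup generated by the $p$-th powers of elements of $H_i$. For the free group $F$ on $d$ generators, $(F_i)$ denotes its lower $p$-series; $F_i/F_{i+1}$ is a finite elementary abelian $p$-group, and its rank is its dimension over $\mathbb{F}_p$. $\mathcal{C}_{d,n}$ is the set of normal subgroups of $F/F_{n+1}$ lying in $F_n/F_{n+1}$ (equivalently, the set of all subspaces of the $\mathbb{F}_p$-vector space $F_n/F_{n+1}$, which is central in $F/F_{n+1}$). The natural map $\mathrm{Aut}(F/F_{n+1})\to\mathrm{Aut}(F/F_2)\cong\mathrm{GL}(d,\mathbb{F}_p)$ is surjective and its kernel acts trivially on $F_n/F_{n+1}$, so $\mathrm{GL}(d,\mathbb{F}_p)$ acts on $F_n/F_{n+1}$ and on $\mathcal{C}_{d,n}$. $\mathfrak{C}_{d,n}$ is the set of $\mathrm{GL}(d,\mathbb{F}_p)$-orbits in $\mathcal{C}_{d,n}$, and $\mathfrak{D}_{d,n}$ is the set of regular $\mathrm{GL}(d,\mathbb{F}_p)$-orbits in $\mathcal{C}_{d,n}$ (those in which every point has trivial stabilizer). $C(q)=\sum_{r=-\infty}^{\infty}q^{-r^2}$ and $D(q)=\prod_{j=1}^{\infty}(1-q^{-j})^{-1}$.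
   Formalization: In (b) the two-sided bound is stated only when Kp^x < 1, since otherwise (1+Kp^x)/(1-Kp^x) is negative or undefined (e.g. p=2, n=3, d=3, where x=2 and K>1); the lower bound 1 ≤ ratio is also stated whenever a regular orbit exists. *)

(* Defs.v *)
From HB Require Import structures.
From mathcomp Require Import all_boot all_order all_fingroup all_algebra.
From mathcomp Require Import all_solvable.
From mathcomp Require Import all_classical all_reals all_analysis.

Set Implicit Arguments.
Unset Strict Implicit.
Unset Printing Implicit Defensive.

(* The free group on d generators, as the reduced words in the letters
   (i, false) (the generator x_i) and (i, true) (its inverse). *)
Section FreeGroup.
Variable d : nat.

Definition letter := ('I_d * bool)%type.
Definition inv_letter (a : letter) : letter := (a.1, ~~ a.2).
Definition reduced (w : seq letter) := sorted (fun a b => b != inv_letter a) w.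
Definition push (a : letter) (w : seq letter) :=
  if w is b :: w' then if b == inv_letter a then w' else a :: w else [:: a].

Record free_group := FreeWord { word :> seq letter; _ : reduced word }.
HB.instance Definition _ := [isSub for word].
HB.instance Definition _ := [Countable of free_group by <:].

Let inv_letterK : involutive inv_letter.
Proof. by case=> i b; rewrite /inv_letter /= negbK. Qed.

Let reduced_behead a w : reduced (a :: w) -> reduced w.
Proof. by case: w => //= b w /andP[]. Qed.

Let push_reduced a w : reduced w -> reduced (push a w).
Proof.
case: w => //= b w; case: eqP => [_|/eqP nab] rw; first exact: reduced_behead rw.
by rewrite /= nab.
Qed.

Let pushK a w : reduced w -> push a (push (inv_letter a) w) = w.
Proof.
case: w => [|b w] /=; first by rewrite eqxx.
rewrite inv_letterK; case: eqP => [->|_] /=; last by rewrite eqxx.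
by case: w => //= c w /andP[/negPf->].
Qed.

Let push_cons a w : reduced (a :: w) -> push a w = a :: w.
Proof. by case: w => //= b w /andP[/negPf->]. Qed.

Let cat_red (u v : seq letter) := foldr push v u.

Let cat_red_reduced u v : reduced v -> reduced (cat_red u v).
Proof. by move=> rv; elim: u => //= a u; apply: push_reduced. Qed.

Let cat_redA u v w : reduced w ->
  cat_red (cat_red u v) w = cat_red u (cat_red v w).
Proof.
move=> rw; elim: u => //= a u <-.
case: (cat_red u v) => //= b t; case: eqP => [->|//] /=.
by rewrite pushK ?cat_red_reduced.
Qed.

Let cat_red0 u : reduced u -> cat_red u [::] = u.
Proof.
elim: u => //= a u IH rau; rewrite IH ?push_cons //; exact: reduced_behead rau.
Qed.

Let inv_word (u : seq letter) := rev (map inv_letter u).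

Let inv_word_reduced u : reduced u -> reduced (inv_word u).
Proof.
rewrite /reduced /inv_word rev_sorted sorted_map; apply: sub_sorted => a b /=.
by apply: contraNneq => ->; rewrite inv_letterK.
Qed.

Let cat_redV u : cat_red (inv_word u) u = [::].
Proof.
rewrite /cat_red /inv_word; elim: u => //= a u IH.
by rewrite rev_cons -cats1 foldr_cat /= inv_letterK eqxx.
Qed.

Let inv_wordK u : inv_word (inv_word u) = u.
Proof. by rewrite /inv_word map_rev revK mapK. Qed.

Definition free_one : free_group := @FreeWord [::] isT.
Definition free_mul (u v : free_group) : free_group :=
  FreeWord (cat_red_reduced u (valP v)).
Definition free_inv (u : free_group) : free_group :=
  FreeWord (inv_word_reduced (valP u)).

Fact free_mulA : associative free_mul.
Proof. by move=> u v w; apply/val_inj; rewrite /= cat_redA ?(valP w). Qed.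
Fact free_mul1 : left_id free_one free_mul.
Proof. by move=> u; apply/val_inj. Qed.
Fact free_1mul : right_id free_one free_mul.
Proof. by move=> u; apply/val_inj; rewrite /= cat_red0 ?(valP u). Qed.
Fact free_mulV : left_inverse free_one free_inv free_mul.
Proof. by move=> u; apply/val_inj; rewrite /= cat_redV. Qed.
Fact free_Vmul : right_inverse free_one free_inv free_mul.
Proof.
by move=> u; apply/val_inj; rewrite /= -[X in cat_red X]inv_wordK cat_redV.
Qed.
HB.instance Definition _ :=
  isGroup.Build free_group free_mulA free_mul1 free_1mul free_mulV free_Vmul.

Definition free_letter (a : letter) : free_group := @FreeWord [:: a] isT.
Definition free_gen (i : 'I_d) : free_group := free_letter (i, false).

Local Open Scope group_scope.

Lemma free_group_ind (P : free_group -> Prop) :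
  P 1 -> (forall u a, P u -> P (free_letter a * u)) -> forall u, P u.
Proof.
move=> P1 PM [w]; elim: w => [|a w IH] raw.
  by rewrite (_ : FreeWord raw = 1) //; apply/val_inj.
have rw := reduced_behead raw.
rewrite (_ : FreeWord raw = free_letter a * FreeWord rw); first exact/PM/IH.
by apply/val_inj; rewrite /= push_cons.
Qed.

End FreeGroup.

Section LowerPSeries.
Local Open Scope group_scope.
Local Open Scope classical_set_scope.
Variable G : groupType.
Implicit Types (H X N : set G).

Definition is_subgroup H := H 1 /\ forall x y, H x -> H y -> H (x * y^-1).
Definition is_normal N := is_subgroup N /\ forall x g, N x -> N (x ^ g).
Definition generated X : set G := smallest is_subgroup X.

(* lower_p_series p i is the i-th term H_i, counted from H_1 = H; the value at
   i = 0 is a dummy *)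
Fixpoint lower_p_series (p i : nat) : set G :=
  if i is j.+1 then
    if j is 0 then setT else
    [set u * v | u in generated [set x ^+ p | x in lower_p_series p j]
               & v in generated [set [~ x, y] | x in lower_p_series p j
                                              & y in setT]]
  else setT.

Let subgroupV H x : is_subgroup H -> H x -> H x^-1.
Proof. by case=> H1 HF Hx; rewrite -[x^-1]mul1g; apply: HF. Qed.

Let subgroupM H x y : is_subgroup H -> H x -> H y -> H (x * y).
Proof.
by move=> sH Hx Hy; rewrite -[y]invgK; apply: sH.2 => //; apply: subgroupV.
Qed.

Let subgroupX H x k : is_subgroup H -> H x -> H (x ^+ k).
Proof.
move=> sH Hx; elim: k => [|k IH]; first exact: sH.1.
by rewrite expgS; apply: subgroupM.
Qed.

Let generated_subgroup X : is_subgroup (generated X).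
Proof.
split=> [H [[H1 _] _]|x y Xx Xy H HX]; first exact: H1.
by apply: HX.1.2; [apply: Xx | apply: Xy].
Qed.

Let generated_normal X :
  (forall x g, X x -> X (x ^ g)) -> is_normal (generated X).
Proof.
move=> XJ; split=> [|x g Xx H [sH sXH]]; first exact: generated_subgroup.
apply: (Xx [set y | H (y ^ g)]); split=> [|y Xy]; last by apply/sXH/XJ.
split=> /= [|y z Hy Hz]; first by rewrite conj1g; case: sH.
by rewrite conjMg conjVg; apply: sH.2.
Qed.

Let normalM H N : is_normal H -> is_normal N ->
  is_normal [set u * v | u in H & v in N].
Proof.
move=> [sH HJ] [sN NJ]; split; first split.
- by exists 1; [apply: sH.1|exists 1; [apply: sN.1|rewrite mulg1]].
- move=> _ _ [u Hu [v Nv <-]] [w Hw [z Nz <-]].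
  exists (u * w^-1); first exact: sH.2.
  exists ((v * z^-1) ^ w^-1); first exact/NJ/sN.2.
  by rewrite conjgE !invgK invgM !mulgA mulgVK.
- move=> _ g [u Hu [v Nv <-]]; exists (u ^ g); first exact: HJ.
  by exists (v ^ g); [apply: NJ | rewrite conjMg].
Qed.

Lemma lower_p_series_normal p i : is_normal (lower_p_series p i).
Proof.
elim: i => [|[|i] IH]; try by [].
apply: normalM; apply: generated_normal => z g.
  by case=> x Lx <-; exists (x ^ g); [apply: IH.2 | rewrite conjXg].
case=> x Lx [y _ <-]; exists (x ^ g); first exact: IH.2.
by exists (y ^ g) => //; rewrite conjRg.
Qed.

Lemma lower_p_seriesX p i x :
  lower_p_series p i.+1 x -> lower_p_series p i.+2 (x ^+ p).
Proof.
move=> Lx; exists (x ^+ p); first by apply: sub_gen_smallest; exists x.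
by exists 1; [apply: (generated_subgroup _).1 | rewrite mulg1].
Qed.

Lemma lower_p_seriesR p i x y :
  lower_p_series p i.+1 x -> lower_p_series p i.+2 [~ x, y].
Proof.
move=> Lx; exists 1; first exact: (generated_subgroup _).1.
exists [~ x, y]; last by rewrite mul1g.
by apply: sub_gen_smallest; exists x => //; exists y.
Qed.

End LowerPSeries.
Arguments lower_p_series : clear implicits.

Section Quotient.
Local Open Scope group_scope.
Local Open Scope quotient_scope.
Variables (G : groupType) (N : set G) (nN : is_normal N).

Definition coset_rel (x y : G) := `[< N (x * y^-1) >].

Fact coset_rel_equiv : equiv_class_of coset_rel.
Proof.
split=> [x|x y|y x z].
- by apply/asboolP; rewrite mulgV; apply: nN.1.1.
- by apply/asboolP/asboolP => Nxy; rewrite -invgF -[_^-1]mul1g;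
    apply: nN.1.2 => //; apply: nN.1.1.
- move=> /asboolP Nxy /asboolP Nyz; apply/asboolP.
  rewrite -[x](mulgVK y) -mulgA -[X in _ * X]invgK; apply: nN.1.2 => //.
  by rewrite -[X in N X]mul1g; apply: nN.1.2 => //; apply: nN.1.1.
Qed.
Canonical coset_equiv := EquivRelPack coset_rel_equiv.

Definition quotient_group := {eq_quot coset_equiv}.
HB.instance Definition _ := Choice.on quotient_group.

Definition quotient_map (x : G) : quotient_group := \pi_{eq_quot coset_equiv} x.

Lemma quotient_mapP x y : quotient_map x = quotient_map y <-> N (x * y^-1).
Proof.
split=> [/eqP|Nxy]; last by apply/eqP; rewrite eqmodE; apply/asboolP.
by rewrite eqmodE => /asboolP.
Qed.

Definition quotient_repr (a : quotient_group) : G :=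
  generic_quotient.repr (a : {eq_quot coset_equiv}).
Lemma quotient_reprK : cancel quotient_repr quotient_map.
Proof. by move=> a; rewrite /quotient_map reprK. Qed.

Definition quotient_one := quotient_map 1.
Definition quotient_mul a b := quotient_map (quotient_repr a * quotient_repr b).
Definition quotient_inv a := quotient_map (quotient_repr a)^-1.

Let mapM x y :
  quotient_map (x * y) = quotient_mul (quotient_map x) (quotient_map y).
Proof.
have Nr z : N (z * (quotient_repr (quotient_map z))^-1).
  by apply/quotient_mapP; rewrite quotient_reprK.
apply/quotient_mapP; move: (Nr x) (Nr y).
set x' := quotient_repr _; set y' := quotient_repr _ => Nx Ny.
rewrite (_ : _ * _^-1 = (y * y'^-1) ^ x^-1 * (x * x'^-1)^-1^-1).
  apply: nN.1.2; first exact: nN.2.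
  by rewrite -[_^-1]mul1g; apply: nN.1.2 => //; apply: nN.1.1.
by rewrite conjgE !invgK invgM !mulgA mulgVK.
Qed.

Let mapV x : quotient_map x^-1 = quotient_inv (quotient_map x).
Proof.
apply/quotient_mapP; rewrite invgK.
have : N (quotient_repr (quotient_map x) * x^-1).
  by apply/quotient_mapP; rewrite quotient_reprK.
by move=> /(nN.2 _ x); rewrite conjgE mulgVK.
Qed.

Fact quotient_mulA : associative quotient_mul.
Proof.
move=> a b c; rewrite -[a]quotient_reprK -[b]quotient_reprK -[c]quotient_reprK.
by rewrite -!mapM mulgA.
Qed.
Fact quotient_mul1 : left_id quotient_one quotient_mul.
Proof. by move=> a; rewrite -[a]quotient_reprK -mapM mul1g. Qed.
Fact quotient_1mul : right_id quotient_one quotient_mul.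
Proof. by move=> a; rewrite -[a]quotient_reprK -mapM mulg1. Qed.
Fact quotient_mulV : left_inverse quotient_one quotient_inv quotient_mul.
Proof. by move=> a; rewrite -[a]quotient_reprK -mapV -mapM mulVg. Qed.
Fact quotient_Vmul : right_inverse quotient_one quotient_inv quotient_mul.
Proof. by move=> a; rewrite -[a]quotient_reprK -mapV -mapM mulgV. Qed.
HB.instance Definition _ := isGroup.Build quotient_group
  quotient_mulA quotient_mul1 quotient_1mul quotient_mulV quotient_Vmul.

Fact quotient_map_morph : {morph quotient_map : x y / x * y}.
Proof. exact: mapM. Qed.
HB.instance Definition _ :=
  isMultiplicative.Build G quotient_group quotient_map quotient_map_morph.
HB.instance Definition _ :=
  Multiplicative_isUMagmaMorphism.Build G quotient_group quotient_map
    (erefl : quotient_map 1 = 1).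

End Quotient.

Section Finiteness.
Local Open Scope group_scope.

Let finite_central_extension (p : nat) (Q : groupType) (ls T : seq Q)
    (Z : set Q) (r : Q -> Q) :
  0 < p ->
  (forall P : Q -> Prop,
     P 1 -> (forall a u, a \in ls -> P u -> P (a * u)) -> forall u, P u) ->
  (forall z, Z z -> z ^+ p = 1) -> (forall z, Z z -> forall x, commute z x) ->
  (forall q, r q \in T) -> (forall q, Z ((r q)^-1 * q)) ->
  exists s : seq Q, forall q, q \in s.
Proof.
move=> p_gt0 Qind ZX ZC rT Zr.
pose prods := foldr (fun (c : Q) (l : seq Q) =>
  [seq c ^+ e * m | e <- iota 0 p, m <- l]) [:: 1].
have prods1 cs : 1 \in prods cs.
  elim: cs => [|c cs IH] /=; first by rewrite inE.
  by apply/allpairsP; exists (0, 1); rewrite mem_iota expg0 mulg1.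
have prodsM cs c m : (forall z, z \in cs -> Z z) ->
    c \in cs -> m \in prods cs -> c * m \in prods cs.
  elim: cs m => [//|h cs IH] m Zcs /=; rewrite inE => ccs.
  case/allpairsP=> -[e k] /= [ep kcs ->]; move: ep; rewrite mem_iota /= => ep.
  have Zh : Z h by apply: Zcs; rewrite mem_head.
  case/orP: ccs => [/eqP->|ccs].
    apply/allpairsP; case: (ltnP e.+1 p) => [lep|pe].
      by exists (e.+1, k); rewrite mem_iota /= lep mulgA -expgS.
    exists (0, k); rewrite mem_iota /= p_gt0 expg0 mul1g mulgA -expgS.
    by rewrite (_ : e.+1 = p) ?ZX ?mul1g //; apply/eqP; rewrite eqn_leq pe andbT.
  apply/allpairsP; exists (e, c * k); rewrite mem_iota /= ep; split=> //.
    by apply: IH => // z zcs; apply: Zcs; rewrite inE zcs orbT.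
  rewrite !mulgA; congr (_ * _); apply: ZC.
  by apply: Zcs; rewrite inE ccs orbT.
pose cs := (r 1)^-1 :: [seq (r (a * t))^-1 * (a * t) | a <- ls, t <- T].
have Zcs z : z \in cs -> Z z.
  rewrite inE => /orP[/eqP->|/allpairsP[[a t] /= [_ _ ->]]]; last exact: Zr.
  by rewrite -[_^-1]mulg1; apply: Zr.
exists [seq t * m | t <- T, m <- prods cs]; apply: Qind => [|a u als].
  apply/allpairsP; exists (r 1, (r 1)^-1); rewrite mulgV; split=> //; first exact: rT.
  change ((r 1)^-1 \in prods cs).
  by rewrite -[(r 1)^-1]mulg1; apply: (prodsM cs) => //; apply: mem_head.
case/allpairsP=> -[t m] /= [tT mcs ->].
apply/allpairsP; exists (r (a * t), (r (a * t))^-1 * (a * t) * m).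
split; [exact: rT| |by rewrite /= !mulgA mulgV mul1g].
apply: (prodsM cs) => //; rewrite inE; apply/orP; right.
by apply/allpairsP; exists (a, t).
Qed.

Lemma free_quotient_finite p d i : prime p ->
  exists s : seq (quotient_group (lower_p_series_normal (free_group d) p i)),
    forall a, a \in s.
Proof.
move=> /prime_gt0 p_gt0.
have triv j : j < 2 ->
    exists s : seq (quotient_group (lower_p_series_normal (free_group d) p j)),
    forall a, a \in s.
  move=> j2; exists [:: 1] => a.
  by rewrite inE -[a]quotient_reprK; apply/eqP/quotient_mapP; case: j j2 a => [|[]].
elim: i => [|[_|i [s sP]]]; [exact: triv|exact: triv|].
set nN := lower_p_series_normal _ p i.+1 in s sP *.
set nM := lower_p_series_normal _ p i.+2.
pose f := quotient_map nN; pose g := quotient_map nM.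
pose Z : set (quotient_group nM) :=
  [set z | exists2 x, lower_p_series (free_group d) p i.+1 x & g x = z]%classic.
pose r (q : quotient_group nM) := g (quotient_repr (f (quotient_repr q))).
apply: (@finite_central_extension p _ [seq g (free_letter a) | a : letter d]
  [seq g (quotient_repr a) | a <- s] Z r) => //.
- move=> P P1 PM q; rewrite -[q]quotient_reprK.
  elim/free_group_ind: (quotient_repr q) => [|u a Pu]; first exact: P1.
  rewrite gmulfM; apply: PM => //; exact: fintype.image_f.
- move=> _ [x Lx <-]; rewrite -gmulfXn /=; apply/quotient_mapP.
  by rewrite invg1 mulg1; apply: lower_p_seriesX.
- move=> _ [x Lx <-] q; rewrite -[q]quotient_reprK; apply/commgP/eqP.
  rewrite -gmulfR; apply/quotient_mapP.
  by rewrite invg1 mulg1; apply: lower_p_seriesR.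
- by move=> q; apply: map_f.
- move=> q; set x := quotient_repr q.
  exists ((quotient_repr (f x))^-1 * x); last first.
    have gx : g x = q by exact: quotient_reprK.
    rewrite [LHS]gmulfM gmulfV; exact: (congr1 (fun z => (r q)^-1 * z) gx).
  set y := quotient_repr _.
  rewrite (_ : y^-1 * x = (x * y^-1) ^ y); last by rewrite conjgE mulgVK.
  by apply: nN.2; apply/(quotient_mapP nN); rewrite quotient_reprK.
Qed.

End Finiteness.

(* F / F_i; the primality of p is used only to make it a finGroupType *)
Definition free_quotient p (p_pr : prime p) (d i : nat) :=
  quotient_group (lower_p_series_normal (free_group d) p i).

Section FreeQuotientInstances.
Variables (p : nat) (p_pr : prime p) (d i : nat).
Let Q := free_quotient p_pr d i.

HB.instance Definition _ := Group.on Q.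
HB.instance Definition _ : isCountable Q :=
  CanIsCountable (@quotient_reprK _ _ (lower_p_series_normal (free_group d) p i)).

Let enumQ := cid (free_quotient_finite d i p_pr).
Fact free_quotient_finite_axiom : Finite.axiom (undup (projT1 enumQ) : seq Q).
Proof.
by move=> a; rewrite count_uniq_mem ?undup_uniq // mem_undup (projT2 enumQ).
Qed.
HB.instance Definition _ := fintype.isFinite.Build Q free_quotient_finite_axiom.

End FreeQuotientInstances.

Section GLOrbits.
Local Open Scope group_scope.
Variables (p : nat) (p_pr : prime p) (d n : nat).

Local Notation F := (free_group d).
Local Notation Q := (free_quotient p_pr d n.+1).

Definition free_proj (u : F) : Q :=
  quotient_map (lower_p_series_normal F p n.+1) u.

(* F_i / F_{n+1}, for i <= n + 1 *)
Definition lower_quotient (i : nat) : {set Q} :=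
  [set a : Q | `[< exists2 u, lower_p_series F p i u & free_proj u = a >]].

(* the set C_{d,n} of normal subgroups of F / F_{n+1} lying in F_n / F_{n+1} *)
Definition normal_subs : {set {set Q}} :=
  [set N : {set Q} |
    [&& group_set N, normal N [set: Q] & N \subset lower_quotient n]].

Definition GL : {set 'M['F_p]_d} := [set A | A \in unitmx].

(* The automorphism a of F / F_{n+1} induces on F / F_2 = (F_p)^d, with basis the
   classes of the free generators x_i, the map v |-> v *m A on row vectors, that
   is, x_i |-> \prod_j x_j ^ (A i j). *)
Definition induces (a : {perm Q}) (A : 'M['F_p]_d) : bool :=
  [forall i : 'I_d,
    a (free_proj (free_gen i)) *
      (\prod_(j < d) free_proj (free_gen j) ^+ (A i j : nat))^-1
    \in lower_quotient 2].

(* The action of A in GL(d, F_p) on F_n / F_{n+1}: apply any automorphism of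
   F / F_{n+1} inducing A. There is one, and its values on F_n / F_{n+1} do not
   depend on the choice. This is a right action: A *m B acts by A, then by B. *)
Definition GL_act (A : 'M['F_p]_d) (u : Q) : Q :=
  if [pick a in Aut [set: Q] | induces a A] is Some a then a u else u.

Definition GL_orbit (N : {set Q}) : {set {set Q}} :=
  [set GL_act A @: N | A in GL].

Definition GL_stab (N : {set Q}) : {set 'M['F_p]_d} :=
  [set A in GL | GL_act A @: N == N].

(* the sets of all, resp. of the regular, GL(d, F_p)-orbits in C_{d,n} *)
Definition orbits : {set {set {set Q}}} := [set GL_orbit N | N in normal_subs].

Definition regular_orbits : {set {set {set Q}}} :=
  [set O in orbits | [forall N in O, GL_stab N == [set 1%:M%R]]].

(* the rank d_n of F_n / F_{n+1} *)
Definition lower_rank : nat := 'r(lower_quotient n).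

End GLOrbits.

Import numFieldNormedType.Exports.

Section Constants.
Local Open Scope ring_scope.
Variable R : realType.

Definition Cfun (q : R) : R :=
  fine (\esum_(r in [set: int]%classic) (q ^ (- r ^+ 2))%:E).

Definition Dfun (q : R) : R :=
  limn (fun m => \prod_(1 <= j < m.+1) (1 - q ^- j)^-1).

End Constants.

(* Main.v *)
Require Import Defs.
From HB Require Import structures.
From mathcomp Require Import all_boot all_order all_fingroup all_algebra.
From mathcomp Require Import all_solvable mxabelem.
From mathcomp Require Import zify ring lra.
From mathcomp Require Import boolp.

Set Implicit Arguments.
Unset Strict Implicit.
Unset Printing Implicit Defensive.

Import Order.TTheory GRing.Theory Num.Theory.

(** Write [nC] for the number of subspaces of V = F_n / F_{n+1}, fix(A) for the
    number of those that A in GL(d, F_p) maps to themselves, and S for the sum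
    of fix(A) over A <> 1.  By the Cauchy-Frobenius formula ([sum_fixed]) the
    number of orbits times the order of GL(d, F_p) is [nC] + S.  A subspace
    outside the regular orbits is fixed by some A <> 1, so the number of regular
    orbits times the order of GL(d, F_p) is at least [nC] - S
    ([card_subs_le_regular]).  Both parts of the theorem are formal consequences
    of S <= K p^x [nC], and as GL(d, F_p) has at most p^(d^2) elements it is
    enough to bound fix(A) / [nC] for each A <> 1.

    Let T be the matrix of A on V, of size m = d_n, and q = p.  A space of
    dimension m has at least theta(m) subspaces, the sum over r of
    q^(r (m - r)), and at most D(q) theta(m).  To bound the number of T-stable
    subspaces W of dimension r, count pairs (X, W) where X is a tuple of j
    vectors of W such that X and its image X T together span 2j dimensions.  A
    stable W around X contains this span, which leaves about
    q^((m - r)(r - 2j)) choices; if a fixed proportion of the q^(rj) tuples in W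
    has the property, then at most about q^((r - j)(m - r)) subspaces W are
    stable ([spread_bound]).  The sum over r is theta(m - j), smaller than
    theta(m) by about q^(-jm/2).

    For n >= 3 the choice j = 1 gives the exponent d^2 - m/2
    ([card_stable_le]); there are enough vectors that are not eigenvectors in
    every W on which T is not scalar, and the W on which T is scalar lie in an
    eigenspace and are counted directly.  For n = 2 the dimension m is only
    d (d + 1) / 2, so the bound -d on the exponent, d^2 - 2m, asks for a saving
    of q^(-2m), and j = 5 is used.  A fixed proportion of the 5-tuples in W has
    the property unless W meets an eigenspace in codimension at most 4
    ([card_spread5]), and there are few such W because all eigenspaces of T have
    codimension at least d - 1 >= 9 in V ([card_stable_far_le]).  The values of
    theta are compared by completing squares, which is where C(q) comes from
    ([theta_ratio_le], [far_bound_le]).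

    The facts about T that this needs, that m >= d (d + 1) / 2 and that the
    eigenspaces have codimension at least d - 1 when A <> 1, come from a
    homomorphism of F to a Heisenberg group over the integers, whose elements
    are pairs (v, B) of a vector and a matrix.  Dividing by suitable powers of p
    turns it into linear maps [lam1] from V to U = F_p^d and [lam2] from V to
    U (x) U that send the p^(n-1)-st power of y to the class of y in U, and the
    p^(n-2)-nd power of the commutator of y and z to y^T z - z^T y.  So V contains
    enough of U and of the exterior square of U, with their natural actions, for
    a computation with A alone ([rank_eigenspace_le]). *)

(** * Counting the subspaces between two given ones *)

Section SubspaceCount.
Variables (F : finFieldType) (m : nat).
Local Notation q := #|F|.
Implicit Types (r : nat) (S E W : 'M[F]_m) (w : 'rV[F]_m).
Local Open Scope nat_scope.

(** Each subspace of F^m is represented by one square matrix, the canonical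
    generator of its row space, so that counting matrices counts subspaces. *)
Definition between r S E : {set 'M[F]_m} :=
  [set W | [&& <<W>>%MS == W, \rank W == r, (S <= W)%MS & (W <= E)%MS]].

(** Double counting of the pairs (w, W) with w a vector of W outside S: a
    given W contains q^r - q^(rank S) of them, and W contains w exactly when
    it contains S + w. Both bounds below follow from this by induction on r -
    rank S. *)
Lemma between_rec r S E :
  #|between r S E| * (q ^ r - q ^ \rank S) =
  \sum_(w in rowg E :\: rowg S) #|between r (S + w)%MS E|.
Proof.
have -> : \sum_(w in rowg E :\: rowg S) #|between r (S + w)%MS E| =
    \sum_(w in rowg E :\: rowg S) \sum_(W in between r S E) (w <= W)%MS.
  apply: eq_bigr => w _; rewrite -sum1_card [LHS]big_mkcond [RHS]big_mkcond.
  apply: eq_bigr => W _; rewrite !inE addsmx_sub.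
  by case: (_ == W); case: (\rank W == r); case: (S <= W)%MS; case: (w <= W)%MS;
    case: (W <= E)%MS.
rewrite exchange_big /= -sum_nat_const; apply: eq_bigr => W.
rewrite inE => /and4P[_ /eqP rW sSW sWE].
have -> : q ^ r - q ^ \rank S = #|rowg W :\: rowg S|.
  by rewrite cardsD (setIidPr _) ?rowgS // !card_rowg rW.
rewrite -sum1_card big_mkcond [RHS]big_mkcond; apply: eq_bigr => w _.
rewrite !inE; case: (boolP (w <= W)%MS) => wW; last by rewrite andbF; case: ifP.
by rewrite (submx_trans wW sWE); case: (w <= S)%MS.
Qed.

Lemma rank_adds_vector S w : ~~ (w <= S)%MS -> \rank (S + w)%MS = (\rank S).+1.
Proof.
move=> nwS; apply/eqP; rewrite eqn_leq; apply/andP; split.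
  by rewrite (leq_trans (mxrank_adds_leqif _ _)) // -[leqRHS]addn1 leq_add2l rank_leq_row.
by apply: rank_ltmx; rewrite /ltmx addsmxSl /= addsmx_sub submx_refl.
Qed.

Lemma card_by_rank (Ws : {set 'M[F]_m}) :
  #|Ws| = \sum_(r < m.+1) #|[set W in Ws | \rank W == r]|.
Proof.
rewrite -sum1_card (partition_big (fun W => inord (\rank W) : 'I_m.+1) predT) //=.
apply: eq_bigr => r _; rewrite sum1dep_card; apply: eq_card => W; rewrite !inE.
by rewrite -val_eqE /= inordK // ltnS rank_leq_row.
Qed.

Lemma card_between_rank r S E : \rank S = r -> #|between r S E| <= 1.
Proof.
move=> rS; rewrite -(cards1 <<S>>%MS); apply: subset_leq_card.
apply/subsetP => W; rewrite !inE => /and4P[/eqP eW /eqP rW sSW _].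
by rewrite -eW; apply/eqP/esym/genmxP; rewrite -(mxrank_leqif_eq sSW).2 rW rS.
Qed.

Lemma between0 r S E : r < \rank S -> between r S E = set0.
Proof.
move=> rS; apply/setP => W; rewrite !inE; apply: contraTF rS.
by case/and4P=> _ /eqP <- /mxrankS + _; rewrite -leqNgt.
Qed.

End SubspaceCount.

Section CountBounds.
Local Open Scope ring_scope.
Variables (R : realFieldType) (F : finFieldType) (m : nat).
Local Notation q := (#|F|%:R : R).
Implicit Types (r : nat) (S E W : 'M[F]_m) (w : 'rV[F]_m).

Lemma card_field_gt1 : 1 < q.
Proof. by rewrite ltr1n; exact: card_finRing_gt1. Qed.

Definition euler_prod (x : R) k : R := \prod_(1 <= j < k.+1) (1 - x ^- j)^-1.

Lemma euler_prodS x k : euler_prod x k.+1 = euler_prod x k * (1 - x ^- k.+1)^-1.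
Proof. by rewrite /euler_prod big_nat_recr. Qed.

Lemma euler_factor_gt0 (x : R) k : 1 < x -> 0 < 1 - x ^- k.+1.
Proof.
by move=> x1; rewrite subr_gt0 invf_lt1 ?exprn_gt0 ?(lt_trans ltr01) // exprn_egt1.
Qed.

Lemma euler_prod_gt0 (x : R) k : 1 < x -> 0 < euler_prod x k.
Proof.
move=> x1; elim: k => [|k IH]; first by rewrite /euler_prod big_geq.
by rewrite euler_prodS mulr_gt0 ?invr_gt0 ?euler_factor_gt0.
Qed.

(** In [between_rec] there are at most q^(rank E) vectors w, and q^r - q^s =
    q^r (1 - q^(s - r)) produces one factor of the Euler product at each step.
    The power q^(r (r - s)) stays on the left because r may be larger than
    rank E. *)
Lemma card_between_le r S E :
  #|between r S E|%:R * q ^+ (r * (r - \rank S)) <=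
    euler_prod q (r - \rank S) * q ^+ (\rank E * (r - \rank S)).
Proof.
have q0 : 0 < q := lt_trans ltr01 card_field_gt1.
have [Sr|rS] := leqP (\rank S) r; last first.
  by rewrite between0 // cards0 mul0r mulr_ge0 ?exprn_ge0 ?ltW // euler_prod_gt0 ?card_field_gt1.
move: (r - \rank S)%N (subnKC Sr) => k; elim: k S {Sr} => [|k IH] S.
  rewrite addn0 => rS; rewrite /euler_prod big_geq // !muln0 !expr0 !mulr1.
  by rewrite lern1 card_between_rank.
move=> rS; rewrite euler_prodS -(ler_pM2r (euler_factor_gt0 k card_field_gt1)).
rewrite [leRHS](_ : _ = q ^+ \rank E * (euler_prod q k * q ^+ (\rank E * k))); last first.
  rewrite mulnS exprD mulrAC -!mulrA; have := euler_factor_gt0 k card_field_gt1.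
  move: (1 - _) => f f0; field; exact: lt0r_neq0.
rewrite [leLHS](_ : _ =
    (#|between r S E| * (#|F| ^ r - #|F| ^ \rank S))%:R * q ^+ (r * k)); last first.
  rewrite natrM natrB ?leq_exp2l ?card_finRing_gt1 -?rS ?leq_addr // !natrX.
  rewrite rS mulnS exprD -rS exprD.
  have : q ^+ k.+1 != 0 by rewrite expf_neq0 // lt0r_neq0.
  by move: (q ^+ k.+1) => x x0; field.
rewrite between_rec natr_sum mulr_suml.
apply: (@le_trans _ _ (\sum_(w in rowg E :\: rowg S)
    (euler_prod q k * q ^+ (\rank E * k)))).
  apply: ler_sum => w; rewrite !inE => /andP[wS _]; apply: IH.
  by rewrite rank_adds_vector // addSnnS.
rewrite sumr_const -[leLHS]mulr_natl; apply: ler_wpM2r.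
  by rewrite mulr_ge0 ?exprn_ge0 ?ltW // euler_prod_gt0 ?card_field_gt1.
by rewrite -natrX ler_nat -card_rowg subset_leq_card ?subsetDl.
Qed.

(** Each step of the induction gains (q^m - q^s) / (q^r - q^s) >= q^(m - r). *)
Lemma card_between_ge r S : (\rank S <= r)%N -> (r <= m)%N ->
  (#|F| ^ ((m - r) * (r - \rank S)) <= #|between r S 1%:M|)%N.
Proof.
move=> Sr rm; move: (r - \rank S)%N (subnKC Sr) => k.
have q1 : (1 < #|F|)%N by exact: card_finRing_gt1.
elim: k S {Sr} => [|k IH] S.
  rewrite addn0 muln0 expn0 => rS; apply/card_gt0P; exists <<S>>%MS.
  by rewrite inE genmx_id eqxx !genmxE rS eqxx submx1 submx_refl.
move=> rS.
have pos : (0 < #|F| ^ r - #|F| ^ \rank S)%N by rewrite subn_gt0 ltn_exp2l // -rS addnS ltnS leq_addr.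
rewrite -(leq_pmul2r pos) between_rec.
apply: (@leq_trans (\sum_(w in rowg 1%:M :\: rowg S) #|F| ^ ((m - r) * k))%N); last first.
  apply: leq_sum => w; rewrite !inE => /andP[wS _]; apply: IH.
  by rewrite rank_adds_vector // addSnnS.
rewrite sum_nat_const cardsD rowg1 setTI cardsT card_rowg card_mx mul1n.
rewrite mulnS expnD mulnC mulnA leq_mul2r; apply/orP; right.
rewrite mulnBl -!expnD subnKC // leq_sub2l //.
by rewrite leq_exp2l // leq_addr.
Qed.

End CountBounds.

(** * Eigenvectors in a subspace *)

Section Eigenvectors.
Local Open Scope ring_scope.
Variables (F : finFieldType) (m : nat) (T : 'M[F]_m).
Local Notation q := #|F|.
Implicit Types (W : 'M[F]_m) (v : 'rV[F]_m) (c : F).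

Definition stable_subs : {set 'M[F]_m} :=
  [set W | (<<W>>%MS == W) && (W *m T <= W)%MS].

Definition eigenvectors W : {set 'rV[F]_m} :=
  [set v in rowg W | (v *m T <= v)%MS].

Definition scalar_on W := [exists c, (W <= eigenspace T c)%MS].

Lemma expn_sum_convex (b e f : nat) : (0 < b)%N ->
  (b ^ e.+1 + b ^ f.+1 <= b ^ (e + f).+1 + b)%N.
Proof.
move=> b0; rewrite !expnS expnD.
have : (0 < b ^ e)%N by rewrite expn_gt0 b0.
have : (0 < b ^ f)%N by rewrite expn_gt0 b0.
move: (b ^ e)%N (b ^ f)%N => [|x] [|y] // _ _; nia.
Qed.

(** Let c be the eigenvalue of a nonzero eigenvector in W, and E the part of W
    in the eigenspace of c, of dimension e with 0 < e < r = rank W.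
    Eigenvectors outside E that are congruent modulo E are equal: u - u' is
    killed by T - c, so u and u' are proportional, and then they have the same
    eigenvalue. So there are at most q^e + q^(r - e) - 1 eigenvectors in W,
    and by convexity e = 1 or e = r - 1 is the worst case. *)
Lemma card_eigenvectors W : ~~ scalar_on W ->
  (#|eigenvectors W| < q ^ (\rank W).-1 + q)%N.
Proof.
move=> nW.
have q1 : (1 < q)%N by exact: card_finRing_gt1.
have [v|no] := pickP [pred v | (v \in eigenvectors W) && (v != 0)]; last first.
  have /subset_leq_card : eigenvectors W \subset [set 0].
    by apply/subsetP => v Wv; rewrite inE; move: (no v) => /=; rewrite Wv => /negbFE.
  rewrite cards1 => /leq_ltn_trans; apply.
  by rewrite (leq_trans q1) // leq_addl.
rewrite !inE => /andP[/andP[vW /sub_rVP[c vT]] v0].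
pose E := (W :&: eigenspace T c)%MS.
have EP (u : 'rV[F]_m) : (u <= E)%MS = (u <= W)%MS && (u *m T == c *: u).
  by rewrite sub_capmx; congr (_ && _); apply/eigenspaceP/eqP.
have e0 : (0 < \rank E)%N.
  rewrite lt0n mxrank_eq0; apply: contraNneq v0 => E0.
  by have := EP v; rewrite vW vT eqxx E0 submx0 => ->.
have er : (\rank E < \rank W)%N.
  apply: rank_ltmx; rewrite /ltmx capmxSl /= sub_capmx submx_refl /=.
  by apply: contra nW => h; apply/existsP; exists c.
have -> : eigenvectors W = rowg E :|: (eigenvectors W :\: rowg E).
  apply/setP => u; rewrite !inE EP; case: (boolP (u <= W)%MS) => //= uW.
  by case: eqP => //= ->; rewrite scalemx_sub.
apply: (@leq_ltn_trans (q ^ \rank E + #|rowg (W *m cokermx E) :\ 0|)).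
  apply: (leq_trans (leq_card_setU _ _)); rewrite card_rowg leq_add2l.
  have inj : {in eigenvectors W :\: rowg E &, injective (mulmxr (cokermx E))}.
    move=> u u'; rewrite !inE !EP => /andP[+ /andP[uW /sub_rVP[b ub]]].
    rewrite uW /= => nu /andP[+ /andP[u'W /sub_rVP[b' ub']]]; rewrite u'W /= => nu'.
    move=> /eqP; rewrite /= -subr_eq0 -mulmxBl -submxE EP => /andP[_ /eqP].
    rewrite mulmxBl ub ub' => h.
    have {}h : (b - c) *: u = (b' - c) *: u'.
      by apply/eqP; rewrite -subr_eq0 !scalerBl opprD opprK addrACA h scalerBr addrACA subrr addNr addr0.
    have bc : b - c != 0.
      by apply: contraNneq nu => /subr0_eq bc; rewrite ub bc.
    have eu : u = ((b - c)^-1 * (b' - c)) *: u'.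
      by rewrite -scalerA -h scalerA mulVf // scale1r.
    have ebb : b = b'.
      apply: contraNeq nu; rewrite -subr_eq0 => bb.
      have : (b - b') *: u = 0.
        rewrite scalerBl -ub {1}eu -scalemxAl ub' [in X in _ - X]eu !scalerA.
        by rewrite -scalerBl [_ * b']mulrC subrr scale0r.
      by move/eqP; rewrite scaler_eq0 (negPf bb) => /eqP ->; rewrite mul0mx scaler0.
    by rewrite eu -ebb mulVf // scale1r.
  rewrite -(card_in_imset inj); apply: subset_leq_card.
  apply/subsetP => _ /imsetP[u + ->]; rewrite !inE => /andP[nu /andP[uW _]] /=.
  by rewrite -submxE nu submxMr.
have rk : (\rank (W *m cokermx E) <= \rank W - \rank E)%N.
  rewrite -(mxrank_mul_ker W (cokermx E)) -addnBA ?leq_addr // ?mxrankS //.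
  rewrite sub_capmx capmxSl /=; apply/sub_kermxP; exact: mulmx_coker.
have /= h := cardsD1 0 (rowg (W *m cokermx E)); rewrite inE sub0mx card_rowg in h.
apply: (@leq_trans (q ^ \rank E + q ^ (\rank W - \rank E))); last first.
  move: (\rank E) (\rank W) e0 er => [|e] // [|r] // _; rewrite ltnS => er.
  have -> : (r.+1 - e.+1 = (r - e.+1).+1)%N by lia.
  have {2}-> : (r = (e + (r - e.+1)).+1)%N by lia.
  exact: expn_sum_convex (ltnW q1).
rewrite ltn_add2l; apply: leq_trans (leq_pexp2l _ rk); last exact: ltnW.
by rewrite h.
Qed.

(** Over the field of two elements an invertible T has no eigenvalue but 1, so
    that all eigenvectors in W lie in one proper subspace. The additional q of
    [card_eigenvectors] would be too much for q = 2. *)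
Lemma card_eigenvectors_F2 W : q = 2 -> T \in unitmx -> ~~ scalar_on W ->
  (#|eigenvectors W| <= q ^ (\rank W).-1)%N.
Proof.
move=> q2 Tu nW; pose E := (W :&: eigenspace T 1)%MS.
have er : (\rank E < \rank W)%N.
  apply: rank_ltmx; rewrite /ltmx capmxSl /= sub_capmx submx_refl /=.
  by apply: contra nW => h; apply/existsP; exists 1.
apply: (@leq_trans #|rowg E|); last first.
  rewrite card_rowg leq_pexp2l ?q2 //; by case: (\rank W) er.
apply: subset_leq_card; apply/subsetP => v; rewrite !inE sub_capmx.
case/andP=> -> /sub_rVP[c vT] /=; apply/eigenspaceP; rewrite vT.
have [->|v0] := eqVneq v 0; first by rewrite !scaler0.
have c0 : c != 0.
  apply: contraNneq v0 => c0; rewrite -(mulmxK Tu v) vT c0 scale0r mul0mx //.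
suff -> : c = 1 by [].
apply/eqP; apply: contraT => c1.
have /subset_leq_card : [set 0; 1; c] \subset [set: F] by apply: subsetT.
by rewrite cardsT q2 setUC cardsU1 cards2 !inE (negPf c0) (negPf c1) eq_sym oner_eq0.
Qed.

End Eigenvectors.

(** * Subspaces stable under a nonscalar matrix *)

Section StableCount.
Local Open Scope ring_scope.
Variables (R : realFieldType) (F : finFieldType) (m : nat) (T : 'M[F]_m).
Local Notation q := (#|F|%:R : R).
Implicit Types (W : 'M[F]_m) (v : 'rV[F]_m) (c : F) (r j : nat).
Variable D : R.
Hypothesis euler_le : forall k, euler_prod q k <= D.

(** Up to a factor between 1 and D(x), the number of subspaces of a space of
    dimension M over a field with x elements. *)
Definition theta (x : R) (M : nat) : R := \sum_(r < M.+1) x ^+ (r * (M - r)).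

Let q1 : 1 < q := card_field_gt1 R F.
Let q0 : 0 < q := lt_trans ltr01 q1.
Let D1 : 1 <= D.
Proof. by have := euler_le 0; rewrite /euler_prod big_geq. Qed.
Let D0 : 0 < D := lt_le_trans ltr01 D1.

Lemma card_between_sparse r (S E : 'M[F]_m) s e :
  \rank S = s -> \rank E = e -> (s <= r <= e)%N ->
  #|between r S E|%:R <= D * q ^+ ((e - r) * (r - s)).
Proof.
move=> rS rE /andP[sr re]; have := card_between_le R r S E; rewrite rS rE => h.
rewrite -(ler_pM2r (exprn_gt0 (r * (r - s)) q0)) (le_trans h) //.
rewrite -mulrA -exprD -mulnDl subnK //.
by apply: ler_wpM2r; rewrite ?exprn_ge0 // ltW.
Qed.

(** Tuples of j vectors, as matrices, that leave little freedom to the stable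
    subspaces around them: these also contain X *m T, hence a given space of
    dimension 2j. *)
Definition spread j W : {set 'M[F]_(j, m)} :=
  [set X | (X <= W)%MS && (\rank (col_mx X (X *m T)) == j.*2)].

(** Double counting of the pairs (X, W). Each W has g q^(rj) spread tuples at
    least; there are at most q^(jm) tuples, and a spread one lies in at most D
    q^((m - r) (r - 2j)) stable subspaces of dimension r, which contain its
    2j-dimensional span with T. The exponent jm + (m - r) (r - 2j) - rj equals
    (r - j) (m - r), the one that dimension r - j contributes to theta(m - j). *)
Lemma spread_bound j r (g : R) (Ws : {set 'M[F]_m}) : (j.*2 <= r <= m)%N ->
  (forall W, W \in Ws -> W \in stable_subs T /\ \rank W = r) ->
  (forall W, W \in Ws -> g * q ^+ (r * j) <= #|spread j W|%:R) ->
  #|Ws|%:R * g <= D * q ^+ ((r - j) * (m - r)).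
Proof.
move=> /andP[jr rm] Wst Wg.
rewrite -(ler_pM2r (exprn_gt0 (r * j) q0)).
apply: (@le_trans _ _ (\sum_(W in Ws) #|spread j W|%:R)).
  by rewrite -mulrA mulr_natl -sumr_const; apply: ler_sum.
have -> : \sum_(W in Ws) #|spread j W|%:R =
    \sum_(X : 'M[F]_(j, m) | \rank (col_mx X (X *m T)) == j.*2)
      #|[set W in Ws | (X <= W)%MS]|%:R :> R.
  under eq_bigr do rewrite -sum1_card natr_sum big_mkcond.
  under [RHS]eq_bigr do rewrite -sum1_card natr_sum big_mkcond.
  rewrite exchange_big /= [RHS]big_mkcond; apply: eq_bigr => X _.
  rewrite [LHS]big_mkcond /=; case: ifP => rX; last first.
    by apply: big1 => W _; rewrite inE rX andbF; case: ifP.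
  by apply: eq_bigr => W _; rewrite !inE rX andbT; case: (W \in Ws).
apply: (@le_trans _ _ (\sum_(X : 'M[F]_(j, m)) D * q ^+ ((m - r) * (r - j.*2)))).
  rewrite [leLHS]big_mkcond; apply: ler_sum => X _; case: ifP => [/eqP rX|_]; last first.
    by rewrite mulr_ge0 ?exprn_ge0 // ltW.
  have rS : \rank <<col_mx X (X *m T)>>%MS = j.*2 by rewrite genmxE.
  have jrm : (j.*2 <= r <= m)%N by rewrite jr.
  apply: le_trans (card_between_sparse rS (mxrank1 F m) jrm).
  rewrite ler_nat; apply: subset_leq_card; apply/subsetP => W.
  rewrite !inE genmxE submx1 => /andP[WWs XW].
  have [] := Wst _ WWs; rewrite inE => /andP[-> WT] ->; rewrite eqxx /= andbT.
  rewrite col_mx_sub XW /=; exact: submx_trans (submxMr _ XW) WT.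
rewrite sumr_const card_mx -[leLHS]mulr_natl natrX mulrCA -exprD -mulrA -exprD.
rewrite ler_pM2l // ler_eXn2l //.
by rewrite [leqLHS](_ : _ = (r - j) * (m - r) + r * j)%N //; nia.
Qed.

Lemma mem_spread1 W v :
  (v \in spread 1 W) = (v <= W)%MS && ~~ (v *m T <= v)%MS.
Proof.
rewrite inE; congr (_ && _); apply/eqP/idP => [r2|nv].
  apply: contraTN (leqnn (\rank (col_mx v (v *m T)))) => vT.
  by rewrite {1}r2 -ltnNge -addsmxE (addsmx_idPl vT) (leq_ltn_trans (rank_leq_row _)).
rewrite -addsmxE -(adds_eqmx (genmxE v) (eqmx_refl _)) rank_adds_vector ?genmxE //.
have v0 : v != 0 by apply: contraNneq nv => ->; rewrite mul0mx sub0mx.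
by rewrite rank_rV v0.
Qed.

Lemma card_spread1 W : (#|spread 1 W| + #|eigenvectors T W| = #|F| ^ \rank W)%N.
Proof.
rewrite -card_rowg -(cardsID (eigenvectors T W) (rowg W)) addnC; congr (_ + _)%N.
  by apply: eq_card => v; rewrite !inE; case: (v <= W)%MS.
by apply: eq_card => v; rewrite mem_spread1 !inE; case: (v <= W)%MS; rewrite ?andbF ?andbT.
Qed.

Lemma card_stable_split :
  #|stable_subs T| =
  (\sum_(r < m.+1) (#|[set W in stable_subs T | (\rank W == r) && scalar_on T W]| +
    #|[set W in stable_subs T | (\rank W == r) && ~~ scalar_on T W]|))%N.
Proof.
rewrite card_by_rank; apply: eq_bigr => r _.
rewrite -(cardsID [set W | scalar_on T W]).
congr (_ + _)%N; apply: eq_card => W; rewrite !inE -!andbA //.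
by case: (scalar_on T W); rewrite ?andbF ?andbT.
Qed.

Hypothesis T_nonscalar : ~~ scalar_on T 1%:M.

(** The stable subspaces on which T is not scalar and those on which it is get
    separate constants, with sum 4. They depend on q because for q = 2 the
    bound on the nonscalar ones can be lowered by [card_eigenvectors_F2], and
    the bound on the scalar ones must be raised. *)
Definition nonscalar_const : R := if #|F| == 2%N then 2 else 9 / 4.
Definition scalar_const : R := 4 - nonscalar_const.

Let q3 : #|F| != 2%N -> 3 <= q.
Proof.
move=> q2; rewrite ler_nat ltn_neqAle eq_sym q2.
exact: card_finRing_gt1.
Qed.

(** The inverse of [nonscalar_const] is a lower bound for the proportion of
    vectors of W that are not eigenvectors, that is, of spread 1-tuples. *)
Lemma card_nonscalar_le r : (2 <= r <= m)%N -> T \in unitmx ->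
  #|[set W in stable_subs T | (\rank W == r) && ~~ scalar_on T W]|%:R <=
    nonscalar_const * D * q ^+ ((r - 1) * (m - r)).
Proof.
move=> rm Tu; set Ws := [set _ in _ | _].
have c0 : 0 < nonscalar_const by rewrite /nonscalar_const; case: ifP => _; lra.
rewrite -mulrA -ler_pdivrMl // mulrC; apply: spread_bound => //.
  by move=> W; rewrite inE => /andP[-> /andP[/eqP ->]].
move=> W; rewrite inE muln1 => /andP[_ /andP[/eqP rW nW]].
have /(congr1 (fun n => n%:R : R)) := card_spread1 W; rewrite natrD natrX rW => e.
case: r rm {Ws} rW e => [//|r] rm rW e; rewrite /nonscalar_const; case: ifP => [/eqP q2|/negbT q2].
  have := card_eigenvectors_F2 q2 Tu nW; rewrite -(ler_nat R) natrX rW /=.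
  have {}q2 : q = 2 by rewrite q2.
  by move: e; rewrite exprS; move: (q ^+ r) => y; rewrite q2; lra.
have := card_eigenvectors nW; rewrite -(ler_nat R) -addn1 !natrD natrX rW /=.
have : q <= q ^+ r by rewrite ler_eXnr // ?(ltW q1) //; case: (r) rm.
move: (q3 q2) e; rewrite exprS; move: (q ^+ r) q => y x; nra.
Qed.

(** Double counting of the pairs (v, W) with v a nonzero vector of W. As T is
    scalar on W, v is an eigenvector; there are at most q^(m-1) + q - 2 such v
    because T is not scalar on the whole space, and W lies in the eigenspace
    that contains v, of dimension at most m - 1. *)
Lemma card_scalar_le r : (3 <= m)%N -> (r < m)%N ->
  #|[set W in stable_subs T | (\rank W == r) && scalar_on T W]|%:R <=
    scalar_const * D * q ^+ (r * (m.-1 - r)).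
Proof.
move=> m3 rm; set Ws := [set _ in _ | _].
have c1 : 7 / 4 <= scalar_const.
  by rewrite /scalar_const /nonscalar_const; case: ifP => _; lra.
have [r0|r0] := posnP r.
  have /subset_leq_card : Ws \subset [set 0].
    apply/subsetP => W; rewrite !inE r0 => /andP[_ /andP[]].
    by rewrite mxrank_eq0.
  rewrite cards1 -(ler_nat R) => /le_trans; apply.
  by rewrite r0 mul0n expr0 mulr1; move: D1 c1; nra.
have h : #|Ws|%:R * (q ^+ r - 1) <= (q ^+ m.-1 + q - 2) * (D * q ^+ ((m.-1 - r) * (r - 1))).
  have -> : #|Ws|%:R * (q ^+ r - 1) = \sum_(W in Ws) #|rowg W :\ 0|%:R.
    rewrite mulr_natl -sumr_const; apply: eq_bigr => W; rewrite inE => /andP[_ /andP[/eqP rW _]].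
    have := cardsD1 0 (rowg W); rewrite inE sub0mx card_rowg rW => /(congr1 (fun n => n%:R : R)).
    by rewrite natrD natrX => ->; rewrite addrC addKr.
  have -> : \sum_(W in Ws) #|rowg W :\ 0|%:R =
      \sum_(v in eigenvectors T 1%:M :\ 0) #|[set W in Ws | (v <= W)%MS]|%:R :> R.
    under eq_bigr do rewrite -sum1_card natr_sum big_mkcond.
    under [RHS]eq_bigr do rewrite -sum1_card natr_sum big_mkcond.
    rewrite exchange_big /= [RHS]big_mkcond; apply: eq_bigr => v _.
    rewrite [LHS]big_mkcond /=; case: ifPn => ve.
      have v0 : v != 0 by move: ve; rewrite !inE => /andP[].
      apply: eq_bigr => W _; rewrite !in_setD1 v0 [in RHS]inE /= !inE.
      by case: (_ && _); case: (v <= W)%MS.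
    apply: big1 => W _; case: ifP => // WWs; case: ifP => //; rewrite !inE => /andP[v0 vW].
    case/negP: ve; move: WWs; rewrite !inE v0 submx1 /= => /andP[_ /andP[_ /existsP[c Wc]]].
    by rewrite (eigenspaceP (submx_trans vW Wc)) scalemx_sub.
  apply: (@le_trans _ _ (\sum_(v in eigenvectors T 1%:M :\ 0)
      (D * q ^+ ((m.-1 - r) * (r - 1))))).
    apply: ler_sum => v; rewrite !inE => /andP[v0 /andP[_ /sub_rVP[c vT]]].
    have cm : (\rank (eigenspace T c) <= m.-1)%N.
      rewrite -ltnS prednK ?(leq_trans (ltn0Sn r) rm) // ltn_neqAle rank_leq_row andbT.
      apply: contra T_nonscalar => full; apply/existsP; exists c.
      by rewrite sub1mx.
    have rv : \rank <<v>>%MS = 1 by rewrite genmxE rank_rV v0.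
    apply: (@le_trans _ _ #|between r <<v>>%MS (eigenspace T c)|%:R).
      rewrite ler_nat; apply: subset_leq_card; apply/subsetP => W.
      rewrite !inE genmxE => /andP[/andP[/andP[-> _] /andP[-> /existsP[b Wb]] vW]].
      rewrite vW /=; suff -> : c = b by [].
      have := eigenspaceP (submx_trans vW Wb); rewrite vT => /eqP.
      by rewrite -subr_eq0 -scalerBl scaler_eq0 (negPf v0) orbF subr_eq0 => /eqP.
    have [rc|cr] := leqP r (\rank (eigenspace T c)).
      have rr : (1 <= r <= \rank (eigenspace T c))%N by rewrite r0.
      apply: (le_trans (card_between_sparse rv erefl rr)).
      rewrite ler_pM2l // ler_eXn2l // leq_mul2r; apply/orP; right.
      exact: leq_sub2r.
    rewrite (_ : between _ _ _ = set0); last first.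
      apply/setP => W; rewrite !inE; apply: contraTF cr.
      by case/and4P => _ /eqP <- _ /mxrankS; rewrite -leqNgt.
    by rewrite cards0 mulr_ge0 ?exprn_ge0 // ltW.
  rewrite sumr_const -[leLHS]mulr_natl ler_wpM2r ?mulr_ge0 ?exprn_ge0 ?(ltW D0) ?(ltW q0) //.
  have := card_eigenvectors T_nonscalar; rewrite mxrank1 (cardsD1 0).
  rewrite !inE !sub0mx mul0mx sub0mx -(ler_nat R) -addn1 !natrD natrX /=; lra.
have qr : q <= q ^+ r by rewrite ler_eXnr // ltW.
have qm : q ^+ 2 <= q ^+ m.-1 by rewrite ler_eXn2l //; case: (m) m3 => [|[]].
have e : q ^+ m.-1 * q ^+ ((m.-1 - r) * (r - 1)) = q ^+ r * q ^+ (r * (m.-1 - r)).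
  rewrite -!exprD; congr (_ ^+ _); case: (r) r0 rm => // k _; case: (m) => // l /=.
  by rewrite ltnS subSS subn0 => kl; nia.
have q2 : 2 <= q by rewrite ler_nat; exact: card_finRing_gt1.
(* The left side bounds (q^(m-1) + q - 2) / q^(m-1), because m >= 3. *)
have ku : 1 + q^-1 - 2 * q^-1 ^+ 2 <= scalar_const * (1 - q^-1).
  rewrite /scalar_const /nonscalar_const; case: ifP => [/eqP ->|/negbT /q3 q3']; first lra.
  have : q^-1 <= 3^-1 by rewrite lef_pV2 ?posrE.
  by move: (q^-1) => u; nra.
have Z0 : 0 <= q ^+ ((m.-1 - r) * (r - 1)) by rewrite exprn_ge0 // ltW.
have Y0 : 0 <= q ^+ (r * (m.-1 - r)) by rewrite exprn_ge0 // ltW.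
have N0 : 0 <= #|Ws|%:R :> R by [].
move: h e qr qm ku N0 Z0 Y0.
move: (#|Ws|%:R) (q ^+ r) (q ^+ m.-1) (q ^+ (_ * (r - 1))) (q ^+ (r * _)).
move=> N Q M Z Y h e qr qm ku N0 Z0 Y0.
have u0 : 0 < q^-1 by rewrite invr_gt0.
have qu : q * q^-1 = 1 by rewrite mulfV // lt0r_neq0.
have u1 : 0 < 1 - q^-1 by rewrite subr_gt0 invf_lt1.
move: u0 qu u1 ku; move: (q^-1) => u u0 qu u1 ku.
have Q0 : 0 < Q := lt_le_trans q0 qr.
have M1 : 1 <= u ^+ 2 * M.
  by rewrite (_ : 1 = u ^+ 2 * q ^+ 2) ?ler_pM2l ?exprn_gt0 // -exprMn mulrC qu expr1n.
have s1 : M + q - 2 <= (1 + u - 2 * u ^+ 2) * M.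
  have -> : (1 + u - 2 * u ^+ 2) * M = M + (q - 2) * (u ^+ 2 * M).
    transitivity (M + (q * u) * (u * M) - 2 * u ^+ 2 * M); last ring.
    by rewrite qu; ring.
  by move: M1; move: (u ^+ 2 * M) => w; nra.
have s2 : Q * (1 - u) <= Q - 1.
  have : q * u <= Q * u by rewrite ler_pM2r.
  by rewrite qu mulrBr; lra.
have s3 : N * (1 - u) * Q <= (1 + u - 2 * u ^+ 2) * (D * Y) * Q.
  apply: (@le_trans _ _ (N * (Q - 1))).
    by rewrite -mulrA [(1 - u) * Q]mulrC ler_wpM2l.
  apply: (le_trans h).
  rewrite (_ : _ * (D * Y) * Q = (1 + u - 2 * u ^+ 2) * M * (D * Z)).
    by rewrite ler_wpM2r // mulr_ge0 // ltW.
  transitivity ((1 + u - 2 * u ^+ 2) * D * (Q * Y)); first ring.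
  by rewrite -e; ring.
have {s3} : N * (1 - u) <= (1 + u - 2 * u ^+ 2) * (D * Y) by rewrite -(ler_pM2r Q0).
move=> /le_trans s3; rewrite -(ler_pM2r u1); apply: s3.
rewrite -mulrA mulrAC ler_wpM2r // mulr_ge0 // ltW //.
Qed.

(** Dimension r contributes to the term r of theta(m - 1) through the
    subspaces on which T is scalar, and to the term r - 1 through the others. *)
Theorem card_stable_le : (3 <= m)%N -> T \in unitmx ->
  #|stable_subs T|%:R <= 4 * D * theta q m.-1.
Proof.
move=> m3 Tu; rewrite card_stable_split natr_sum.
under eq_bigr do rewrite natrD.
rewrite big_split /= (_ : 4 * D * theta q m.-1 =
  scalar_const * D * theta q m.-1 + nonscalar_const * D * theta q m.-1); last first.
  by rewrite -!mulrDl /scalar_const subrK.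
have mE : m = m.-1.+1 by case: (m) m3.
have D0' := ltW D0.
have c0 : 0 <= nonscalar_const by rewrite /nonscalar_const; case: ifP => _; lra.
apply: lerD.
  rewrite big_ord_recr /= [X in _ + X](_ : _ = 0) ?addr0.
    rewrite /theta mulr_sumr -mE; apply: ler_sum => r _; exact: card_scalar_le.
  rewrite (_ : [set _ in _ | _] = set0) ?cards0 //; apply/setP => W; rewrite !inE.
  apply/negP => /andP[_ /andP[/eqP Wm /existsP[c Wc]]].
  case/negP: T_nonscalar; apply/existsP; exists c; apply: submx_trans Wc.
  by rewrite sub1mx /row_full Wm.
rewrite big_ord_recl /= [X in X + _](_ : _ = 0) ?add0r; last first.
  rewrite (_ : [set _ in _ | _] = set0) ?cards0 //; apply/setP => W; rewrite !inE.
  apply/negP => /andP[_ /andP[]]; rewrite mxrank_eq0 => /eqP -> /existsP[].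
  by exists 0; apply: sub0mx.
rewrite /theta mulr_sumr -mE; apply: ler_sum => r _; rewrite /bump /= add1n.
have [r0|r0] := posnP r.
  rewrite (_ : [set _ in _ | _] = set0) ?cards0; last first.
    apply/setP => W; rewrite !inE; apply/negP => /andP[/andP[_ WT]].
    rewrite r0 => /andP[/eqP W1] /existsP[].
    have v0 : nz_row W != 0 by rewrite nz_row_eq0 -mxrank_eq0 W1.
    have Wv : (W <= nz_row W)%MS.
      by rewrite -(mxrank_leqif_sup (nz_row_sub W)).2 W1 rank_rV v0.
    have /sub_rVP[c vT] := submx_trans (submx_trans (submxMr T (nz_row_sub W)) WT) Wv.
    by exists c; apply: submx_trans Wv _; apply/eigenspaceP.
  by rewrite !mulr_ge0 // exprn_ge0 // ltW.
have rr : (2 <= r.+1 <= m)%N by have := ltn_ord r; lia.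
apply: (le_trans (card_nonscalar_le rr Tu)).
by rewrite subn1 /= (_ : m - r.+1 = m.-1 - r)%N //; lia.
Qed.

End StableCount.

(** * Linear relations between a tuple and its image *)

Section Relations.
Local Open Scope ring_scope.
Variables (F : finFieldType) (m : nat) (T : 'M[F]_m).
Local Notation q := #|F|.
Implicit Types (W : 'M[F]_m) (c : F) (j : nat).

Lemma card_row_submx j W : #|[set X : 'M[F]_(j, m) | (X <= W)%MS]| = (q ^ (j * \rank W))%N.
Proof.
rewrite -card_mx; have injW : injective (fun X : 'M_(j, \rank W) => X *m row_base W).
  exact/row_free_inj/row_base_free.
rewrite -(card_image injW); apply: eq_card => X.
by rewrite inE -(eq_row_base W) (sameP submxP codomP).
Qed.

Definition relation_set j W (a b : 'rV[F]_j) : {set 'M[F]_(j, m)} :=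
  [set X | (X <= W)%MS && (a *m X + b *m X *m T == 0)].

(** The linear map X |-> a X + b X T on the tuples in W takes the tuple x w,
    for w in W, to w (s + t T). So its image contains that of W under s + t T,
    and its kernel is accordingly small. *)
Lemma card_relation j W (a b : 'rV[F]_j) (x : 'cV[F]_j) (s t : F) :
  a *m x = s%:M -> b *m x = t%:M ->
  (#|relation_set W a b| * q ^ \rank (W *m (s%:M + t *: T)) <=
   q ^ (j * \rank W))%N.
Proof.
move=> ax bx; set M := W *m _.
rewrite -card_rowg -cardsX -card_row_submx.
(* A tuple in W that the linear map takes to z, for z in the image of W. *)
pose lift (z : 'rV[F]_m) := x *m (z *m pinvmx M *m W).
have rel_lift z : (z <= M)%MS -> a *m lift z + b *m lift z *m T = z.
  move=> zM; rewrite -[RHS](mulmxKpV zM) /lift; move: (z *m pinvmx M) => y.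
  rewrite ![_ *m (x *m _)]mulmxA ax bx !mul_scalar_mx /M mulmxA mulmxDr mul_mx_scalar.
  by rewrite -scalemxAl -scalemxAr.
pose f (Xz : 'M[F]_(j, m) * 'rV[F]_m) := Xz.1 + lift Xz.2.
have fz X z : X \in relation_set W a b -> (z <= M)%MS ->
    a *m f (X, z) + b *m f (X, z) *m T = z.
  rewrite inE => /andP[_ /eqP h] zM; rewrite /f /= !mulmxDr mulmxDl addrACA h add0r.
  exact: rel_lift.
have injf : {in setX (relation_set W a b) (rowg M) &, injective f}.
  move=> [X z] [X' z'] /setXP[/= Xr zM] /setXP[/= Xr' zM'] e.
  rewrite inE in zM; rewrite inE in zM'.
  have ez : z = z' by rewrite -(fz X z) // e fz.
  by move: e; rewrite /f /= ez => /addIr ->.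
rewrite -(card_in_imset injf); apply: subset_leq_card; apply/subsetP => Y.
move=> /imsetP[[X z] /setXP[/= + _] ->]; rewrite !inE => /andP[XW _].
by rewrite /f addmx_sub //= /lift mulmxA submxMl.
Qed.

(** Unless a is a nonzero multiple of b, some x gives (s, t) the value (1, 0)
    or (0, 1), and then s + t T is invertible. *)
Lemma card_relation_small j W (a b : 'rV[F]_j) : T \in unitmx ->
  (a != 0) || (b != 0) -> (forall c, c != 0 -> b != 0 -> a != - c *: b) ->
  (#|relation_set W a b| * q ^ \rank W <= q ^ (j * \rank W))%N.
Proof.
move=> Tu ab nab.
have pick_col (u : 'rV[F]_j) : u != 0 -> exists x : 'cV[F]_j, u *m x = 1%:M.
  move=> u0; have /row_freeP[x ux] : row_free u by rewrite /row_free rank_rV u0.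
  by exists x.
have [b0|b0] := eqVneq b 0.
  move: ab; rewrite b0 eqxx orbF => /pick_col[x ax].
  have bx : (0 : 'rV_j) *m x = 0%:M by rewrite mul0mx raddf0.
  by have := card_relation W ax bx; rewrite scale0r addr0 mulmx1.
have [a0|a0] := eqVneq a 0.
  have [x bx] := pick_col _ b0.
  have ax : (0 : 'rV_j) *m x = 0%:M by rewrite mul0mx raddf0.
  have := card_relation W ax bx; rewrite scale1r raddf0 add0r a0.
  by rewrite mxrankMfree // row_free_unit.
have nsub : ~~ (a <= b)%MS.
  apply/negP => /sub_rVP[c ac]; have c0 : c != 0.
    by apply: contraNneq a0 => c0; rewrite ac c0 scale0r.
  by have := nab (- c); rewrite oppr_eq0 opprK ac eqxx => /(_ c0 b0).
have [x bx ax] : exists2 x : 'cV[F]_j, b *m x = 0%:M & a *m x = 1%:M.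
  have [u au] : exists u, a *m cokermx b *m u = 1%:M.
    apply: pick_col; by rewrite -submxE.
  by exists (cokermx b *m u); rewrite [_ *m (_ *m u)]mulmxA // mulmx_coker mul0mx raddf0.
by have := card_relation W ax bx; rewrite scale0r addr0 mulmx1.
Qed.

(** Here s + t T is T - c, whose kernel in W is the eigenspace for c. *)
Lemma card_relation_eigen j W (b : 'rV[F]_j) c : b != 0 ->
  (#|relation_set W (- c *: b) b| * q ^ \rank W <=
   q ^ (j * \rank W) * q ^ \rank (W :&: eigenspace T c)%MS)%N.
Proof.
move=> b0; have /row_freeP[x bx] : row_free b by rewrite /row_free rank_rV b0.
have ax : (- c *: b) *m x = (- c)%:M by rewrite -scalemxAl bx scalemx1.
have := card_relation W ax bx; rewrite scale1r [_ + T]addrC raddfN.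
rewrite -(mxrank_mul_ker W (T - c%:M)) expnD mulnA => h.
by rewrite leq_mul2r h orbT.
Qed.

(** Union bound over the nonzero pairs (a, b) of coefficient vectors of a
    relation a X + b X T = 0, which a tuple that is not spread satisfies; a
    relation and its q - 1 nonzero multiples say the same, whence the factor q
    - 1. The only relations satisfied by more than a proportion q^(- rank W)
    of the tuples are those with a = - c b, of which there are q^j - 1 for
    every c <> 0. *)
Lemma card_nonspread j W : T \in unitmx ->
  ((q - 1) * #|[set X : 'M[F]_(j, m) | (X <= W)%MS] :\: spread T j W| * q ^ \rank W <=
   (q ^ j.*2 + (q ^ j - 1) * \sum_(c | c != 0%R) q ^ \rank (W :&: eigenspace T c)%MS) *
     q ^ (j * \rank W))%N.
Proof.
move=> Tu; set bad := _ :\: _.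
apply: (@leq_trans ((\sum_(ab : 'rV[F]_j * 'rV[F]_j | ab != 0%R) #|relation_set W ab.1 ab.2|) * q ^ \rank W)%N).
  rewrite leq_mul2r; apply/orP; right.
  apply: (@leq_trans (\sum_(X in bad)
      #|[set ab : 'rV[F]_j * 'rV[F]_j | (ab != 0%R) && (X \in relation_set W ab.1 ab.2)]|)%N).
    rewrite mulnC -sum_nat_const; apply: leq_sum => X; rewrite !inE => /andP[+ XW].
    rewrite XW /= => rX.
    have [u u0 uX] : exists2 u : 'rV_(j + j), u != 0 & u *m col_mx X (X *m T) = 0.
      have : kermx (col_mx X (X *m T)) != 0.
        by move: rX; rewrite kermx_eq0 /row_free -addnn.
      move=> k0; exists (nz_row (kermx (col_mx X (X *m T)))); rewrite ?nz_row_eq0 //.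
      by apply/sub_kermxP; apply: nz_row_sub.
    (* The q - 1 multiples of one relation. *)
    pose g (c : F) := (c *: lsubmx u, c *: rsubmx u).
    have g0 : (lsubmx u != 0) || (rsubmx u != 0).
      by rewrite -negb_and; apply: contra u0 => /andP[/eqP l0 /eqP r0];
        rewrite -(hsubmxK u) l0 r0 row_mx0.
    have injg : injective g.
      move=> c c' gg; have := congr1 fst gg; have := congr1 snd gg; rewrite /= {gg}.
      have cancel (v : 'rV[F]_j) : v != 0 -> c *: v = c' *: v -> c = c'.
        move=> v0 /eqP; rewrite -subr_eq0 -scalerBl scaler_eq0 (negPf v0) orbF.
        by rewrite subr_eq0 => /eqP.
      by case/orP: g0 => /cancel cv; [move=> _ /cv | move=> /cv].
    have -> : (q - 1 = #|[set~ (0%R : F)]|)%N.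
      by rewrite cardsC1 subn1.
    rewrite -(card_imset _ injg); apply: subset_leq_card.
    apply/subsetP => _ /imsetP[c + ->]; rewrite !inE XW /= => c0.
    rewrite -pair_eqE /= negb_and !scaler_eq0 (negPf c0) /= g0 /=.
    rewrite -!scalemxAl -scalerDr -mulmxA -mul_row_col hsubmxK uX scaler0 //.
  under eq_bigr do rewrite -sum1_card big_mkcond.
  under [leqRHS]eq_bigr do rewrite -sum1_card big_mkcond.
  rewrite exchange_big /= [leqRHS]big_mkcond /=; apply: leq_sum => ab _.
  rewrite big_mkcond /=; case: ifP => ab0.
    apply: leq_sum => X _; rewrite !inE; case: ifP => // _.
    by case: and3P => [[_ -> ->]|].
  rewrite leqn0; apply/eqP; apply: big1 => X _; case: ifP => // _.
  by rewrite inE; case: andP => // -[h _]; case/negP: (negbT ab0).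
apply: (@leq_trans (\sum_(ab : 'rV[F]_j * 'rV[F]_j)
   (q ^ (j * \rank W) + \sum_(c | c != 0%R) (if (ab.2 != 0%R) && (ab.1 == - c *: ab.2)%R then
      q ^ (j * \rank W) * q ^ \rank (W :&: eigenspace T c)%MS else 0)))%N).
  rewrite big_distrl /= [leqLHS]big_mkcond; apply: leq_sum => -[a b] _ /=; case: ifP => // ab0.
  have [/existsP[c /andP[c0 /andP[b0 /eqP ->]]]|] :=
      boolP [exists c, (c != 0) && ((b != 0) && (a == - c *: b))].
    apply: leq_trans (card_relation_eigen W c b0) _.
    by rewrite (bigD1 c) //= b0 eqxx /= addnCA leq_addr.
  rewrite negb_exists => /forallP nab; apply: leq_trans (leq_addr _ _).
  apply: card_relation_small => //.
    by move: ab0; rewrite -pair_eqE negb_and.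
  by move=> c c0 b0; have := nab c; rewrite c0 b0.
rewrite big_split /= sum_nat_const card_prod !card_mx mul1n -expnD addnn mulnDl leq_add2l.
rewrite exchange_big /= big_distrr big_distrl /=; apply: leq_sum => c c0.
rewrite -big_mkcond /= sum_nat_const [(_ * _ * q ^ (j * _))%N]mulnAC -mulnA leq_mul2r.
apply/orP; right.
pose g (b : 'rV[F]_j) := (- c *: b, b)%R.
have -> : (q ^ j - 1 = #|[set~ (0%R : 'rV[F]_j)]|)%N by rewrite cardsC1 card_mx mul1n subn1.
have injg : injective g by move=> b b' /(congr1 snd).
rewrite -(card_imset _ injg); apply: subset_leq_card; apply/subsetP => -[a b].
rewrite unfold_in /= => /andP[b0 /eqP ->].
by apply/imsetP; exists b; rewrite ?inE.
Qed.

End Relations.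

(** * Spread tuples of five vectors *)

Section FarFromScalar.
Local Open Scope ring_scope.
Variables (R : realFieldType) (F : finFieldType) (m : nat) (T : 'M[F]_m).
Local Notation q := (#|F|%:R : R).
Implicit Types (W : 'M[F]_m) (c : F) (r : nat).
Hypothesis T_unit : T \in unitmx.

Let q1 : 1 < q := card_field_gt1 R F.
Let q0 : 0 < q := lt_trans ltr01 q1.

Lemma rank_eigenspaces_disjoint W c c' : c != c' ->
  (\rank (W :&: eigenspace T c) + \rank (W :&: eigenspace T c') <= \rank W)%N.
Proof.
move=> cc'; rewrite -mxrank_sum_cap.
set X := (_ :&: eigenspace T c :&: _)%MS; suff X0 : X = 0.
  by rewrite X0 mxrank0 addn0 mxrankS // addsmx_sub !capmxSl.
have XE b : (X <= eigenspace T b)%MS -> X *m T = b *: X by move/eigenspaceP.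
have e1 : X *m T = c *: X.
  by apply: XE; rewrite (submx_trans (capmxSl _ _)) // capmxSr.
have e2 : X *m T = c' *: X.
  by apply: XE; rewrite (submx_trans (capmxSr _ _)) // capmxSr.
move/eqP: e2; rewrite e1 -subr_eq0 -scalerBl scaler_eq0 subr_eq0 (negPf cc') /=.
by move/eqP.
Qed.

(** The eigenspaces in W for distinct c are independent, so all but the
    largest have dimension at most r / 2, and r / 2 <= r - 9 since r >= 18. *)
Lemma sum_eigen_le W r : \rank W = r -> (18 <= r)%N ->
  (forall c, \rank (W :&: eigenspace T c) + 5 <= r)%N ->
  \sum_(c | c != 0) q ^+ \rank (W :&: eigenspace T c)%MS <=
    q ^+ (r - 5) + (q - 2) * q ^+ (r - 9).
Proof.
move=> rW r18 far; pose f c := \rank (W :&: eigenspace T c)%MS.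
have [c0 c00 cmax] : exists2 c0, c0 != 0 & forall c, c != 0 -> (f c <= f c0)%N.
  by case: (@arg_maxnP F 1 (fun c => c != 0) f (oner_neq0 _)) => c0; exists c0.
rewrite (bigD1 c0) //=; apply: lerD.
  by rewrite ler_eXn2l //; have := far c0; lia.
apply: (@le_trans _ _ (\sum_(c | (c != 0) && (c != c0)) q ^+ (r - 9))).
  apply: ler_sum => c /andP[c1 cc]; rewrite ler_eXn2l //.
  have := rank_eigenspaces_disjoint W cc; have := cmax c c1; rewrite /f rW; lia.
rewrite sumr_const -[leLHS]mulr_natl ler_wpM2r ?exprn_ge0 ?(ltW q0) //.
have -> : #|(fun c => (c != 0) && (c != c0))| = #|~: [set 0; c0]|.
  by apply: eq_card => c; rewrite !inE unfold_in negb_or.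
have := cardsC [set 0; c0]; rewrite cards2 eq_sym c00 => /(congr1 (fun n => n%:R : R)).
rewrite natrD /=. lra.
Qed.

(** By [card_nonspread] and [sum_eigen_le] the proportion of tuples that are
    not spread is at most (q^10 + (q^5 - 1) (q^(r-5) + (q - 2) q^(r-9))) / ((q
    - 1) q^r), which is largest for q = 2, where it is less than 63 / 64. *)
Lemma card_spread5 W r : \rank W = r -> (18 <= r)%N ->
  (forall c, \rank (W :&: eigenspace T c) + 5 <= r)%N ->
  64^-1 * q ^+ (r * 5) <= #|spread T 5 W|%:R.
Proof.
move=> rW r18 far; have sumE := sum_eigen_le rW r18 far.
set bad := [set X : 'M[F]_(5, m) | (X <= W)%MS] :\: spread T 5 W.
have cardE : #|spread T 5 W|%:R + #|bad|%:R = q ^+ (r * 5).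
  rewrite -natrD -natrX [(r * 5)%N]mulnC -rW -card_row_submx -(cardsID (spread T 5 W) [set X : 'M[F]_(5, m) | (X <= W)%MS]).
  rewrite (_ : _ :&: spread T 5 W = spread T 5 W) //.
  by apply/setP => X; rewrite !inE; case: (X <= W)%MS.
have h : (q - 1) * #|bad|%:R * q ^+ r <=
   (q ^+ 10 + (q ^+ 5 - 1) * \sum_(c | c != 0) q ^+ \rank (W :&: eigenspace T c)%MS) *
     q ^+ (r * 5).
  have := card_nonspread 5 W T_unit; rewrite -/bad -(ler_nat R) rW.
  have gt1 := card_finRing_gt1 F.
  rewrite [leLHS]natrM natrM natrX natrB 1?ltnW //.
  rewrite [leRHS]natrM natrX natrD natrX natrM natrB ?expn_gt0 ?(ltnW gt1) // natrX.
  rewrite natr_sum; under eq_bigr do rewrite natrX.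
  by rewrite [(5 * r)%N]mulnC.
pose u : R := q^-1.
have qu : q * u = 1 by rewrite /u mulfV // lt0r_neq0.
have u0 : 0 < u by rewrite invr_gt0.
have q2 : 2 <= q by rewrite ler_nat card_finRing_gt1.
have Q0 : 0 < q ^+ r by rewrite exprn_gt0.
have low k : (k <= r)%N -> q ^+ (r - k) = q ^+ r * u ^+ k.
  by move=> kr; rewrite -{2}(subnK kr) exprD -mulrA -exprMn qu expr1n mulr1.
have q10 : q ^+ 10 <= q ^+ r * u ^+ 8.
  by rewrite -low ?(leq_trans _ r18) // ler_eXn2l //; lia.
have hB : (q - 1) * #|bad|%:R <= (63 / 64) * (q - 1) * q ^+ (r * 5).
  rewrite -(ler_pM2r Q0); apply: (le_trans h).
  rewrite [leRHS]mulrAC ler_wpM2r ?exprn_ge0 ?(ltW q0) //.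
  move: sumE; rewrite !low ?(leq_trans _ r18) // => sumE.
  have q51 : 0 <= q ^+ 5 - 1 by rewrite subr_ge0 exprn_ege1 // ltW.
  apply: (@le_trans _ _ (q ^+ r * u ^+ 8 +
      (q ^+ 5 - 1) * (q ^+ r * u ^+ 5 + (q - 2) * (q ^+ r * u ^+ 9)))).
    by apply: lerD => //; apply: ler_wpM2l.
  have -> : q ^+ r * u ^+ 8 + (q ^+ 5 - 1) * (q ^+ r * u ^+ 5 + (q - 2) * (q ^+ r * u ^+ 9)) =
      (u ^+ 8 + (q * u) ^+ 5 - u ^+ 5 + (q * u) ^+ 6 * u ^+ 3 - 2 * (q * u) ^+ 5 * u ^+ 4
        - (q - 2) * u ^+ 9) * q ^+ r.
    by move: (q ^+ r) => Y; ring.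
  rewrite ler_wpM2r ?(ltW Q0) // qu !expr1n.
  have : 0 <= (q - 2) * u ^+ 9 by rewrite mulr_ge0 ?subr_ge0 ?exprn_ge0 // ltW.
  have [q2'|q3] : q = 2 \/ 3 <= q.
    have := card_finRing_gt1 F; rewrite leq_eqVlt => /orP[/eqP <-|q3]; first by left.
    by right; rewrite ler_nat.
    by rewrite (_ : u = 2^-1) ?q2'; [lra | rewrite /u q2'].
  have u3 : u <= 3^-1 by rewrite /u lef_pV2 ?posrE.
  have uX k : u ^+ k.+1 <= 3^-1.
    rewrite exprS -[leRHS]mulr1; apply: ler_pM; rewrite ?exprn_ge0 ?(ltW u0) //.
    by apply: exprn_ile1; rewrite ?(ltW u0) // (le_trans u3) //; lra.
  have := uX 7; have := uX 2; have : 0 <= u ^+ 5 by rewrite exprn_ge0 // ltW.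
  have : 0 <= u ^+ 4 by rewrite exprn_ge0 // ltW.
  by move: (u ^+ 8) (u ^+ 3) (u ^+ 4) (u ^+ 5) ((q - 2) * _) => *; lra.
have {}hB : #|bad|%:R <= 63 / 64 * q ^+ (r * 5).
  by rewrite -(ler_pM2l (_ : 0 < q - 1)) ?subr_gt0 // (le_trans hB) // mulrCA mulrA.
by move: hB cardE; move: (q ^+ (r * 5)) => Y; lra.
Qed.

End FarFromScalar.

(** * Stable subspaces when every eigenspace is small *)

Lemma leq_card_bigcup (I S : finType) (P : pred I) (A : I -> {set S}) :
  (#|\bigcup_(i | P i) A i| <= \sum_(i | P i) #|A i|)%N.
Proof.
apply: (big_ind2 (fun (B : {set S}) k => #|B| <= k)%N); rewrite ?cards0 //.
move=> B1 k1 B2 k2 h1 h2; exact: leq_trans (leq_card_setU _ _) (leq_add h1 h2).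
Qed.

Section FarCount.
Local Open Scope ring_scope.
Variables (R : realFieldType) (F : finFieldType) (m : nat) (T : 'M[F]_m).
Local Notation q := (#|F|%:R : R).
Implicit Types (W : 'M[F]_m) (c : F) (r : nat).
Variable D : R.
Hypothesis euler_le : forall k, euler_prod q k <= D.
Hypothesis T_unit : T \in unitmx.

Let q1 : 1 < q := card_field_gt1 R F.
Let q0 : 0 < q := lt_trans ltr01 q1.
Let D1 : 1 <= D.
Proof. by have := euler_le 0; rewrite /euler_prod big_geq. Qed.
Let D0 : 0 < D := lt_le_trans ltr01 D1.

Hypothesis T_far : forall c, (\rank (eigenspace T c) + 9 <= m)%N.

Definition stable_of_rank r := [set W in stable_subs T | \rank W == r].

(** Truncate a basis of the row space of A. *)
Lemma exists_subspace_rank (A : 'M[F]_m) k : (k <= \rank A)%N ->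
  exists2 U : 'M[F]_m, <<U>>%MS = U & \rank U = k /\ (U <= A)%MS.
Proof.
move=> kA; pose X : 'M[F]_(m, \rank A) := pid_mx k.
exists <<X *m row_base A>>%MS; first exact: genmx_id.
rewrite !genmxE mxrankMfree ?row_base_free // rank_pid_mx //.
  by split=> //; rewrite (submx_trans (submxMl _ _)) // eq_row_base.
exact: leq_trans kA (rank_leq_col A).
Qed.

(** Such a W contains a subspace U of dimension r - 4 of an eigenspace. There
    are at most q eigenvalues; each eigenspace has dimension at most m - 9,
    which gives about q^((r - 4) (m - 5 - r)) choices of U; and W is one of
    about q^(4 (m - r)) subspaces that contain U. Altogether the exponent is r
    (m - 5 - r) + 21. *)
Lemma card_near_scalar_le r : (4 <= r <= m)%N ->
  #|[set W in stable_of_rank r |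
      [exists c, (r <= \rank (W :&: eigenspace T c) + 4)%N]]|%:R <=
    if (r <= m - 5)%N then D ^+ 2 * q ^+ 21 * q ^+ (r * (m - 5 - r)) else 0.
Proof.
move=> /andP[r4 rm]; set Ws := [set _ in _ | _].
have [r5|r5] := leqP; last first.
  rewrite (_ : Ws = set0) ?cards0 //; apply/setP => W; rewrite !inE; apply/negP.
  move=> /andP[/andP[_ _] /existsP[c]].
  have := T_far c; have := mxrankS (capmxSr W (eigenspace T c)); lia.
apply: (@le_trans _ _ (\sum_c \sum_(U in between (r - 4) (0 : 'M_m) (eigenspace T c))
    #|between r U 1%:M|%:R)).
  under eq_bigr do rewrite -natr_sum.
  rewrite -natr_sum ler_nat.
  apply: (@leq_trans #|\bigcup_c \bigcup_(U in between (r - 4) (0 : 'M_m) (eigenspace T c))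
    between r U 1%:M|).
    apply: subset_leq_card; apply/subsetP => W; rewrite !inE.
    move=> /andP[/andP[/andP[gW WT] /eqP rW] /existsP[c Wc]].
    have [|U gU [rU UW]] := @exists_subspace_rank (W :&: eigenspace T c)%MS (r - 4); first by lia.
    apply/bigcupP; exists c => //; apply/bigcupP; exists U.
      by rewrite inE gU rU !eqxx sub0mx /= (submx_trans UW) // capmxSr.
    by rewrite inE gW rW eqxx submx1 /= (submx_trans UW) // capmxSl.
  apply: (leq_trans (leq_card_bigcup _ _ )).
  by apply: leq_sum => c _; apply: leq_card_bigcup.
apply: (@le_trans _ _ (\sum_(c : F) D ^+ 2 * q ^+ (20 + r * (m - 5 - r)))).
  apply: ler_sum => c _.
  apply: (@le_trans _ _ (\sum_(U in between (r - 4) (0 : 'M_m) (eigenspace T c)) D * q ^+ ((m - r) * 4))).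
    apply: ler_sum => U; rewrite inE => /and4P[_ /eqP rU _ _].
    have rr : (r - 4 <= r <= m)%N by rewrite leq_subr.
    apply: le_trans (card_between_sparse euler_le rU (mxrank1 F m) rr) _.
    by rewrite subKn.
  rewrite sumr_const -[leLHS]mulr_natl.
  have [re|er] := leqP (r - 4) (\rank (eigenspace T c)); last first.
    rewrite (_ : between _ _ _ = set0); last first.
      apply/setP => W; rewrite !inE; apply: contraTF er.
      by case/and4P => _ /eqP <- _ /mxrankS; rewrite -leqNgt.
    by rewrite cards0 mul0r mulr_ge0 ?exprn_ge0 // ltW.
  have rr : (0 <= r - 4 <= \rank (eigenspace T c))%N by [].
  apply: (@le_trans _ _ (D * q ^+ ((m - 9 - (r - 4)) * (r - 4)) * (D * q ^+ ((m - r) * 4)))).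
    rewrite ler_wpM2r ?mulr_ge0 ?exprn_ge0 ?(ltW D0) ?(ltW q0) //.
    apply: le_trans (card_between_sparse euler_le (mxrank0 _ _ _) erefl rr) _.
    rewrite ler_pM2l // ler_eXn2l // subn0 leq_mul2r; apply/orP; right.
    by have := T_far c; lia.
  rewrite (_ : D * _ * (D * _) = D ^+ 2 * (q ^+ ((m - 9 - (r - 4)) * (r - 4)) * q ^+ ((m - r) * 4))).
    rewrite -exprD ler_pM2l ?exprn_gt0 // ler_eXn2l //.
    have [s [t [-> ->]]] : exists s t, r = (s + 4)%N /\ m = (s + 4 + t + 5)%N.
      by exists (r - 4)%N, (m - 5 - r)%N; lia.
    by nia.
  by rewrite expr2; ring.
have -> : \sum_(c : F) D ^+ 2 * q ^+ (20 + r * (m - 5 - r)) =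
    q * (D ^+ 2 * q ^+ (20 + r * (m - 5 - r))) by rewrite sumr_const -[LHS]mulr_natl.
rewrite exprD [q ^+ 21]exprS; move: (q ^+ 20) (q ^+ (r * _)) => x y.
by rewrite (_ : q * _ = D ^+ 2 * (q * x) * y) //; ring.
Qed.

Lemma card_far_scalar_le r : (18 <= r <= m)%N ->
  #|[set W in stable_of_rank r |
      [forall c, (\rank (W :&: eigenspace T c) + 5 <= r)%N]]|%:R <=
    64 * D * q ^+ ((r - 5) * (m - r)).
Proof.
move=> /andP[r18 rm].
rewrite -mulrA -ler_pdivrMl // mulrC; apply: (@spread_bound R F m T D euler_le 5) => //.
- by rewrite rm andbT (leq_trans _ r18).
- by move=> W; rewrite !inE => /andP[/andP[-> /eqP ->]].
move=> W; rewrite !inE => /andP[/andP[_ /eqP rW] /forallP far].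
exact: card_spread5.
Qed.

(** The subspaces fall into three kinds: those of dimension less than 18,
    where [card_spread5] says nothing and the trivial bound is small enough;
    those that meet an eigenspace in codimension at most 4; and those to which
    [card_spread5] applies. *)
Lemma card_stable_of_rank_le r : (r <= m)%N ->
  #|stable_of_rank r|%:R <=
    (if (r < 18)%N then D * q ^+ (r * (m - r)) else 0) +
    ((if (r <= m - 5)%N then D ^+ 2 * q ^+ 21 * q ^+ (r * (m - 5 - r)) else 0) +
     (if (5 <= r)%N then 64 * D * q ^+ ((r - 5) * (m - r)) else 0)).
Proof.
move=> rm.
have nb0 : 0 <= (if (r <= m - 5)%N then D ^+ 2 * q ^+ 21 * q ^+ (r * (m - 5 - r)) else 0).
  by case: ifP => // _; rewrite !mulr_ge0 ?exprn_ge0 ?(ltW D0) ?(ltW q0).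
have fb0 : 0 <= (if (5 <= r)%N then 64 * D * q ^+ ((r - 5) * (m - r)) else 0).
  by case: ifP => // _; rewrite !mulr_ge0 ?exprn_ge0 ?(ltW D0) ?(ltW q0).
case: ltnP => r18.
  apply: ler_wpDr; first exact: addr_ge0.
  have rr : (0 <= r <= m)%N by [].
  apply: le_trans (_ : #|between r (0 : 'M[F]_m) 1%:M|%:R <= _).
    rewrite ler_nat; apply: subset_leq_card; apply/subsetP => W.
    by rewrite !inE sub0mx submx1 => /andP[/andP[-> _] ->].
  apply: le_trans (card_between_sparse euler_le (mxrank0 _ _ _) (mxrank1 F m) rr) _.
  by rewrite subn0 mulnC.
have h1 : (4 <= r <= m)%N by rewrite rm (leq_trans _ r18).
have h2 : (18 <= r <= m)%N by rewrite r18.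
rewrite add0r (leq_trans _ r18) //.
apply: le_trans (lerD (card_near_scalar_le h1) (card_far_scalar_le h2)).
rewrite -natrD ler_nat.
apply: (leq_trans _ (leq_card_setU _ _)).
apply: subset_leq_card; apply/subsetP => W Ws; rewrite !inE.
have := Ws; rewrite !inE => ->; rewrite /= orbC.
case: (boolP [forall c, _]) => //=; rewrite negb_forall => /existsP[c Wc].
by apply/existsP; exists c; move: Wc; rewrite -ltnNge; lia.
Qed.

(** The exponent r (m - r) increases strictly up to r = 17, so that each term
    is at most half of the next. *)
Lemma low_rank_sum k : (k <= 17)%N -> (37 <= m)%N ->
  \sum_(r < k.+1) q ^+ (r * (m - r)) <= 2 * q ^+ (k * (m - k)).
Proof.
move=> + m37; elim: k => [|k IH] k17.
  by rewrite big_ord1 !mul0n !expr0; lra.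
rewrite big_ord_recr /=; apply: (le_trans (lerD (IH (ltnW k17)) (lexx _))).
have -> : (k.+1 * (m - k.+1) = (k * (m - k) + (m - k.*2.+2)).+1)%N.
  have [s ->] : exists s, m = (k.+1 + k.+1 + s)%N by exists (m - k.+1 - k.+1)%N; lia.
  nia.
have q2 : 2 <= q by rewrite ler_nat card_finRing_gt1.
have : q ^+ (k * (m - k)) <= q ^+ (k * (m - k) + (m - k.*2.+2)).
  by rewrite ler_eXn2l // leq_addr.
have : 0 < q ^+ (k * (m - k)) by rewrite exprn_gt0.
rewrite exprS; move: (q ^+ (_ + _)) (q ^+ (k * _)) => y x; nra.
Qed.

Theorem card_stable_far_le : (37 <= m)%N ->
  #|stable_subs T|%:R <= (D ^+ 2 * q ^+ 21 + 64 * D) * theta q (m - 5) +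
     2 * D * q ^+ (17 * (m - 17)).
Proof.
move=> m37.
rewrite card_by_rank natr_sum.
apply: (@le_trans _ _ (\sum_(r < m.+1) (
    (if (r < 18)%N then D * q ^+ (r * (m - r)) else 0) +
    ((if (r <= m - 5)%N then D ^+ 2 * q ^+ 21 * q ^+ (r * (m - 5 - r)) else 0) +
     (if (5 <= r)%N then 64 * D * q ^+ ((r - 5) * (m - r)) else 0))))).
  by apply: ler_sum => r _; apply: card_stable_of_rank_le; rewrite -ltnS.
rewrite big_split /= [leLHS]addrC; apply: lerD.
  rewrite [leLHS]big_split [leRHS]mulrDl /=; apply: lerD.
    rewrite -big_mkcond /= /theta mulr_sumr.
    rewrite (big_ord_widen m.+1 (fun r => D ^+ 2 * q ^+ 21 * q ^+ (r * (m - 5 - r)))) //.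
    by rewrite ltnS leq_subr.
  have e : (m.+1 = 5 + (m - 5).+1)%N by lia.
  rewrite e big_split_ord /= big1 ?add0r; last by move=> i _; rewrite leqNgt ltn_ord.
  rewrite /theta mulr_sumr; apply: ler_sum => r _; by rewrite addKn subnDA.
rewrite -big_mkcond /=.
rewrite -(big_ord_widen m.+1 (fun r => D * q ^+ (r * (m - r)))); last by lia.
rewrite -mulr_sumr -mulrA mulrCA ler_pM2l //.
exact: low_rank_sum.
Qed.

End FarCount.

(** * Estimates of theta *)

Section ThetaBounds.
Local Open Scope ring_scope.
Variables (R : realFieldType) (q : R).
Hypothesis q2 : 2 <= q.

(** Partial sums of C(q), over the integers r with -N <= r < N; a negative r
    is written - (i + 1). *)
Definition gauss_sum (N : nat) : R :=
  \sum_(i < N) q ^- (i ^ 2) + \sum_(i < N) q ^- (i.+1 ^ 2).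

Let q0 : 0 < q. Proof. by apply: lt_le_trans q2. Qed.
Let q1 : 1 < q. Proof. by apply: lt_le_trans q2; lra. Qed.

Let powB a b c : (a = b + c)%N -> q ^+ b = q ^+ a * q ^- c.
Proof. by move=> ->; rewrite exprD mulfK // expf_neq0 // lt0r_neq0. Qed.

(** Completing the square: r (2h - r) = h^2 - (h - r)^2. *)
Lemma theta_even h :
  theta q h.*2 = q ^+ (h ^ 2) * (\sum_(i < h.+1) q ^- (i ^ 2) + \sum_(i < h) q ^- (i.+1 ^ 2)).
Proof.
rewrite /theta (_ : h.*2.+1 = h + h.+1)%N; last by rewrite -addnn addnS.
rewrite big_split_ord /= addrC mulrDr !mulr_sumr; congr (_ + _).
  apply: eq_bigr => -[i /= ih] _; apply: powB; move: ih; rewrite ?ltnS => ih.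
  have [j ->] : exists j, h = (i + j)%N by exists (h - i)%N; lia.
  have -> : ((i + j).*2 - (i + j + i) = j)%N by lia.
  by nia.
rewrite (reindex_inj rev_ord_inj) /=; apply: eq_bigr => -[i /= ih] _; apply: powB.
have [j ->] : exists j, h = (i + j).+1 by exists (h - i.+1)%N; lia.
have -> : ((i + j).+1 - i.+1 = j)%N by lia.
have -> : ((i + j).+1.*2 - j = j + i.+1.*2)%N by lia.
by nia.
Qed.

(** Completing the square: r (2h + 1 - r) = h (h + 1) - i (i + 1), where i is
    the distance from r to the nearer of h and h + 1. *)
Lemma theta_odd h :
  theta q h.*2.+1 = q ^+ (h * h.+1) * (2 * \sum_(i < h.+1) q ^- (i * i.+1)).
Proof.
rewrite /theta (_ : h.*2.+2 = h.+1 + h.+1)%N; last by lia.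
rewrite big_split_ord /= mulr_natl mulr2n mulrDr !mulr_sumr; congr (_ + _).
  rewrite (reindex_inj rev_ord_inj) /=; apply: eq_bigr => -[i /= ih] _; apply: powB; move: ih; rewrite ltnS => ih.
  have [j ->] : exists j, h = (i + j)%N by exists (h - i)%N; lia.
  have -> : ((i + j).+1 - i.+1 = j)%N by lia.
  have -> : ((i + j).*2.+1 - j = j + i.*2.+1)%N by lia.
  by nia.
apply: eq_bigr => -[i /= ih] _; apply: powB; move: ih; rewrite ?ltnS => ih.
have [j ->] : exists j, h = (i + j)%N by exists (h - i)%N; lia.
have -> : ((i + j).*2.+1 - ((i + j).+1 + i) = j)%N by lia.
by nia.
Qed.

Variable C : R.
Hypothesis gauss_le : forall N, gauss_sum N <= C.

Lemma gauss_bound_ge : 1 + 2 * q^-1 <= C.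
Proof.
apply: le_trans (gauss_le 2); rewrite /gauss_sum !big_ord_recl !big_ord0 /= /bump /=.
rewrite !addr0 expr0 invr1 !expr1.
have : 0 < q ^- 4 by rewrite invr_gt0 exprn_gt0.
by rewrite (_ : (1 + 1) ^ 2 = 4)%N //; lra.
Qed.

Let qV0 : 0 < q^-1. Proof. by rewrite invr_gt0. Qed.
Lemma gauss_bound_ge1 : 1 <= C.
Proof. by move: gauss_bound_ge qV0; lra. Qed.

Lemma theta_even_le h : theta q h.*2 <= q ^+ (h ^ 2) * C.
Proof.
rewrite theta_even ler_wpM2l ?exprn_ge0 ?(ltW q0) //.
apply: le_trans (gauss_le h.+1); rewrite /gauss_sum lerD2l big_ord_recr /=.
by rewrite lerDl invr_ge0 exprn_ge0 // ltW.
Qed.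

(** Since i (i + 1) >= i^2 + 1 for i > 0, the sum of the terms q^(- i (i + 1))
    with i > 0 is at most 1 / q times either half of the Gauss sum without its
    term 1. *)
Lemma theta_odd_le h : theta q h.*2.+1 <= q ^+ (h * h.+1) * (2 + (C - 1) * q^-1).
Proof.
rewrite theta_odd ler_wpM2l ?exprn_ge0 ?(ltW q0) //.
rewrite big_ord_recl /= mul0n expr0 invr1 mulrDr mulr1 lerD2l.
apply: (@le_trans _ _ ((gauss_sum h.+1 - 1) * q^-1)); last first.
  by rewrite ler_pM2r // lerD2r.
rewrite /gauss_sum big_ord_recl /= expr0 invr1 addrAC [1 + _]addrC addrK.
rewrite [leRHS]mulrDl mulrDl !mul1r.
have le1 : \sum_(i < h) q ^- (bump 0 i * (bump 0 i).+1) <=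
    (\sum_(i < h) q ^- (bump 0 i ^ 2)) * q^-1.
  rewrite mulr_suml; apply: ler_sum => i _.
  rewrite -invfM -exprSr lef_pV2 ?posrE ?exprn_gt0 // ler_eXn2l //.
  by rewrite /bump /=; nia.
have le2 : \sum_(i < h) q ^- (bump 0 i * (bump 0 i).+1) <=
    (\sum_(i < h.+1) q ^- (i.+1 ^ 2)) * q^-1.
  apply: le_trans le1 _; rewrite ler_pM2r // big_ord_recr /= lerDl.
  by rewrite invr_ge0 exprn_ge0 // ltW.
exact: lerD.
Qed.

Lemma theta_even_ge h : q ^+ (h.+1 ^ 2) * (1 + 2 * q^-1) <= theta q h.+1.*2.
Proof.
rewrite theta_even ler_wpM2l ?exprn_ge0 ?(ltW q0) //.
rewrite !big_ord_recl /= /bump /= expr0 invr1 expr1.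
apply: (@le_trans _ _ ((1 + (q^-1 + 0)) + (q^-1 + 0))); first lra.
by apply: lerD; rewrite !lerD2l; apply: sumr_ge0 => i _; rewrite invr_ge0 exprn_ge0 // ltW.
Qed.

Lemma theta_odd_ge h : 2 * q ^+ (h * h.+1) <= theta q h.*2.+1.
Proof.
rewrite theta_odd [leLHS]mulrC ler_wpM2l ?exprn_ge0 ?(ltW q0) //.
rewrite big_ord_recl /= mul0n expr0 invr1 mulrDr mulr1 lerDl mulr_ge0 //.
by apply: sumr_ge0 => i _; rewrite invr_ge0 exprn_ge0 // ltW.
Qed.

Variable t : R.
Hypothesis t0 : 0 < t.
Hypothesis tq : t ^+ 4 = q.

Let t1 : 1 <= t.
Proof.
rewrite leNgt; apply/negP => t1.
have : t ^+ 4 <= 1 by apply: exprn_ile1; apply: ltW.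
by move: q2; rewrite tq; lra.
Qed.

(* A lower bound for C, made of the terms r = 0, 1, -1 of the Gauss sum. *)
Let w := 1 + 2 * q^-1.

Let wq : w ^+ 4 * q = (q + 2) ^+ 4 * q^-1 ^+ 3.
Proof. by rewrite /w; field; rewrite lt0r_neq0. Qed.

(* As a function of q, w^4 q = (q + 2)^4 / q^3 has its minimum 512 / 27 at q =
   6. *)
Let w4 : 468 / 25 <= w ^+ 4 * q.
Proof.
rewrite wq exprVn -ler_pdivrMr ?invr_gt0 ?exprn_gt0 // invrK.
(* This square has the two leading terms of (q + 2)^4 - (468 / 25) q^3. *)
have : 0 <= (q ^+ 2 - 134 / 25 * q - 237 / 100) ^+ 2 by rewrite sqr_ge0.
by have := q2; nra.
Qed.

Let w4_small : q <= 3 -> 22 <= w ^+ 4 * q.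
Proof.
move=> q3; rewrite wq exprVn -ler_pdivrMr ?invr_gt0 ?exprn_gt0 // invrK.
rewrite -subr_ge0; have -> : (q + 2) ^+ 4 - 22 * q ^+ 3 =
  31 + 46 * (3 - q) + 48 * ((3 - q) * (q - 2)) + 2 * (3 - q) ^+ 3 + (3 - q) ^+ 4 by ring.
by rewrite !addr_ge0 ?mulr_ge0 ?exprn_ge0 ?subr_ge0.
Qed.

Let pow4_le (x y : R) : 0 <= y -> x ^+ 4 <= y ^+ 4 -> x <= y.
Proof.
move=> y0; rewrite leNgt => /negP nh; rewrite leNgt; apply/negP => xy; apply: nh.
by rewrite ltrXn2r.
Qed.

Let w0 : 0 < w. Proof. by rewrite /w; move: qV0; lra. Qed.

Lemma Ct_ge2 : 2 <= C * t.
Proof.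
apply: (@le_trans _ _ (w * t)); last by rewrite ler_pM2r // gauss_bound_ge.
apply: pow4_le; first by rewrite mulr_ge0 ?ltW.
by rewrite exprMn tq; move: w4; lra.
Qed.

(** For C = w this is 8 + 8 / q^2 <= (w t)^3, which follows from the lower
    bounds on (w t)^4 = w^4 q; and the right side grows faster with C than the
    left side. *)
Lemma cubic_ge : 8 + 4 * (C - 1) * q^-1 <= C ^+ 2 * t ^+ 3 * w.
Proof.
pose v := w * t; have v4 : v ^+ 4 = w ^+ 4 * q by rewrite exprMn tq.
have v0 : 0 <= v by rewrite mulr_ge0 ?ltW.
have base : 8 + 8 * q^-1 ^+ 2 <= v ^+ 3.
  have from (x : R) : 0 <= x -> x ^+ 4 <= v ^+ 4 -> 8 + 8 * q^-1 ^+ 2 <= x ^+ 3 -> 8 + 8 * q^-1 ^+ 2 <= v ^+ 3.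
    by move=> x0 /(pow4_le v0) xv h; apply: le_trans h _; rewrite lerXn2r // nnegrE.
  have [q3|q3] := leP q 3.
    (* 431 / 200 and, below, 52 / 25 are a little less than the fourth
       roots of 22 and 468 / 25. *)
    apply: (from (431 / 200)); [lra | rewrite v4; move: (w4_small q3); lra |].
    have : q^-1 <= 2^-1 by rewrite lef_pV2 ?posrE.
    by move: qV0; move: (q^-1) => u; nra.
  apply: (from (52 / 25)); [lra | rewrite v4; move: w4; lra |].
  have : q^-1 <= 3^-1 by rewrite lef_pV2 ?posrE // ltW.
  by move: qV0; move: (q^-1) => u; nra.
pose z := C - w; have z0 : 0 <= z by rewrite subr_ge0 gauss_bound_ge.
have t3 : 1 <= t ^+ 3 by rewrite exprn_ege1.
have w1 : 1 <= w by rewrite /w; move: qV0; lra.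
have v3 : v ^+ 3 = w ^+ 3 * t ^+ 3 by rewrite exprMn.
have uz : 4 * (z * q^-1) <= 2 * z.
  have : q^-1 <= 2^-1 by rewrite lef_pV2 ?posrE.
  by move/(ler_wpM2l z0); lra.
have -> : 8 + 4 * (C - 1) * q^-1 = 8 + 8 * q^-1 ^+ 2 + 4 * (z * q^-1) by rewrite /z /w; ring.
have -> : C ^+ 2 * t ^+ 3 * w = v ^+ 3 + z * (2 * w + z) * (t ^+ 3 * w) by rewrite v3 /z; ring.
apply: lerD => //; apply: (le_trans uz).
have tw : 1 <= t ^+ 3 * w by rewrite -[1]mulr1 ler_pM.
rewrite -mulrA [2 * z]mulrC ler_wpM2l // -[leLHS]mulr1 ler_pM //.
by move: w1 z0; lra.
Qed.

End ThetaBounds.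

Section ThetaRatios.
Local Open Scope ring_scope.
Variables (R : realFieldType) (q C t : R).
Hypotheses (q2 : 2 <= q) (gauss_le : forall N, gauss_sum q N <= C).
Hypotheses (t0 : 0 < t) (tq : t ^+ 4 = q).

Lemma theta_ge0 M : 0 <= theta q M.
Proof.
by apply: sumr_ge0 => i _; rewrite exprn_ge0 // (le_trans _ q2).
Qed.

(** The largest exponent of q in theta(m) is m^2 / 4, rounded down, so theta(m
    - 1) / theta(m) is q^(- m / 2) up to a bounded factor. With the exact
    leading terms, the bound amounts to 2 <= C t if m is odd, and to
    [cubic_ge] if m is even. *)
Lemma theta_ratio_le m : (3 <= m)%N ->
  t ^+ (2 * m) * (4 * theta q m.-1) <= C ^+ 2 * t ^+ 3 * theta q m.
Proof.
move=> m3; have C0 : 0 < C := lt_le_trans ltr01 (gauss_bound_ge1 q2 gauss_le).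
have q0 : 0 < q := lt_le_trans (ltr0Sn R 1) q2.
have tX k : t ^+ (4 * k) = q ^+ k by rewrite exprM tq.
have qX k : 0 < q ^+ k by rewrite exprn_gt0.
rewrite -(odd_double_half m); case: (odd m) m3 => /= m3.
  rewrite add1n /=; move: (m./2) => h.
  apply: (@le_trans _ _ (q ^+ h * t ^+ 2 * (4 * (q ^+ (h ^ 2) * C)))).
    rewrite (_ : 2 * h.*2.+1 = 4 * h + 2)%N; last by lia.
    rewrite exprD tX ler_wpM2l ?mulr_ge0 ?exprn_ge0 ?(ltW q0) ?(ltW t0) //.
    by rewrite ler_pM2l // theta_even_le.
  apply: le_trans (ler_wpM2l _ (theta_odd_ge q2 h)); last first.
    by rewrite mulr_ge0 ?exprn_ge0 ?ltW.
  rewrite (_ : h * h.+1 = h + h ^ 2)%N; last by nia.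
  have pos : 0 <= 2 * C * t ^+ 2 * (q ^+ h * q ^+ (h ^ 2)).
    by rewrite !mulr_ge0 ?exprn_ge0 ?ltW.
  have := ler_wpM2l pos (Ct_ge2 q2 gauss_le t0 tq); rewrite exprD.
  by move: (q ^+ h) (q ^+ (h ^ 2)) => x y; lra.
have [h ->] : exists h, m./2 = h.+1 by exists (m./2).-1; lia.
rewrite add0n; apply: (@le_trans _ _ (q ^+ h.+1 * (4 * (q ^+ (h * h.+1) * (2 + (C - 1) * q^-1))))).
  rewrite (_ : 2 * h.+1.*2 = 4 * h.+1)%N; last by lia.
  rewrite tX ler_wpM2l ?exprn_ge0 ?(ltW q0) // ler_pM2l //.
  by rewrite doubleS /= theta_odd_le.
apply: le_trans (ler_wpM2l _ (theta_even_ge q2 h)); last first.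
  by rewrite mulr_ge0 ?exprn_ge0 ?ltW.
rewrite (_ : h.+1 ^ 2 = h.+1 + h * h.+1)%N; last by nia.
have pos : 0 <= q ^+ h.+1 * q ^+ (h * h.+1) by rewrite mulr_ge0 ?ltW.
have := ler_wpM2l pos (cubic_ge q2 gauss_le t0 tq); rewrite exprD.
by move: (q ^+ h.+1) (q ^+ (h * _)) => x y; lra.
Qed.

Variable D : R.
Hypothesis D1 : 1 <= D.

(** A comparison of the leading exponents, about (m - 5)^2 / 4 and m^2 / 4:
    the saving 5m / 2 - 25 / 4 pays for 2m + 21 and the constants from m = 55
    on. This is the least dimension to which it is applied, d (d + 1) / 2 for
    d = 10. *)
Lemma theta_shift_le m : (55 <= m)%N ->
  q ^+ (2 * m) * (D ^+ 2 * q ^+ 21 * theta q (m - 5)) * 4 <=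
    C * D ^+ 2 * q ^+ 4 * theta q m.
Proof.
move=> m55; have C0 : 0 < C := lt_le_trans ltr01 (gauss_bound_ge1 q2 gauss_le).
have q0 : 0 < q := lt_le_trans (ltr0Sn R 1) q2.
have D0 : 0 < D by apply: lt_le_trans D1.
have qX k : 0 < q ^+ k by rewrite exprn_gt0.
have q1 : 1 < q by apply: lt_le_trans q2; rewrite ltr1n.
have q8 : 8 <= q ^+ 3 by have := q2; nra.
suff h : q ^+ (2 * m + 21) * theta q (m - 5) * 4 <= C * q ^+ 4 * theta q m.
  rewrite (_ : q ^+ (2 * m) * _ * 4 = D ^+ 2 * (q ^+ (2 * m + 21) * theta q (m - 5) * 4)).
    rewrite (_ : C * D ^+ 2 * _ * _ = D ^+ 2 * (C * q ^+ 4 * theta q m)); last by ring.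
    by rewrite ler_wpM2l // exprn_ge0 // ltW.
  by rewrite exprD; move: (q ^+ (2 * m)) (q ^+ 21) => x y; ring.
rewrite -(odd_double_half m); case: (odd m) m55 (odd_double_half m) => /= m55 mE.
  have [h hE] : exists h, m./2 = h.+2 by exists (m./2).-2; lia.
  rewrite hE (_ : 1 + h.+2.*2 - 5 = h.*2)%N; last by lia.
  rewrite add1n.
  apply: (@le_trans _ _ (q ^+ (2 * h.+2.*2.+1 + 21) * (q ^+ (h ^ 2) * C) * q ^+ 3)).
    apply: ler_pM => //; last lra.
      by apply: mulr_ge0; [exact: ltW | exact: theta_ge0].
    by rewrite ler_pM2l // theta_even_le.
  apply: le_trans (ler_wpM2l _ (theta_odd_ge q2 h.+2)); last first.
    by rewrite mulr_ge0 ?exprn_ge0 ?ltW.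
  have {mE} e : (2 * h.+2.*2.+1 + 21 + h ^ 2 + 3 <= 4 + h.+2 * h.+3)%N.
    by move: m55; rewrite -mE hE; clear; nia.
  move: e; move: (2 * _)%N (h.+2 * _)%N (h ^ 2)%N => a b k.
  rewrite -(ler_eXn2l q1) !exprD => /(ler_wpM2l (ltW C0)).
  have : 0 <= C * (q ^+ 4 * q ^+ b) by rewrite !mulr_ge0 ?ltW.
  by move: (q ^+ a) (q ^+ b) (q ^+ 21) (q ^+ 3) (q ^+ k) (q ^+ 4) => *; lra.
have [h hE] : exists h, m./2 = h.+3 by exists (m./2).-1.-2; lia.
rewrite hE add0n (_ : h.+3.*2 - 5 = h.*2.+1)%N; last by lia.
apply: (@le_trans _ _ (q ^+ (2 * h.+3.*2 + 21) * (q ^+ (h * h.+1) * (2 + (C - 1) * q^-1)) * q ^+ 3)).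
  apply: ler_pM => //; last lra.
    by apply: mulr_ge0; [exact: ltW | exact: theta_ge0].
  by rewrite ler_pM2l // theta_odd_le.
apply: le_trans (ler_wpM2l _ (theta_even_ge q2 h.+2)); last first.
  by rewrite mulr_ge0 ?exprn_ge0 ?ltW.
have {mE} e : (2 * h.+3.*2 + 21 + h * h.+1 + 4 <= 4 + h.+3 ^ 2)%N.
  by move: m55; rewrite -mE hE; clear; nia.
have c2 : 2 + (C - 1) * q^-1 <= q * C.
  have C1 := gauss_bound_ge1 q2 gauss_le.
  have : (C - 1) * q^-1 <= C - 1.
    by rewrite ler_piMr ?subr_ge0 // invf_le1 // (le_trans _ q2) //; lra.
  by have := ler_pM2r C0 2 q; rewrite q2; lra.
apply: (@le_trans _ _ (q ^+ (2 * h.+3.*2 + 21) * (q ^+ (h * h.+1) * (q * C)) * q ^+ 3)).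
  by rewrite ler_pM2r // ler_pM2l // ler_pM2l.
have u0 : 0 < q^-1 by rewrite invr_gt0.
move: e; move: (2 * _)%N (h * _)%N (h.+3 ^ 2)%N => a b k.
rewrite -(ler_eXn2l q1) !exprD [q ^+ 4]exprS => /(ler_wpM2l (ltW C0)).
have : 0 <= C * (q * q ^+ 3 * q ^+ k) * q^-1 by rewrite !mulr_ge0 ?ltW.
by move: (q ^+ a) (q ^+ b) (q ^+ 21) (q ^+ 3) (q ^+ k) (q^-1) => *; lra.
Qed.

(** A comparison of leading exponents, which is close for m = 55: there 2m +
    17 (m - 17) + 2 = 758 and m^2 / 4 + 4, rounded down, is 760. *)
Lemma low_rank_term_le m : (55 <= m)%N ->
  q ^+ (2 * m) * (2 * D * q ^+ (17 * (m - 17))) * 2 <= D * q ^+ 4 * theta q m.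
Proof.
move=> m55; have D0 : 0 < D by apply: lt_le_trans D1.
have q0 : 0 < q := lt_le_trans (ltr0Sn R 1) q2.
have qX k : 0 < q ^+ k by rewrite exprn_gt0.
have q1 : 1 < q by apply: lt_le_trans q2; rewrite ltr1n.
have u0 : 0 < q^-1 by rewrite invr_gt0.
suff h : q ^+ (2 * m + 17 * (m - 17)) * 4 <= q ^+ 4 * theta q m.
  rewrite exprD in h; have := ler_wpM2l (ltW D0) h.
  by move: (q ^+ (2 * m)) (q ^+ (17 * _)) (q ^+ 4) => *; lra.
have q44 : 4 <= q ^+ 2 by have := q2; nra.
rewrite -(odd_double_half m); case: (odd m) m55 (odd_double_half m) => /= m55 mE.
  move: mE m55; move: (m./2) => h <-; rewrite add1n => h27.
  apply: le_trans (ler_wpM2l _ (theta_odd_ge q2 h)); last exact: ltW.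
  have {h27} : (2 * h.*2.+1 + 17 * (h.*2.+1 - 17) + 2 <= 4 + h * h.+1)%N.
    by have [k ->] : exists k, h = (27 + k)%N; [exists (h - 27)%N; lia | clear; nia].
  move: (2 * _ + _)%N (h * _)%N => a b.
  rewrite -(ler_eXn2l q1) [q ^+ (a + _)]exprD [q ^+ (_ + b)]exprD.
  have := ler_wpM2l (ltW (qX a)) q44; have := qX b; have := qX 4.
  by move: (q ^+ a) (q ^+ 2) (q ^+ b) (q ^+ 4) => *; nra.
move: mE m55; rewrite add0n; case: (m./2) => [|h] <- //= h27.
apply: le_trans (ler_wpM2l _ (theta_even_ge q2 h)); last exact: ltW.
have {h27} : (2 * h.+1.*2 + 17 * (h.+1.*2 - 17) + 2 <= 4 + h.+1 ^ 2)%N.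
  by have [k ->] : exists k, h = (27 + k)%N; [exists (h - 27)%N; lia | clear; nia].
move: (2 * _ + _)%N (h.+1 ^ _)%N => a b.
rewrite -(ler_eXn2l q1) [q ^+ (a + _)]exprD [q ^+ (_ + b)]exprD.
have : 0 <= q ^+ 4 * q ^+ b * q^-1 by rewrite !mulr_ge0 ?ltW.
have := ler_wpM2l (ltW (qX a)) q44.
by move: (q ^+ a) (q ^+ 2) (q ^+ b) (q ^+ 4) => *; lra.
Qed.

(** The term 64 D is absorbed by D^2 q^21; then [theta_shift_le] and
    [low_rank_term_le] bound the two parts by one half of C D^2 q^4 theta(m)
    each. *)
Lemma far_bound_le m : (55 <= m)%N ->
  q ^+ (2 * m) * ((D ^+ 2 * q ^+ 21 + 64 * D) * theta q (m - 5) +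
     2 * D * q ^+ (17 * (m - 17))) <= C ^+ 5 * D ^+ 4 * (q ^+ 4 * t) * theta q m.
Proof.
move=> m55; have h1 := theta_shift_le m55; have h2 := low_rank_term_le m55.
have C1 := gauss_bound_ge1 q2 gauss_le.
have D0 : 0 < D by apply: lt_le_trans D1.
have C0 : 0 < C by apply: lt_le_trans C1.
have q1 : 1 <= q by apply: le_trans q2; rewrite ler1n.
have q0 : 0 < q := lt_le_trans ltr01 q1.
have t1 : 1 <= t.
  rewrite leNgt; apply/negP => t1.
  have : t ^+ 4 <= 1 by apply: exprn_ile1; apply: ltW.
  by have := q2; rewrite tq; lra.
have h3 : 64 * D <= D ^+ 2 * q ^+ 21.
  rewrite mulrC expr2 -mulrA ler_pM2l // -[leLHS]mul1r ler_pM //.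
  apply: (@le_trans _ _ (2 ^+ 21)); last by rewrite lerXn2r ?nnegrE ?(ltW q0).
  by rewrite -natrX ler_nat.
apply: (@le_trans _ _ (C * D ^+ 2 * (q ^+ 4 * theta q m))).
  have qm : 0 <= q ^+ (2 * m) by rewrite exprn_ge0 // ltW.
  have h4 : (D ^+ 2 * q ^+ 21 + 64 * D) * theta q (m - 5) <=
      2 * (D ^+ 2 * q ^+ 21 * theta q (m - 5)).
    rewrite [leRHS]mulrA ler_wpM2r ?theta_ge0 //.
    by rewrite [leRHS](_ : _ = D ^+ 2 * q ^+ 21 + D ^+ 2 * q ^+ 21) ?lerD2l //; ring.
  have h5 : D * q ^+ 4 * theta q m <= C * D ^+ 2 * (q ^+ 4 * theta q m).
    rewrite -mulrA ler_wpM2r ?mulr_ge0 ?theta_ge0 ?exprn_ge0 ?(ltW q0) //.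
    by rewrite -[leLHS]mul1r ler_pM // ?(ltW D0) // expr2 ler_peMl ?(ltW D0).
  have := ler_wpM2l qm h4; move: h1 h2 h5; rewrite mulrDr.
  move: (q ^+ (17 * _)) (q ^+ (2 * m)) (theta q m) (theta q (m - 5)) (q ^+ 21) (q ^+ 4).
  by move=> *; lra.
have -> : C ^+ 5 * D ^+ 4 * (q ^+ 4 * t) * theta q m =
  (C ^+ 4 * D ^+ 2 * t) * (C * D ^+ 2 * (q ^+ 4 * theta q m)).
  by move: (q ^+ 4) (theta q m) => x y; ring.
rewrite ler_peMl ?mulr_ge0 ?theta_ge0 ?exprn_ge0 ?(ltW q0) ?(ltW C0) ?(ltW D0) //.
by rewrite -[1]mulr1 ler_pM ?mulr_ge0 // -[1]mulr1 ler_pM // exprn_ege1.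
Qed.

End ThetaRatios.

(** * Homomorphisms from a free group *)

Section GroupMorphism.
Local Open Scope group_scope.
Variables (H G : groupType) (f : H -> G).
Hypothesis fM : {morph f : x y / x * y}.

Lemma mulg_morph1 : f 1 = 1.
Proof. by apply: (mulgI (f 1)); rewrite -fM !mulg1. Qed.

Lemma mulg_morphV x : f x^-1 = (f x)^-1.
Proof. by apply: (mulgI (f x)); rewrite -fM !mulgV mulg_morph1. Qed.

Lemma mulg_morphX x k : f (x ^+ k) = f x ^+ k.
Proof. by elim: k => [|k IH]; rewrite ?expg0 ?mulg_morph1 // !expgS fM IH. Qed.

Lemma mulg_morphR x y : f [~ x, y] = [~ f x, f y].
Proof. by rewrite /commg /conjg !fM !mulg_morphV. Qed.

End GroupMorphism.

Section FreeHom.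
Local Open Scope group_scope.
Variables (d : nat) (G : groupType) (g : 'I_d -> G).

Definition letter_val (a : letter d) : G := if a.2 then (g a.1)^-1 else g a.1.
Definition free_hom (u : free_group d) : G :=
  foldr (fun a x => letter_val a * x) 1 (word u).

Lemma free_homM : {morph free_hom : u v / u * v}.
Proof.
move=> u v; rewrite /free_hom /= -[RHS]/(_ * _).
have inv a : letter_val (inv_letter a) = (letter_val a)^-1.
  by case: a => i [] //=; rewrite /letter_val /= invgK.
elim: (word u) => [|a w IH] /=; first by rewrite mul1g.
rewrite -mulgA -IH; case: (foldr _ _ w) => [|b t] //=.
by case: eqP => [->|//]; rewrite /= inv mulVKg.
Qed.

Lemma free_hom_gen i : free_hom (free_gen i) = g i.
Proof. by rewrite /free_hom /= mulg1. Qed.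

End FreeHom.

Section FreeExt.
Local Open Scope group_scope.
Variable d : nat.
Local Notation F := (free_group d).

Lemma free_letterE (a : letter d) :
  free_letter a = if a.2 then (free_gen a.1)^-1 else free_gen a.1.
Proof. by case: a => i [] //; apply/val_inj. Qed.

Lemma free_hom_ext (G : groupType) (f g : F -> G) :
  {morph f : u v / u * v} -> {morph g : u v / u * v} ->
  (forall i, f (free_gen i) = g (free_gen i)) -> f =1 g.
Proof.
move=> fM gM fg; apply: free_group_ind => [|u a IH].
  by rewrite (mulg_morph1 fM) (mulg_morph1 gM).
rewrite fM gM IH free_letterE.
by case: a.2; rewrite ?(mulg_morphV fM) ?(mulg_morphV gM) fg.
Qed.

Lemma free_additive_ext (V : zmodType) (f g : F -> V) :
  (forall u v, f (u * v)%g = f u + f v)%R -> (forall u v, g (u * v)%g = g u + g v)%R ->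
  (forall i, f (free_gen i) = g (free_gen i)) -> f =1 g.
Proof.
move=> fM gM fg.
have f1 : f 1 = 0%R by apply: (addrI (f 1)); rewrite -fM mulg1 addr0.
have g1 : g 1 = 0%R by apply: (addrI (g 1)); rewrite -gM mulg1 addr0.
apply: free_group_ind => [|u a IH]; first by rewrite f1 g1.
rewrite fM gM IH free_letterE; congr (_ + _)%R; case: a.2; last exact: fg.
by apply: (addrI (f (free_gen a.1))); rewrite -fM [in RHS]fg -gM !mulgV f1 g1.
Qed.

End FreeExt.

Section SeriesImage.
Local Open Scope group_scope.
Variables (p : nat) (G : groupType).

(** The closure properties by which the terms S i contain those of the lower
    p-series, also along homomorphisms. *)
Record p_filtration (S : nat -> G -> Prop) : Prop := PFiltration {
  filt_sub : forall i, is_subgroup (S i);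
  filt1 : forall x, S 1%N x;
  filtX : forall i x, S i.+1 x -> S i.+2 (x ^+ p);
  filtR : forall i x y, S i.+1 x -> S i.+2 [~ x, y] }.

Lemma is_subgroupM (S : G -> Prop) x y : is_subgroup S -> S x -> S y -> S (x * y).
Proof.
move=> [S1 SV] Sx Sy; rewrite -[y]invgK; apply: (SV) => //.
by rewrite -[y^-1]mul1g; apply: SV.
Qed.

Lemma generated_le (X S : G -> Prop) x :
  is_subgroup S -> (forall y, X y -> S y) -> Defs.generated X x -> S x.
Proof. by move=> sS XS; apply; split. Qed.

Lemma lower_series_ind (S : G -> Prop) i :
  is_subgroup S ->
  (forall x, lower_p_series G p i.+1 x -> S (x ^+ p)) ->
  (forall x y, lower_p_series G p i.+1 x -> S [~ x, y]) ->
  forall x, lower_p_series G p i.+2 x -> S x.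
Proof.
move=> sS SX SR x [u Xu [v Yv <-]]; apply: is_subgroupM => //.
  by apply: generated_le Xu => // _ [y Ly <-]; apply: SX.
by apply: generated_le Yv => // _ [y Ly [z _ <-]]; apply: SR.
Qed.

End SeriesImage.

Lemma lower_series_image (p : nat) (H G : groupType) (S : nat -> G -> Prop) (f : H -> G) :
  p_filtration p S -> {morph f : x y / (x * y)%g} ->
  forall i x, lower_p_series H p i.+1 x -> S i.+1 (f x).
Proof.
move=> fS fM.
elim=> [|i IH] x; first by move=> _; apply: filt1 fS _.
have [s1 sV] := filt_sub fS i.+2.
apply: (@lower_series_ind p H (fun x => S i.+2 (f x))) => [|y Ly|y z Ly].
- by split=> [|y z]; rewrite ?(mulg_morph1 fM) // fM (mulg_morphV fM); apply: sV.
- by rewrite (mulg_morphX fM); apply: (filtX fS); apply: IH.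
by rewrite (mulg_morphR fM); apply: (filtR fS); apply: IH.
Qed.

(** * Groups with a descending central series of exponent p *)

Section FiniteSeries.
Local Open Scope group_scope.
Variables (gT : finGroupType) (p : nat) (L : nat -> {group gT}).
Implicit Types (H K : {group gT}) (x y z : gT) (i : nat).
Hypothesis L1 : L 1 = [set: gT] :> {set gT}.
Hypothesis LX : forall i x, x \in L i.+1 -> x ^+ p \in L i.+2.
Hypothesis LR : forall i x y, x \in L i.+1 -> [~ x, y] \in L i.+2.
Hypothesis L_ind : forall i H, (forall x, x \in L i.+1 -> x ^+ p \in H) ->
  (forall x y, x \in L i.+1 -> [~ x, y] \in H) -> L i.+2 \subset H.

Lemma series_morph_sub (f : gT -> gT) i : {morph f : x y / x * y} ->
  forall x, x \in L i.+1 -> f x \in L i.+1.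
Proof.
move=> fM; elim: i => [|i IH] x; first by rewrite L1 !inE.
have gH : group_set [set y | f y \in L i.+2].
  apply/group_setP; split=> [|y z]; rewrite !inE ?(mulg_morph1 fM) ?group1 // fM; exact: groupM.
suff /subsetP h : L i.+2 \subset Group gH by move=> /h; rewrite inE.
apply: L_ind => [y /IH|y z /IH] h; rewrite inE.
  by rewrite (mulg_morphX fM); apply: LX.
by rewrite (mulg_morphR fM); apply: LR.
Qed.

Lemma series_normal i : L i.+1 <| [set: gT].
Proof.
rewrite /normal subsetT /=; apply/subsetP => x _; rewrite inE.
apply/subsetP => _ /imsetP[y Ly ->].
by apply: (@series_morph_sub (conjg^~ x)) => // u v; rewrite conjMg.
Qed.

Local Notation cs i := (coset (L i.+1)).

Lemma series_cosetM i : {morph cs i : x y / x * y}.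
Proof. by move=> x y; apply: morphM; rewrite (subsetP (normal_norm (series_normal i))) ?inE. Qed.

Lemma series_coset_eq1 i x : (cs i x == 1) = (x \in L i.+1).
Proof.
have nx : x \in 'N(L i.+1) by rewrite (subsetP (normal_norm (series_normal i))) ?inE.
apply/eqP/idP; [exact: coset_idr nx | exact: coset_id].
Qed.

Lemma series_coset_central i x y : x \in L i.+1 -> commute (cs i.+1 x) (cs i.+1 y).
Proof.
move=> Lx; apply/commgP; rewrite -(mulg_morphR (@series_cosetM _)) series_coset_eq1; exact: LR.
Qed.

Lemma series_coset_conj i z v : commute (cs i z) (cs i v) -> cs i (z ^ v) = cs i z.
Proof.
move=> zv; rewrite conjgE !series_cosetM zv mulgA -series_cosetM mulVg.
by rewrite (mulg_morph1 (@series_cosetM i)) mul1g.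
Qed.

(** Modulo L_(i+3) the map u |-> [~ x, u] is a homomorphism to the central
    subgroup L_(i+2), of exponent p. So it kills the p-th powers and
    commutators that generate L_2. *)
Lemma series_commL2 i x y : x \in L i.+1 -> y \in L 2 -> [~ x, y] \in L i.+3.
Proof.
move=> Lx Ly.
pose phi u := cs i.+2 [~ x, u].
have phi_central u v : commute (phi u) (cs i.+2 v) by apply: series_coset_central; apply: LR.
have phiM u v : phi (u * v) = phi u * phi v.
  rewrite {1}/phi commgMJ series_cosetM series_coset_conj; exact: phi_central.
have gH : group_set [set u | phi u == 1].
  apply/group_setP; split=> [|u v]; rewrite !inE ?(mulg_morph1 phiM) // phiM.
  by move=> /eqP -> /eqP ->; rewrite mulg1.
suff /subsetP h : L 2 \subset Group gH by have := h _ Ly; rewrite inE series_coset_eq1.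
apply: L_ind => [u _|u v _]; rewrite inE.
  rewrite (mulg_morphX phiM) -(mulg_morphX (@series_cosetM _)) series_coset_eq1.
  by apply: LX; apply: LR.
rewrite (mulg_morphR phiM) /commg /conjg.
by rewrite (phi_central u [~ x, v] : phi u * phi v = phi v * phi u) mulKg mulVg.
Qed.

(** Induction on i. For u in L_(i+1) write a u = z (b u) with z in L_(i+2).
    Modulo L_(i+3), z is central of exponent p, so it disappears from a u ^+ p
    and from [~ a u, a v]; and the quotient of a v by b v, in L_2, disappears
    from the commutator by [series_commL2]. *)
Lemma series_morph_agree (a b : gT -> gT) :
  {morph a : x y / x * y} -> {morph b : x y / x * y} ->
  (forall x, a x * (b x)^-1 \in L 2) ->
  forall i x, x \in L i.+1 -> a x * (b x)^-1 \in L i.+2.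
Proof.
move=> aM bM ab; elim=> [|i IH] x Lx; first exact: ab.
have eqP' (u v : gT) j : (u * v^-1 \in L j.+1) = (cs j u == cs j v).
  by rewrite -series_coset_eq1 series_cosetM (mulg_morphV (@series_cosetM j)) -eq_mulgV1.
have gH : group_set [set u | cs i.+2 (a u) == cs i.+2 (b u)].
  apply/group_setP; split=> [|u v]; rewrite !inE ?(mulg_morph1 aM) ?(mulg_morph1 bM) //.
  by rewrite aM bM !series_cosetM => /eqP -> /eqP ->.
suff /subsetP h : L i.+2 \subset Group gH by have := h _ Lx; rewrite inE eqP'.
apply: L_ind => [u Lu|u v Lu]; rewrite inE.
  have Lz := IH u Lu; rewrite (mulg_morphX aM) (mulg_morphX bM) -[a u](mulgKV (b u)).
  set z := a u * _ in Lz *.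
  have zp : cs i.+2 z ^+ p = 1.
    by rewrite -(mulg_morphX (@series_cosetM _)); apply/eqP; rewrite series_coset_eq1; apply: LX.
  rewrite !(mulg_morphX (@series_cosetM _)) series_cosetM expgMn ?zp ?mul1g //.
  exact: series_coset_central.
have Lz := IH u Lu; rewrite (mulg_morphR aM) (mulg_morphR bM).
rewrite -[a u](mulgKV (b u)); set z := a u * _ in Lz *.
have Lbu : b u \in L i.+1 by apply: series_morph_sub.
have zc w : commute (cs i.+2 z) (cs i.+2 w) by apply: series_coset_central.
have -> : cs i.+2 [~ z * b u, a v] = cs i.+2 [~ b u, a v].
  rewrite !(mulg_morphR (@series_cosetM _)) series_cosetM commMgJ.
  by rewrite (eqP (introT commgP (zc (a v)))) conj1g mul1g.
rewrite -[a v](mulgKV (b v)) commgMJ series_cosetM.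
set w := a v * _; have Lw : w \in L 2 by exact: ab.
have cw : cs i.+2 [~ b u, w] = 1 by apply/eqP; rewrite series_coset_eq1 series_commL2.
by rewrite series_coset_conj cw ?mulg1 //; apply/commute_sym/commute1.
Qed.

End FiniteSeries.

(** * An integral Heisenberg group *)

Section MatrixMuln.
Local Open Scope ring_scope.
Variables (R : comPzRingType) (a b c : nat) (A : 'M[R]_(a, b)) (B : 'M[R]_(b, c)).

Lemma mulmxMnl k : (A *+ k) *m B = (A *m B) *+ k.
Proof. by rewrite -!scaler_nat -scalemxAl. Qed.

Lemma mulmxMnr k : A *m (B *+ k) = (A *m B) *+ k.
Proof. by rewrite -!scaler_nat -scalemxAr. Qed.

Lemma trmxMn k : (A *+ k)^T = A^T *+ k.
Proof. exact: raddfMn. Qed.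

End MatrixMuln.

Section Heisenberg.
Local Open Scope ring_scope.
Variable d : nat.

(** With the product below, the commutator of (v, B) and (w, C) is (0, v^T w -
    w^T v): enough of the free group to see powers of its elements and powers
    of commutators. The entries are integers since the powers of p that divide
    them are what matters. *)
Definition heis := ('rV[int]_d * 'M[int]_d)%type.
HB.instance Definition _ := Choice.on heis.

Definition heis_one : heis := (0, 0).
Definition heis_mul (x y : heis) : heis := (x.1 + y.1, x.2 + y.2 + x.1^T *m y.1).
Definition heis_inv (x : heis) : heis := (- x.1, - x.2 + x.1^T *m x.1).

Fact heis_mulA : associative heis_mul.
Proof.
move=> [u A] [v B] [w C]; rewrite /heis_mul /= addrA; congr (_, _).
rewrite [(u + v)^T]raddfD /= mulmxDl mulmxDr.
move: (v^T *m w) (u^T *m v) (u^T *m w) => X Y Z.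
by apply/matrixP => i j; rewrite !mxE; ring.
Qed.
Fact heis_mul1 : left_id heis_one heis_mul.
Proof. by move=> [u A]; rewrite /heis_mul /= !add0r trmx0 mul0mx addr0. Qed.
Fact heis_1mul : right_id heis_one heis_mul.
Proof. by move=> [u A]; rewrite /heis_mul /= !addr0 mulmx0 addr0. Qed.
Fact heis_mulV : left_inverse heis_one heis_inv heis_mul.
Proof.
move=> [u A]; rewrite /heis_mul /heis_inv /= addNr; congr (_, _).
by rewrite raddfN /= mulNmx addrAC addrK addNr.
Qed.
Fact heis_Vmul : right_inverse heis_one heis_inv heis_mul.
Proof.
move=> [u A]; rewrite /heis_mul /heis_inv /= addrN; congr (_, _).
by rewrite mulmxN addrA addrK addrN.
Qed.
HB.instance Definition _ :=
  isGroup.Build heis heis_mulA heis_mul1 heis_1mul heis_mulV heis_Vmul.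

Lemma heisX (x : heis) k :
  (x ^+ k)%g = (x.1 *+ k, x.2 *+ k + (x.1^T *m x.1) *+ 'C(k, 2)).
Proof.
elim: k => [|k IH]; first by rewrite expg0 !mulr0n addr0.
rewrite expgSr IH /mulg /= /heis_mul /= -mulrSr; congr (_, _).
rewrite trmxMn mulmxMnl binS bin1 mulrnDr -!addrA mulrSr -!addrA; congr (_ + _).
by rewrite addrCA addrC -!addrA; congr (_ + _); rewrite addrC.
Qed.

Lemma heisR (x y : heis) : [~ x, y]%g = (0, x.1^T *m y.1 - y.1^T *m x.1).
Proof.
apply: (mulgI (y * x)%g); rewrite -commgC.
rewrite /mulg /= /heis_mul /= addr0 mulmx0 addr0 addrC; congr (_, _).
move: (x.1^T *m y.1) (y.1^T *m x.1) => X Y.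
by apply/matrixP => i j; rewrite !mxE; ring.
Qed.

Variable p : nat.

(** B is one power of p behind v because the commutators of arbitrary elements
    already lie in the second term of the lower p-series. *)
Definition heis_filt (i : nat) (x : heis) : Prop :=
  if i is j.+2 then exists v B, x = (v *+ p ^ j.+1, B *+ p ^ j) else True.

Lemma heis_filtration : p_filtration p heis_filt.
Proof.
split=> // [[|[|j]] //|[|j] x|[|j] x y].
- split=> [|_ _ [v [B ->]] [w [C ->]]]; first by exists 0, 0; rewrite !mul0rn.
  exists (v - w), (B - C + (w^T *m w - v^T *m w) *+ p ^ j.+2).
  rewrite /mulg /= /heis_mul /= /invg /= mulrnBl; congr (_, _).
  rewrite !trmxMn mulmxN !(mulmxMnl, mulmxMnr) -!mulrnA.
  have -> : (p ^ j.+1 * p ^ j.+1 = p ^ j.+2 * p ^ j)%N by rewrite -!expnD; congr (_ ^ _)%N; lia.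
  move: (w^T *m w) (v^T *m w) => X Y.
  apply/matrixP => i k; rewrite !(mulmxnE, mxE).
  by move: (p ^ j)%N (p ^ j.+2)%N => s t; ring.
- move=> _; exists x.1, (x.2 *+ p + (x.1^T *m x.1) *+ 'C(p, 2)).
  by rewrite heisX expn1 expn0.
- case=> v [B ->]; exists v, (B + v^T *m v *+ ('C(p, 2) * p ^ j.+1)).
  rewrite heisX /= -!mulrnA -!expnSr; congr (_, _).
  rewrite trmxMn mulmxMnl mulmxMnr -!mulrnA mulrnDl -mulrnA; congr (_ + _ *+ _).
  by rewrite mulnA mulnC mulnA.
- move=> _; exists 0, (x.1^T *m y.1 - y.1^T *m x.1).
  by rewrite heisR expn0 mul0rn.
case=> v [B ->]; exists 0, (v^T *m y.1 - y.1^T *m v).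
by rewrite heisR mul0rn /= trmxMn mulmxMnl mulmxMnr -mulrnBl.
Qed.

End Heisenberg.

(** * The lower series of F / F_{n+1} *)

Section QuotientSeries.
Local Open Scope group_scope.
Variables (p : nat) (p_pr : prime p) (d n : nat).
Local Notation F := (free_group d).
Local Notation Q := (free_quotient p_pr d n.+1).
Local Notation proj := (free_proj p_pr n : F -> Q).
Local Notation L i := (lower_quotient p_pr d n i).
Implicit Types (u v : F) (x y : Q).

Lemma projM : {morph proj : u v / u * v}.
Proof. exact: quotient_map_morph. Qed.

Lemma proj_surj x : exists u, x = proj u.
Proof. by exists (quotient_repr x); rewrite /free_proj quotient_reprK. Qed.

Lemma proj_eq u v : proj u = proj v -> lower_p_series F p n.+1 (u * v^-1).
Proof. by move/quotient_mapP. Qed.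

Lemma lower_quotientP i x :
  reflect (exists2 u, lower_p_series F p i u & x = proj u) (x \in L i).
Proof.
rewrite inE; apply: (iffP (asboolP _)) => -[u Lu e]; exists u => //.
Qed.

Lemma mem_lower_quotient i u : lower_p_series F p i u -> proj u \in L i.
Proof. by move=> Lu; apply/lower_quotientP; exists u. Qed.

Lemma lower_quotient_group i : group_set (L i).
Proof.
have [[s1 sV] _] := lower_p_series_normal F p i.
have sS : is_subgroup (lower_p_series F p i) by [].
apply/group_setP; split; first by rewrite -(mulg_morph1 projM) mem_lower_quotient.
move=> _ _ /lower_quotientP[u Lu ->] /lower_quotientP[v Lv ->].
by rewrite -projM mem_lower_quotient //; apply: is_subgroupM.
Qed.
Canonical lower_quotient_groupType i := Group (lower_quotient_group i).

Lemma lower_quotient1 : L 1 = [set: Q].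
Proof.
by apply/setP => x; rewrite [RHS]inE; have [u ->] := proj_surj x; rewrite mem_lower_quotient.
Qed.

Lemma lower_quotient_last : L n.+1 = 1.
Proof.
apply/trivgP/subsetP => _ /lower_quotientP[u Lu ->]; rewrite inE; apply/eqP.
by rewrite -(mulg_morph1 projM); apply/quotient_mapP; rewrite invg1 mulg1.
Qed.

Lemma lower_quotientX i x : x \in L i.+1 -> x ^+ p \in L i.+2.
Proof.
by case/lower_quotientP=> u Lu ->; rewrite -(mulg_morphX projM) mem_lower_quotient //; apply: lower_p_seriesX.
Qed.

Lemma lower_quotientR i x y : x \in L i.+1 -> [~ x, y] \in L i.+2.
Proof.
case/lower_quotientP=> u Lu ->; have [v ->] := proj_surj y.
by rewrite -(mulg_morphR projM) mem_lower_quotient //; apply: lower_p_seriesR.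
Qed.

Lemma lower_quotient_ind i (H : {group Q}) :
  (forall x, x \in L i.+1 -> x ^+ p \in H) ->
  (forall x y, x \in L i.+1 -> [~ x, y] \in H) -> L i.+2 \subset H.
Proof.
move=> HX HR; apply/subsetP => _ /lower_quotientP[u Lu ->].
apply: (@lower_series_ind p F (fun u => proj u \in H) i) Lu => [|v Lv|v w Lv].
- by split=> [|v w Hv Hw]; rewrite ?(mulg_morph1 projM) ?group1 // projM (mulg_morphV projM) groupM ?groupV.
- by rewrite (mulg_morphX projM) HX // mem_lower_quotient.
- by rewrite (mulg_morphR projM) HR // mem_lower_quotient.
Qed.

Definition quotient_agree :=
  series_morph_agree (L := lower_quotient_groupType)
    lower_quotient1 lower_quotientX lower_quotientR lower_quotient_ind.

Definition quotient_morph_sub :=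
  series_morph_sub (L := lower_quotient_groupType)
    lower_quotient1 lower_quotientX lower_quotientR lower_quotient_ind.

Definition heis_hom : F -> heis d := free_hom (fun i => (delta_mx 0 i, 0)%R : heis d).

Lemma heis_homM : {morph heis_hom : u v / u * v}.
Proof. exact: free_homM. Qed.

Lemma heis_hom_filt i u : lower_p_series F p i.+1 u -> heis_filt p i.+1 (heis_hom u).
Proof. exact: (lower_series_image (heis_filtration d p) heis_homM). Qed.

Definition intr_mx a b (A : 'M[int]_(a, b)) : 'M['F_p]_(a, b) :=
  map_mx (fun z : int => z%:~R)%R A.

Lemma intr_mxD a b : {morph @intr_mx a b : A B / (A + B)%R}.
Proof. by move=> A B; apply/matrixP => i j; rewrite !mxE rmorphD. Qed.

Lemma intr_mx_muln a b (A : 'M_(a, b)) k : intr_mx (A *+ k)%R = (intr_mx A *+ k)%R.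
Proof. by apply/matrixP => i j; rewrite !(mulmxnE, mxE) rmorphMn. Qed.

Lemma mulrn_p a b (A : 'M['F_p]_(a, b)) k : (A *+ (p ^ k.+1) = 0)%R.
Proof.
by apply/matrixP => i j; rewrite mulmxnE mxE -mulr_natr natrX pchar_Fp_0 // expr0n mulr0.
Qed.

(** The class in F / F_2 = F_p^d, obtained from the Heisenberg group so that
    it comes with explicit coordinates. *)
Definition bar (x : Q) : 'rV['F_p]_d := intr_mx (heis_hom (quotient_repr x)).1.

Hypothesis n_gt0 : 0 < n.

(** The choice of a representative in F does not matter: F_(n+1) maps to
    multiples of p^n, and n > 0. *)
Lemma bar_proj u : bar (proj u) = intr_mx (heis_hom u).1.
Proof.
set w := quotient_repr (proj u : Q).
have : lower_p_series F p n.+1 (w * u^-1).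
  by apply: proj_eq; rewrite /free_proj quotient_reprK.
have [m nE] : exists m, n = m.+1 by exists n.-1; rewrite prednK.
move/heis_hom_filt; rewrite {1}nE => -[v [B e]].
have : heis_hom w = heis_hom (w * u^-1) * heis_hom u by rewrite -heis_homM mulgVK.
rewrite e /bar -/w => ->; rewrite [X in X.1]/mulg /= intr_mxD intr_mx_muln mulrn_p.
by rewrite add0r.
Qed.

Lemma barM x y : bar (x * y) = (bar x + bar y)%R.
Proof.
have [u ->] := proj_surj x; have [v ->] := proj_surj y.
by rewrite -projM !bar_proj heis_homM -intr_mxD.
Qed.

Lemma bar1 : bar 1 = 0%R.
Proof. by apply: (addrI (bar 1)); rewrite -barM mulg1 addr0. Qed.

Lemma barX x k : bar (x ^+ k) = (bar x *+ k)%R.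
Proof. by elim: k => [|k IH]; rewrite ?expg0 ?bar1 // expgS barM IH mulrS. Qed.

Lemma barV x : bar x^-1 = (- bar x)%R.
Proof. by apply: (addrI (bar x)); rewrite -barM mulgV bar1 subrr. Qed.

(** The product through which [induces] reads a row of a matrix. *)
Definition word_of (y : 'rV['F_p]_d) : Q :=
  \prod_(j < d) free_proj p_pr n (free_gen j) ^+ (y 0%R j : nat).

Lemma bar_gen i : bar (proj (free_gen i)) = delta_mx 0%R i.
Proof.
rewrite bar_proj /heis_hom free_hom_gen /=; apply/matrixP => a b; rewrite !mxE.
by case: (_ && _).
Qed.

Lemma bar_word (y : 'rV['F_p]_d) : bar (word_of y) = y.
Proof.
rewrite [RHS]row_sum_delta /word_of.
have -> : forall r (f : 'I_d -> Q), bar (\prod_(j <- r) f j) = (\sum_(j <- r) bar (f j))%R.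
  move=> r f; elim: r => [|j r IH]; first by rewrite !big_nil bar1.
  by rewrite !big_cons barM IH.
apply: eq_bigr => j _; rewrite barX bar_gen -scaler_nat natr_Zp.
by [].
Qed.

Lemma bar_L2 x : x \in L 2 -> bar x = 0%R.
Proof.
case/lower_quotientP=> u Lu ->; rewrite bar_proj.
by have [v [B ->]] := heis_hom_filt Lu; rewrite intr_mx_muln mulrn_p.
Qed.

Let f := coset (L 2).
Let fM : {morph f : x y / x * y}.
Proof.
exact: (@series_cosetM _ _ lower_quotient_groupType
    lower_quotient1 lower_quotientX lower_quotientR lower_quotient_ind 1).
Qed.
Let f_eq1 x : (f x == 1) = (x \in L 2).
Proof.
exact: (series_coset_eq1 (L := lower_quotient_groupType)
    lower_quotient1 lower_quotientX lower_quotientR lower_quotient_ind 1).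
Qed.
Let f_comm x y : commute (f x) (f y).
Proof.
rewrite /commute -!fM (commgC x y) [LHS]fM -[RHS]mulg1; congr (_ * _).
by apply/eqP; rewrite f_eq1 lower_quotientR // lower_quotient1 inE.
Qed.
Let f_word_add (y z : 'rV['F_p]_d) : f (word_of (y + z)%R) = f (word_of y) * f (word_of z).
Proof.
have fp x : f x ^+ p = 1.
  by apply/eqP; rewrite -(mulg_morphX fM) f_eq1 lower_quotientX // lower_quotient1 inE.
rewrite /word_of; elim: (index_enum _) => [|j r IH]; first by rewrite !big_nil (mulg_morph1 fM) mulg1.
rewrite !big_cons !fM IH.
have -> : f (proj (free_gen j) ^+ ((y + z)%R 0%R j)) =
    f (proj (free_gen j) ^+ (y 0%R j)) * f (proj (free_gen j) ^+ (z 0%R j)).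
  rewrite !(mulg_morphX fM) mxE -expgD /= -[in RHS](expg_mod _ (fp _)).
  by move: (nat_of_ord (y 0%R j) + _)%N => s; rewrite Fp_cast.
by rewrite -!mulgA; congr (_ * _); rewrite !mulgA; congr (_ * _); apply: f_comm.
Qed.

(** Modulo L_2 the group Q is abelian of exponent p, so both sides are
    homomorphisms from F, and they agree on the generators. *)
Lemma word_bar x : f (word_of (bar x)) = f x.
Proof.
have [u ->] := proj_surj x.
apply: (@free_hom_ext _ _ (fun u => f (word_of (bar (proj u)))) (fun u => f (proj u))) => {u}.
- by move=> u v; rewrite projM barM f_word_add.
- by move=> u v; rewrite projM fM.
move=> i; rewrite bar_gen /word_of; congr f.
have := index_enum_uniq 'I_d; have := mem_index_enum i.
case/splitPr: (index_enum _) / => r1 r2; rewrite cat_uniq /= => /and3P[_ + /andP[ir2 _]].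
rewrite negb_or => /andP[ir1 _].
have skip r : i \notin r ->
    \prod_(j <- r) proj (free_gen j) ^+ ((delta_mx 0%R i : 'rV['F_p]_d) 0%R j) = 1.
  move=> ir; rewrite big_seq big1 // => j jr.
  by rewrite mxE eqxx /= (_ : j == i = false) ?expg0 //; apply: contraNF ir => /eqP <-.
by rewrite big_cat big_cons /= !skip // mul1g mulg1 mxE !eqxx expg1.
Qed.

Lemma bar_eq0 x : (bar x == 0%R) = (x \in L 2).
Proof.
apply/eqP/idP => [b0|]; last exact: bar_L2.
rewrite -f_eq1 -word_bar b0 /word_of big1 ?(mulg_morph1 fM) // => i _.
by rewrite mxE expg0.
Qed.

End QuotientSeries.

(** * The action of GL(d, F_p) *)

Section LinearAction.
Local Open Scope group_scope.
Variables (p : nat) (p_pr : prime p) (d n : nat).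
Hypothesis n_gt0 : 0 < n.
Local Notation F := (free_group d).
Local Notation Q := (free_quotient p_pr d n.+1).
Local Notation proj := (free_proj p_pr n : F -> Q).
Local Notation L i := (lower_quotient p_pr d n i).
Local Notation bar := (@bar p p_pr d n).
Implicit Types (u v : F) (x y : Q) (A B : 'M['F_p]_d).

(** [induces] asks for automorphisms. Endomorphisms are easier to construct
    and to compose, and those that lift invertible matrices are automorphisms
    by [lifts_inj]. *)
Definition lifts (a : Q -> Q) A :=
  {morph a : x y / x * y} /\ forall x, bar (a x) = (bar x *m A)%R.

Lemma Aut_morph (a : {perm Q}) : a \in Aut [set: Q] -> {morph a : x y / x * y}.
Proof.
by rewrite inE => /andP[_ /morphicP aM] x y; apply: aM; rewrite inE.
Qed.

Lemma inducesP (a : {perm Q}) A : a \in Aut [set: Q] -> induces a A = true <-> lifts a A.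
Proof.
move=> /Aut_morph aM.
have bE i : (a (proj (free_gen i)) * (\prod_(j < d) proj (free_gen j) ^+ (A i j : nat))^-1 \in L 2) =
    (bar (a (proj (free_gen i))) == row i A).
  rewrite -bar_eq0 // barM // barV // subr_eq0; congr (_ == _).
  rewrite -[RHS](bar_word p_pr n_gt0); congr bar; apply: eq_bigr => j _; by rewrite mxE.
split=> [/forallP h|[_ h]]; last first.
  by apply/forallP => i; rewrite bE h bar_gen // rowE.
split=> // x; have [w ->] := proj_surj x.
apply: (@free_additive_ext _ _ (fun u => bar (a (proj u))) (fun u => bar (proj u) *m A)%R).
- by move=> u v; rewrite projM aM barM.
- by move=> u v; rewrite projM barM // mulmxDl.
- by move=> i; apply/eqP; have := h i; rewrite bE bar_gen // rowE.
Qed.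

Lemma lifts_comp a b A B : lifts a A -> lifts b B -> lifts (b \o a) (A *m B)%R.
Proof.
move=> [aM ab] [bM bb]; split=> [x y|x] /=; first by rewrite aM bM.
by rewrite bb ab mulmxA.
Qed.

Lemma lifts_id : lifts id 1%:M%R.
Proof. by split=> // x; rewrite mulmx1. Qed.

(** Two lifts of A agree modulo L_2, hence by [series_morph_agree] on each
    L_(i+1) modulo L_(i+2). With i + 1 = n, where L_(n+1) = 1, it follows that
    the action on F_n / F_(n+1) does not depend on the lift. *)
Lemma lifts_agree a b A : lifts a A -> lifts b A ->
  forall i x, x \in L i.+1 -> a x * (b x)^-1 \in L i.+2.
Proof.
move=> [aM ab] [bM bb]; apply: quotient_agree => // x.
by rewrite -bar_eq0 // barM // barV // ab bb subrr.
Qed.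

Lemma lifts_eq a b A : lifts a A -> lifts b A -> {in L n, a =1 b}.
Proof.
move=> aA bA x Lx; apply/eqP; rewrite eq_mulgV1.
have := lifts_agree aA bA (i := n.-1); rewrite prednK // => /(_ x Lx).
by rewrite lower_quotient_last inE.
Qed.

(** If a lifts A and b lifts its inverse, then b \o a agrees with the identity
    on each L_(i+1) modulo L_(i+2). So an element of the kernel of a moves
    down the series until it lies in L_(n+1) = 1. *)
Lemma lifts_inj a A : lifts a A -> A \in unitmx ->
  (exists b, lifts b (invmx A)) -> injective a.
Proof.
move=> aA Au [b bB]; have [aM _] := aA; have [bM _] := bB.
have ba : lifts (b \o a) 1%:M%R by rewrite -(mulmxV Au); apply: lifts_comp.
have ker x : a x = 1 -> x = 1.
  move=> ax; have Lx i : x \in L i.+1.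
    elim: i => [|i IH]; first by rewrite lower_quotient1 inE.
    have := lifts_agree ba lifts_id IH; rewrite /= ax (mulg_morph1 bM) mul1g => h.
    by rewrite -(groupV (lower_quotient_groupType p_pr d n i.+2)).
  by apply/eqP; have := Lx n; rewrite lower_quotient_last inE.
move=> x y axy; apply/eqP; rewrite eq_mulgV1; apply/eqP/ker.
by rewrite aM (mulg_morphV aM) axy mulgV.
Qed.

(** The free group maps to Q by x_i |-> the word of row i of A. The
    homomorphism kills F_(n+1), because the subgroups L_i form a filtration of
    Q that ends with 1. *)
Lemma lifts_exists A : exists a, lifts a A.
Proof.
pose g i : Q := word_of p_pr n (row i A).
have [phi phiM phig] : exists2 phi : F -> Q, {morph phi : u v / u * v} &
    forall i, phi (free_gen i) = g i.
  by exists (free_hom g) => [|i]; [exact: free_homM | exact: free_hom_gen].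
have filt : p_filtration p (fun i x => x \in L i : Prop).
  split=> [i|x|i x|i x y].
  - by split=> [|x y Lx Ly]; rewrite ?group1 // groupM ?groupV.
  - by rewrite lower_quotient1 inE.
  - exact: lower_quotientX.
  - exact: lower_quotientR.
have phi_kills u : lower_p_series F p n.+1 u -> phi u = 1.
  move=> /(lower_series_image filt phiM); rewrite lower_quotient_last inE => /eqP //.
pose a x := phi (quotient_repr x).
have aP u : a (proj u) = phi u.
  apply/eqP; rewrite eq_mulgV1 -(mulg_morphV phiM) -phiM; apply/eqP/phi_kills.
  by apply: proj_eq; rewrite /free_proj quotient_reprK.
have aM : {morph a : x y / x * y}.
  move=> x y; have [u ->] := proj_surj x; have [v ->] := proj_surj y.
  by rewrite -projM !aP phiM.
exists a; split=> // x; have [u ->] := proj_surj x; rewrite aP.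
apply: (@free_additive_ext _ _ (fun u => bar (phi u)) (fun u => bar (proj u) *m A)%R).
- by move=> {}u v; rewrite phiM barM.
- by move=> {}u v; rewrite projM barM // mulmxDl.
- by move=> i; rewrite phig bar_word // bar_gen // rowE.
Qed.

Lemma GL_actP A : A \in unitmx -> lifts (GL_act A : Q -> Q) A.
Proof.
move=> Au; rewrite /GL_act; case: pickP => [a /andP[aAut /(inducesP _ aAut)] //|none].
have [a aA] := lifts_exists A.
have inj_a := lifts_inj aA Au (lifts_exists _).
have [aM _] := aA.
pose s := perm inj_a; have sA : s \in Aut [set: Q].
  rewrite inE; apply/andP; split; first by apply/subsetP => x _; rewrite inE.
  by apply/morphicP => x y _ _; rewrite !permE aM.
have sl : lifts s A by case: aA => _ ab; split=> [x y|x]; rewrite !permE.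
by have := none s; rewrite sA /= => /negP []; apply/(inducesP _ sA).
Qed.

Lemma GL_act_sub A x : A \in unitmx -> x \in L n -> GL_act A x \in L n.
Proof.
move=> /GL_actP[aM _] Lx.
by have := quotient_morph_sub (i := n.-1) aM; rewrite prednK //; apply.
Qed.

Lemma GL_actM A B x : A \in unitmx -> B \in unitmx -> x \in L n ->
  GL_act (A *m B)%R x = GL_act B (GL_act A x).
Proof.
move=> Au Bu Lx; have AB : (A *m B)%R \in unitmx by rewrite unitmx_mul Au.
exact: (lifts_eq (GL_actP AB) (lifts_comp (GL_actP Au) (GL_actP Bu)) Lx).
Qed.

Lemma GL_act1 x : x \in L n -> GL_act (1%:M : 'M['F_p]_d)%R x = x.
Proof. exact: (lifts_eq (GL_actP (unitmx1 _ _)) lifts_id). Qed.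

End LinearAction.

(** * Eigenspaces of an action that contains an exterior square *)

Section WedgeRank.
Local Open Scope ring_scope.
Variables (K : fieldType) (d m : nat).
Implicit Types (y z w : 'rV[K]_d).

Definition wedge_mx y z : 'M[K]_d := y^T *m z - z^T *m y.

Variables (A : 'M[K]_d) (T : 'M[K]_m) (P1 : 'M[K]_(m, d)) (P2 : 'M[K]_(m, d * d)).
Variables (pw : 'rV[K]_d -> 'rV[K]_m) (cm : 'rV[K]_d -> 'rV[K]_d -> 'rV[K]_m).
Hypothesis pwP1 : forall y, pw y *m P1 = y.
Hypothesis cmP1 : forall y z, cm y z *m P1 = 0.
Hypothesis cmP2 : forall y z, cm y z *m P2 = mxvec (wedge_mx y z).

Definition wedge_row w : 'M[K]_(d, d * d) := \matrix_i mxvec (wedge_mx w (delta_mx 0 i)).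

Lemma wedge_rowE w z : z *m wedge_row w = mxvec (wedge_mx w z).
Proof.
rewrite [z in RHS]row_sum_delta mulmx_sum_row.
have D (f : 'I_d -> 'rV[K]_d) : wedge_mx w (\sum_j f j) = \sum_j wedge_mx w (f j).
  by rewrite /wedge_mx sumrB mulmx_sumr -mulmx_suml raddf_sum.
rewrite D raddf_sum /=; apply: eq_bigr => j _; rewrite rowK -linearZ /=; congr mxvec.
by rewrite /wedge_mx -scalemxAr [(_ *: _)^T]linearZ /= -scalemxAl scalerBr.
Qed.

Lemma wedge_eq0 w z : w != 0 -> wedge_mx w z = 0 -> (z <= w)%MS.
Proof.
move=> /eqP w0 e; have [i wi] : exists i, w 0 i != 0.
  apply/existsP; apply: contraT; rewrite negb_exists => /forallP h; case: w0.
  by apply/rowP => j; rewrite mxE; apply/eqP/negbNE/h.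
have -> : z = ((w 0 i)^-1 * z 0 i) *: w.
  apply/rowP => j; rewrite mxE; move/matrixP/(_ i j): e; rewrite !mxE !big_ord1 !mxE.
  by move/subr0_eq => e; rewrite -mulrA -e mulKf.
exact: scalemx_sub.
Qed.

(** The kernel of z |-> w /\ z is the line spanned by w. *)
Lemma rank_wedge_row w (E : 'M[K]_d) : w != 0 ->
  (\rank E <= (\rank (E *m wedge_row w)).+1)%N.
Proof.
move=> w0; rewrite -(mxrank_mul_ker E (wedge_row w)) -addn1 leq_add2l.
apply: leq_trans (rank_leq_row w); apply: mxrankS.
apply: submx_trans (capmxSr _ _) _; apply/row_subP => i; apply: wedge_eq0 w0 _.
by apply: (can_inj mxvecK); rewrite -wedge_rowE linear0; apply/sub_kermxP/row_sub.
Qed.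

Lemma rank_P1 : \rank P1 = d.
Proof.
apply/eqP; rewrite eqn_leq rank_leq_col /=.
rewrite -{1}(mxrank1 K d); apply: mxrankS; apply/row_subP => i.
by rewrite -(pwP1 (row i 1%:M)) submxMl.
Qed.

Lemma dim_ge_d : (d <= m)%N.
Proof. by rewrite -[X in (X <= _)%N]rank_P1 rank_leq_row. Qed.

(** The d (d - 1) / 2 vectors [cm e_i e_j] with i < j lie in the kernel of P1,
    of dimension m - d, and their images under P2 are independent. *)
Lemma dim_ge_binomial : (d * d.+1 <= 2 * m)%N.
Proof.
pose N := [set ij : 'I_d * 'I_d | (ij.1 < ij.2)%N].
have cN : (#|N| + #|N| + d = d * d)%N.
  pose N' := [set ij : 'I_d * 'I_d | (ij.2 < ij.1)%N].
  pose N0 := [set ij : 'I_d * 'I_d | ij.1 == ij.2].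
  have e' : #|N'| = #|N|.
    have sw_inj : injective (fun ij : 'I_d * 'I_d => (ij.2, ij.1)).
      by move=> [a b] [a' b'] [-> ->].
    rewrite -(card_imset _ sw_inj); apply: eq_card => -[i j].
    apply/imsetP/idP => [[[a b]]|]; rewrite !inE /=; first by move=> h [-> ->].
    by move=> h; exists (j, i); rewrite ?inE.
  have e0 : #|N0| = d.
    rewrite -[RHS]card_ord -(card_imset _ (_ : injective (fun i : 'I_d => (i, i)))); last by move=> i j [].
    apply: eq_card => -[i j]; rewrite !inE /=; apply/eqP/imsetP => [->|[a _ [-> ->]]] //.
    by exists j.
  have cT : #|[set: 'I_d * 'I_d]| = (d * d)%N by rewrite cardsT card_prod card_ord.
  have U : [set: 'I_d * 'I_d] = N :|: N' :|: N0.
    by apply/setP => -[i j]; rewrite !inE /= -val_eqE /=; case: ltngtP.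
  move: cT; rewrite U !cardsU (_ : N :&: N' = set0) ?cards0 ?subn0; last first.
    by apply/setP => -[i j]; rewrite !inE /=; case: ltngtP.
  rewrite (_ : (N :|: N') :&: N0 = set0) ?cards0 ?subn0; last first.
    by apply/setP => -[i j]; rewrite !inE /= -val_eqE /=; case: ltngtP.
  by rewrite e' e0.
pose e (i : 'I_d) : 'rV[K]_d := delta_mx 0 i.
pose Y : 'M[K]_(#|N|, m) := \matrix_t cm (e (enum_val t).1) (e (enum_val t).2).
have YP1 : (Y <= kermx P1)%MS.
  by apply/sub_kermxP/row_matrixP => t; rewrite row_mul rowK cmP1 row0.
have free : \rank (Y *m P2) = #|N|.
  apply/eqP; rewrite -/(row_free _); apply/row_freeP.
  exists (\matrix_(s, t) (s == mxvec_index (enum_val t).1 (enum_val t).2)%:R).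
  apply/matrixP => s t; rewrite mxE (bigD1 (mxvec_index (enum_val t).1 (enum_val t).2)) //=.
  rewrite big1 ?addr0; last by move=> l /negPf h; rewrite [X in _ * X]mxE h mulr0.
  rewrite [X in _ * X]mxE eqxx mulr1.
  have -> : (Y *m P2) s (mxvec_index (enum_val t).1 (enum_val t).2) =
      (row s Y *m P2) 0 (mxvec_index (enum_val t).1 (enum_val t).2).
    by rewrite -row_mul [RHS]mxE.
  rewrite rowK cmP2 mxvecE /wedge_mx /e !mxE !big_ord1 !mxE !eqxx /=.
  have := enum_valP t; have := enum_valP s; rewrite !inE => hs ht.
  rewrite -(inj_eq enum_val_inj); move: hs ht.
  case: (enum_val s) (enum_val t) => [a b] [i j] /= ab ij.
  rewrite -!natrM !mulnb xpair_eqE (_ : (i == b) && (j == a) = false).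
    by rewrite subr0 [i == a]eq_sym [j == b]eq_sym.
  by apply/negP => /andP[/eqP ib /eqP ja]; move: ij; rewrite ib ja ltnNge ltnW.
have := mxrankS (submxMr P2 YP1); rewrite free => h1.
have := leq_trans h1 (mxrankM_maxl _ _); rewrite mxrank_ker rank_P1.
by have := dim_ge_d; move: cN; clear; nia.
Qed.

Hypothesis pwT : forall y, pw y *m T *m P1 = y *m A.
Hypothesis cmT1 : forall y z, cm y z *m T *m P1 = 0.
Hypothesis cmT2 : forall y z, cm y z *m T *m P2 = mxvec (wedge_mx (y *m A) (z *m A)).

(** Let s be the rank of A - c. The image of T - c projects by P1 onto at
    least the image of A - c, of dimension s. The part of that image in the
    kernel of P1 contains, as P2 shows, a copy of w /\ E for some w <> 0,
    where E is the eigenspace of A for c: if c = 1, use the vectors cm y z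
    with z in E and y such that w = y A - y is not 0; otherwise use cm w z
    with w and z in E, which is multiplied by c^2 - c <> 0. As E has dimension
    d - s, this adds d - s - 1. If E = 0, then s = d. *)
Lemma rank_eigenspace_le c : A \in unitmx -> A != 1%:M ->
  (\rank (eigenspace T c) + d.-1 <= m)%N.
Proof.
move=> Au A1; pose N := T - c%:M; pose E := eigenspace A c.
have rE : (\rank E + \rank (A - c%:M)%R = d)%N.
  by rewrite /E /eigenspace mxrank_ker subnK // rank_leq_row.
have h1 : (\rank (A - c%:M)%R <= \rank (N *m P1)%R)%N.
  apply: mxrankS; apply/row_subP => i.
  have -> : row i (A - c%:M) = pw (delta_mx 0 i) *m (N *m P1).
    by rewrite mulmxA mulmxBr mulmxBl pwT mul_mx_scalar -scalemxAl pwP1 rowE mulmxBr mul_mx_scalar.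
  exact: submxMl.
pose X := (N :&: kermx P1)%MS.
have Xmem y z : (mxvec (wedge_mx (y *m A) (z *m A) - c *: wedge_mx y z) <= X *m P2)%MS.
  have -> : mxvec (wedge_mx (y *m A) (z *m A) - c *: wedge_mx y z) = cm y z *m N *m P2.
    by rewrite /N mulmxBr mulmxBl cmT2 mul_mx_scalar -scalemxAl cmP2 linearB linearZ.
  apply: submxMr; rewrite sub_capmx submxMl /=; apply/sub_kermxP.
  by rewrite /N mulmxBr mulmxBl cmT1 mul_mx_scalar -scalemxAl cmP1 scaler0 subr0.
have EA z : (z <= E)%MS -> z *m A = c *: z by move/eigenspaceP.
have [h2|[w w0 [e e0 we]]] : \rank E = 0%N \/ exists2 w : 'rV[K]_d, w != 0 &
    exists2 e : K, e != 0 & forall z, (z <= E)%MS -> (e *: mxvec (wedge_mx w z) <= X *m P2)%MS.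
- have [c1|c1] := eqVneq c 1.
    right; have [i ri] : exists i, row i A != delta_mx 0 i.
      apply/existsP; apply: contraT; rewrite negb_exists => /forallP h; case/negP: A1.
      by apply/eqP/row_matrixP => i; rewrite row1; apply/eqP/negbNE/h.
    exists (row i A - delta_mx 0 i); first by rewrite subr_eq0.
    exists 1; first exact: oner_neq0.
    move=> z /EA zA; have := Xmem (delta_mx 0 i) z; rewrite zA c1 !scale1r -rowE.
    congr (_ <= _)%MS; congr mxvec.
    move: (row i A) (delta_mx 0 i) => y u.
    rewrite /wedge_mx [(y - u)^T]raddfB /= mulmxBl mulmxBr.
    move: (_ *m _) (_ *m _) (_ *m _) (_ *m _) => Y1 Y2 Y3 Y4.
    by apply/matrixP => r s; rewrite !mxE; ring.
  have [r0|r0] := posnP (\rank E); [by left | right].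
  have [w w0 wE] : exists2 w : 'rV[K]_d, w != 0 & (w <= E)%MS.
    by exists (nz_row E); rewrite ?nz_row_sub // nz_row_eq0 -mxrank_eq0 -lt0n.
  have c0 : c != 0.
    apply: contraNneq w0 => c0; have := EA w wE; rewrite c0 scale0r => wA.
    by rewrite -(mulmxK Au w) wA mul0mx.
  exists w => //; exists (c * c - c); first by rewrite -{3}[c]mulr1 -mulrBr mulf_neq0 // subr_eq0.
  move=> z zE; have := Xmem w z; rewrite (EA _ wE) (EA _ zE) -linearZ /=.
  congr (_ <= _)%MS; congr mxvec; rewrite scalerBl; congr (_ - _).
  by rewrite /wedge_mx ![(_ *: _)^T]linearZ /= -!scalemxAl -!scalemxAr !scalerA scalerBr.
- have := leq_trans h1 (mxrankM_maxl _ _); move: rE; rewrite h2.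
  rewrite /eigenspace mxrank_ker -/N; have := rank_leq_row N; clear; lia.
have h3 := rank_wedge_row E w0.
have h4 : (\rank (E *m wedge_row w) <= \rank X)%N.
  apply: leq_trans (mxrankM_maxl X P2); rewrite -(eqmx_scale _ e0); apply: mxrankS.
  apply/row_subP => i; rewrite rowE -scalemxAr mulmxA wedge_rowE; apply: we.
  by rewrite -rowE row_sub.
have := mxrank_mul_ker N P1; rewrite -/X /eigenspace mxrank_ker -/N.
move: rE h1 h3 h4 (rank_leq_row N); clear; lia.
Qed.

End WedgeRank.

(** * Powers and commutators in F_n / F_{n+1} *)

Section LastLayer.
Local Open Scope group_scope.
Variables (p : nat) (p_pr : prime p) (d k : nat).
Local Notation n := k.+2.
Local Notation F := (free_group d).
Local Notation Q := (free_quotient p_pr d n.+1).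
Local Notation proj := (free_proj p_pr n : F -> Q).
Local Notation L i := (lower_quotient p_pr d n i).
Local Notation bar := (@bar p p_pr d n).
Local Notation Phi := (@heis_hom d).
Implicit Types (u v : F) (x y : Q).

(** The two components of the image of x in the Heisenberg group, divided by
    the powers of p that [heis_filt] provides for x in L_n, and reduced modulo
    p. *)
Definition lam1 x : 'rV['F_p]_d :=
  intr_mx p (map_mx (fun z : int => (z %/ (p ^ k.+1)%:Z)%Z) (Phi (quotient_repr x)).1).
Definition lam2 x : 'M['F_p]_d :=
  intr_mx p (map_mx (fun z : int => (z %/ (p ^ k)%:Z)%Z) (Phi (quotient_repr x)).2).

Lemma divz_muln a b (A : 'M[int]_(a, b)) e : 
  map_mx (fun z : int => (z %/ (p ^ e)%:Z)%Z) (A *+ (p ^ e))%R = A.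
Proof.
apply/matrixP => i j; rewrite !(mxE, mulmxnE) -mulr_natr natz mulzK //.
by rewrite -lt0n expn_gt0 prime_gt0.
Qed.

(** Another representative of x differs by an element of F_(n+1), whose
    components are divisible by one more power of p. *)
Lemma lam_spec u (v : 'rV[int]_d) (B : 'M[int]_d) :
  Phi u = (v *+ p ^ k.+1, B *+ p ^ k)%R ->
  lam1 (proj u) = intr_mx p v /\ lam2 (proj u) = intr_mx p B.
Proof.
move=> e; set w := quotient_repr (proj u : Q).
have : lower_p_series F p n.+1 (w * u^-1).
  by apply: proj_eq; rewrite /free_proj quotient_reprK.
move/(heis_hom_filt (i := n)) => [v' [B' e']].
have : Phi w = Phi (w * u^-1) * Phi u by rewrite -heis_homM mulgVK.
rewrite e e' /lam1 /lam2 -/w => ->; rewrite /mulg /= /heis_mul /=.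
have -> : (v' *+ p ^ k.+2 + v *+ p ^ k.+1 = (v' *+ p ^ 1 + v) *+ p ^ k.+1)%R.
  by rewrite mulrnDl -mulrnA -expnD.
have -> : (B' *+ p ^ k.+1 + B *+ p ^ k + (v' *+ p ^ k.+2)^T *m (v *+ p ^ k.+1) =
    (B' *+ p ^ 1 + B + (v'^T *m v) *+ p ^ k.+3) *+ p ^ k)%R.
  rewrite trmxMn mulmxMnl mulmxMnr !mulrnDl -!mulrnA -!expnD add1n.
  by congr (_ + _ *+ _)%R; congr (_ ^ _)%N; lia.
by split; rewrite divz_muln !intr_mxD !intr_mx_muln !mulrn_p // ?add0r ?addr0.
Qed.

Lemma lamM x y : x \in L n -> y \in L n ->
  lam1 (x * y) = (lam1 x + lam1 y)%R /\ lam2 (x * y) = (lam2 x + lam2 y)%R.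
Proof.
case/lower_quotientP => u Lu ->; case/lower_quotientP => w Lw ->.
have [v [B eu]] := heis_hom_filt (i := k.+1) Lu.
have [v' [B' ew]] := heis_hom_filt (i := k.+1) Lw.
have [-> ->] := lam_spec eu; have [-> ->] := lam_spec ew.
have e : Phi (u * w) = ((v + v') *+ p ^ k.+1, (B + B' + (v^T *m v') *+ p ^ k.+2) *+ p ^ k)%R.
  rewrite heis_homM eu ew /mulg /= /heis_mul /= trmxMn mulmxMnl mulmxMnr.
  rewrite !mulrnDl -!mulrnA -!expnD; congr (_, _ + _ *+ _)%R; congr (_ ^ _)%N; lia.
by rewrite -projM; have [-> ->] := lam_spec e; rewrite !intr_mxD intr_mx_muln mulrn_p // addr0.
Qed.

Lemma pow_mem x i j : x \in L i.+1 -> x ^+ (p ^ j) \in L (i + j).+1.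
Proof.
move=> Lx; elim: j => [|j IH]; first by rewrite expn0 expg1 addn0.
by rewrite expnSr expgM addnS; apply: lower_quotientX.
Qed.

Definition top_pow x := x ^+ (p ^ k.+1).
Definition top_comm x y := [~ x, y] ^+ (p ^ k).

Lemma top_pow_mem x : top_pow x \in L n.
Proof. by apply: (@pow_mem _ 0); rewrite lower_quotient1 inE. Qed.

Lemma top_comm_mem x y : top_comm x y \in L n.
Proof. by apply: (@pow_mem _ 1); apply: lower_quotientR; rewrite lower_quotient1 inE. Qed.

Lemma lam1_top_pow x : lam1 (top_pow x) = bar x.
Proof.
have [u ->] := proj_surj x; rewrite /top_pow -(mulg_morphX (@projM _ _ _ _)) bar_proj //.
have Lpow : lower_p_series F p n (u ^+ (p ^ k.+1)).
  have pw j : lower_p_series F p j.+1 (u ^+ (p ^ j)).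
    by elim: j => // j IH; rewrite expnSr expgM; apply: lower_p_seriesX.
  exact: pw.
have [v [B e]] := heis_hom_filt (i := k.+1) Lpow.
have [-> _] := lam_spec e.
have : (v *+ p ^ k.+1 = (Phi u).1 *+ p ^ k.+1)%R.
  by have := congr1 fst e; rewrite (mulg_morphX (@heis_homM d)) heisX.
move/(congr1 (map_mx (fun z : int => (z %/ (p ^ k.+1)%:Z)%Z))).
by rewrite !divz_muln => ->.
Qed.

Lemma lam_top_comm x y :
  lam1 (top_comm x y) = 0%R /\ lam2 (top_comm x y) = wedge_mx (bar x) (bar y).
Proof.
have [u ->] := proj_surj x; have [v ->] := proj_surj y.
have e : Phi ([~ u, v] ^+ (p ^ k)) = (0%R *+ p ^ k.+1,
   ((Phi u).1^T *m (Phi v).1 - (Phi v).1^T *m (Phi u).1) *+ p ^ k)%R.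
  rewrite (mulg_morphX (@heis_homM d)) (mulg_morphR (@heis_homM d)) heisR heisX /=.
  by rewrite trmx0 mul0mx !mul0rn addr0.
rewrite /top_comm -(mulg_morphR (@projM _ _ _ _)) -(mulg_morphX (@projM _ _ _ _)); have [-> ->] := lam_spec e; rewrite !bar_proj //.
split; first by apply/matrixP => i j; rewrite !mxE.
rewrite /wedge_mx; apply/matrixP => i j; rewrite !mxE rmorphB /= !rmorph_sum /=.
by congr (_ - _)%R; apply: eq_bigr => l _; rewrite !mxE rmorphM.
Qed.

Lemma lower_quotient_top_abelem : p.-abelem (L n).
Proof.
apply/abelemP => //; split.
  apply/centsP => x Lx y _; apply/commgP.
  by have := lower_quotientR y (i := k.+1) Lx; rewrite lower_quotient_last inE.
by move=> x Lx; have := lower_quotientX (i := k.+1) Lx; rewrite lower_quotient_last inE => /eqP.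
Qed.

Lemma lower_quotient_top_neq1 : 0 < d -> L n != 1.
Proof.
move=> d0; apply/negP => /eqP L1.
have := top_pow_mem (proj (free_gen (Ordinal d0))); rewrite L1 inE => /eqP e.
have := lam1_top_pow (proj (free_gen (Ordinal d0))); rewrite e bar_gen //.
have -> : lam1 1 = 0%R.
  have [+ _] := lamM (group1 (lower_quotient_groupType p_pr d n n))
    (group1 (lower_quotient_groupType p_pr d n n)).
  by rewrite mulg1 => h; apply: (addrI (lam1 1)); rewrite -h addr0.
move/matrixP/(_ 0%R (Ordinal d0)); rewrite !mxE !eqxx /= => /eqP.
by rewrite eq_sym oner_eq0.
Qed.

End LastLayer.

(** * F_n / F_{n+1} as a vector space *)

Lemma additive_matrix (p a b : nat) (h : 'rV['F_p]_a -> 'rV['F_p]_b) :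
  (forall u v, h (u + v)%R = (h u + h v)%R) -> exists M, forall u, h u = (u *m M)%R.
Proof.
move=> hD; have h0 : h 0%R = 0%R by apply: (addrI (h 0%R)); rewrite -hD !addr0.
have hZ (c : 'F_p) u : h (c *: u)%R = (c *: h u)%R.
  rewrite -[c]natr_Zp !scaler_nat; elim: (nat_of_ord c) => [|k IH]; first by rewrite !mulr0n.
  by rewrite !mulrS hD IH.
exists (\matrix_i h (delta_mx 0 i))%R => u.
rewrite {1}[u]row_sum_delta mulmx_sum_row.
have hS (F : 'I_a -> 'rV['F_p]_a) : h (\sum_j F j)%R = (\sum_j h (F j))%R.
  by elim/big_rec2: _ => [//|i x y _ <-]; rewrite hD.
by rewrite hS; apply: eq_bigr => j _; rewrite hZ rowK.
Qed.

Section Coordinates.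
Local Open Scope group_scope.
Variables (p : nat) (p_pr : prime p) (d k : nat).
Local Notation n := k.+2.
Local Notation Q := (free_quotient p_pr d n.+1).
Local Notation L i := (lower_quotient p_pr d n i).
Local Notation m := (lower_rank p_pr d n).
Implicit Types (x : Q) (A : 'M['F_p]_d).
Hypothesis d_gt0 : 0 < d.

Definition is_coordinates r (f : Q -> 'rV['F_p]_r) (g : 'rV['F_p]_r -> Q) :=
  [/\ {in L n &, forall x y, f (x * y) = (f x + f y)%R}, forall u, g u \in L n,
      cancel g f & {in L n, cancel f g}].

Lemma coordinates_exist :
  exists (f : Q -> 'rV['F_p]_m) (g : 'rV['F_p]_m -> Q), is_coordinates f g.
Proof.
have abL := lower_quotient_top_abelem p_pr d k.
have ntL := lower_quotient_top_neq1 p_pr k d_gt0.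
have -> : m = (abelem_dim' (L n)).+1.
  have := dim_abelemE (E := lower_quotient_groupType p_pr d n n) abL ntL => ->.
  by rewrite /lower_rank (rank_pgroup (abelem_pgroup abL)) (p_rank_abelem abL).
exists (abelem_rV (E := lower_quotient_groupType p_pr d n n) abL ntL).
exists (rVabelem (E := lower_quotient_groupType p_pr d n n) abL ntL).
split; [exact: abelem_rV_M | exact: mem_rVabelem | exact: rVabelemK | exact: abelem_rV_K].
Qed.

Variables (f : Q -> 'rV['F_p]_m) (g : 'rV['F_p]_m -> Q).
Hypothesis fg : is_coordinates f g.

Let fM : {in L n &, forall x y, f (x * y) = (f x + f y)%R}. Proof. by case: fg. Qed.
Let gL u : g u \in L n. Proof. by case: fg. Qed.
Let gK : cancel g f. Proof. by case: fg. Qed.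
Let fK : {in L n, cancel f g}. Proof. by case: fg. Qed.

Let Lgrp := lower_quotient_groupType p_pr d n n.
Let LM x y : x \in L n -> y \in L n -> x * y \in L n. Proof. exact: (@groupM _ Lgrp). Qed.

Lemma coord_gD u v : g (u + v)%R = g u * g v.
Proof. by rewrite -[u]gK -[v]gK -fM ?gL // !fK ?LM ?gL. Qed.

Lemma coord_matrix b (h : Q -> 'rV['F_p]_b) :
  {in L n &, forall x y, h (x * y) = (h x + h y)%R} ->
  exists M, {in L n, forall x, h x = (f x *m M)%R}.
Proof.
move=> hM; have [|M hE] := @additive_matrix p m b (fun u => h (g u)).
  by move=> u v; rewrite coord_gD hM.
by exists M => x Lx; rewrite -hE fK.
Qed.

Definition acts_by A (T : 'M['F_p]_m) :=
  {in L n, forall x, f (GL_act A x) = (f x *m T)%R}.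

(** T is invertible because the matrix of the inverse of A is its inverse. *)
Lemma acts_by_exists A : A \in unitmx -> exists2 T, acts_by A T & T \in unitmx.
Proof.
move=> Au.
have ex B : B \in unitmx -> exists T, acts_by B T.
  move=> Bu; apply: coord_matrix => x y Lx Ly.
  have [aM _] := GL_actP p_pr (ltn0Sn k.+1) Bu.
  by rewrite aM fM // GL_act_sub.
have [T TA] := ex A Au; have AVu : (invmx A \in unitmx)%R by rewrite unitmx_inv.
have [S SA] := ex _ AVu; exists T => //.
suff /mulmx1_unit[] : (T *m S = 1%:M)%R by [].
apply/row_matrixP => i; rewrite row1 rowE mulmxA -[delta_mx 0%R i]gK -TA // -SA ?GL_act_sub //.
by rewrite -GL_actM // mulmxV // GL_act1.
Qed.

(** The p^(n-1)-st powers and the p^(n-2)-nd powers of commutators are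
    families of vectors with the properties that the section on exterior
    squares starts from. *)
Lemma lower_rank_ge_and_eigenspace_le A T : A \in unitmx -> acts_by A T ->
  [/\ d <= m, d * d.+1 <= 2 * m &
      (A != 1%:M)%R -> forall c, \rank (eigenspace T c) + d.-1 <= m].
Proof.
move=> Au TA.
have n0 : 0 < n by [].
have [P1 P1E] := coord_matrix (h := @lam1 p p_pr d k) (fun x y Lx Ly => (lamM Lx Ly).1).
have [|P2 P2E] := @coord_matrix (d * d) (fun x => mxvec (lam2 x)).
  by move=> x y Lx Ly; rewrite (lamM Lx Ly).2 linearD.
pose a : Q -> Q := GL_act A.
have [aM ab] : lifts a A := GL_actP p_pr n0 Au.
pose w (y : 'rV['F_p]_d) := word_of p_pr n y.
have wb y : bar (w y) = y by exact: bar_word.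
pose pw y := f (top_pow (w y)); pose cm y z := f (top_comm (w y) (w z)).
have pwP1 y : (pw y *m P1 = y)%R by rewrite -P1E ?top_pow_mem // lam1_top_pow wb.
have cmP1 y z : (cm y z *m P1 = 0)%R.
  by rewrite -P1E ?top_comm_mem // (lam_top_comm _ _).1.
have cmP2 y z : (cm y z *m P2 = mxvec (wedge_mx y z))%R.
  by rewrite -P2E ?top_comm_mem // (lam_top_comm _ _).2 !wb.
have pwT y : (pw y *m T *m P1 = y *m A)%R.
  rewrite -TA ?top_pow_mem // -P1E ?GL_act_sub ?top_pow_mem //.
  by rewrite -/(a _) (mulg_morphX aM) lam1_top_pow ab wb.
have cmT y z : f (a (top_comm (w y) (w z))) = (cm y z *m T)%R by rewrite TA ?top_comm_mem.
have ac y z : a (top_comm (w y) (w z)) = top_comm (a (w y)) (a (w z)).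
  by rewrite [LHS](mulg_morphX aM) (mulg_morphR aM).
have cmT1 y z : (cm y z *m T *m P1 = 0)%R.
  by rewrite -cmT ac -P1E ?top_comm_mem // (lam_top_comm _ _).1.
have cmT2 y z : (cm y z *m T *m P2 = mxvec (wedge_mx (y *m A) (z *m A)))%R.
  by rewrite -cmT ac -P2E ?top_comm_mem // (lam_top_comm _ _).2 !ab !wb.
split; [exact: dim_ge_d pwP1 | exact: dim_ge_binomial pwP1 cmP1 cmP2 |].
by move=> A1 c; apply: rank_eigenspace_le pwP1 cmP1 cmP2 pwT cmT1 cmT2 _ Au A1.
Qed.

Definition subspace_of (N : {set Q}) : 'M['F_p]_m := rowg_mx (f @: N).

Lemma normal_subsP (N : {set Q}) : N \in normal_subs p_pr d n ->
  group_set N /\ N \subset L n.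
Proof. by rewrite inE => /and3P[]. Qed.

Lemma rowg_subspace N : N \in normal_subs p_pr d n -> rowg (subspace_of N) = f @: N.
Proof.
move=> /normal_subsP[/group_setP[N1 NM] /subsetP NL].
have gN : group_set (f @: N).
  apply/group_setP; split.
    apply/imsetP; exists 1 => //; apply: (addrI (f 1)).
    by rewrite -fM ?mulg1 ?addr0 //; exact: (group1 Lgrp).
  move=> _ _ /imsetP[x Nx ->] /imsetP[y Ny ->].
  by apply/imsetP; exists (x * y); [exact: NM | rewrite fM ?NL].
exact: (rowg_mxK (Group gN)).
Qed.

Lemma subspace_inj : {in normal_subs p_pr d n &, injective subspace_of}.
Proof.
have rec N : N \in normal_subs p_pr d n -> N = g @: rowg (subspace_of N).
  move=> NN; rewrite rowg_subspace //; have [_ /subsetP NL] := normal_subsP NN.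
  rewrite -imset_comp -[LHS]imset_id; apply: eq_in_imset => x Nx /=.
  by rewrite fK ?NL.
by move=> N N' NN NN' e; rewrite (rec N NN) (rec N' NN') e.
Qed.

Lemma subspace_surj (W : 'M['F_p]_m) : <<W>>%MS = W ->
  exists2 N, N \in normal_subs p_pr d n & subspace_of N = W.
Proof.
move=> gW; exists (g @: rowg W); last first.
  rewrite /subspace_of -imset_comp (_ : _ @: _ = rowg W).
    by rewrite -[RHS]gW -[LHS]genmx_id; apply/genmxP/eqmxP/rowgK.
  by rewrite -[RHS]imset_id; apply: eq_imset => u /=; rewrite gK.
have sL : g @: rowg W \subset L n by apply/subsetP => _ /imsetP[u _ ->].
have gN : group_set (g @: rowg W).
  apply/group_setP; split.
    by apply/imsetP; exists 0%R; rewrite ?inE ?sub0mx //; apply: (mulgI (g 0%R)); rewrite -coord_gD addr0 mulg1.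
  move=> _ _ /imsetP[u + ->] /imsetP[v + ->]; rewrite !inE => uW vW.
  by apply/imsetP; exists (u + v)%R; rewrite ?inE ?addmx_sub ?coord_gD.
rewrite inE gN sL andbT /=; apply: (@sub_center_normal _ (Group gN)).
apply/subsetP => x /(subsetP sL) Lx; apply/centerP; split; first by rewrite inE.
move=> y _; apply/commgP.
by have := lower_quotientR y (i := k.+1) Lx; rewrite lower_quotient_last inE.
Qed.

Lemma card_normal_subs :
  #|normal_subs p_pr d n| = #|[set W : 'M['F_p]_m | <<W>>%MS == W]|.
Proof.
rewrite -(card_in_imset subspace_inj); apply: eq_card => W; rewrite inE.
apply/imsetP/eqP => [[N NN ->]|/subspace_surj[N NN <-]]; last by exists N.
exact: genmx_id.
Qed.

(** A maps N into itself exactly when it maps N onto itself, since A acts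
    injectively on the finite set N. *)
Lemma card_fixed_subs A T : A \in unitmx -> acts_by A T ->
  #|[set N in normal_subs p_pr d n | GL_act A @: N == N]| = #|stable_subs T|.
Proof.
move=> Au TA.
have stE N : N \in normal_subs p_pr d n ->
    (GL_act A @: N == N) = ((subspace_of N *m T)%R <= subspace_of N)%MS.
  move=> NN; have [gN /subsetP NL] := normal_subsP NN; have rN := rowg_subspace NN.
  have memN x : x \in L n -> (x \in N) = (f x <= subspace_of N)%MS.
    move=> Lx; rewrite -mem_rowg rN; apply/idP/imsetP => [Nx|[y Ny e]]; first by exists x.
    by rewrite -(fK Lx) e fK ?NL.
  have inj : {in N &, injective (GL_act A : Q -> Q)}.
    have Vu : (invmx A \in unitmx)%R by rewrite unitmx_inv.
    move=> x y Nx Ny /(congr1 (GL_act (invmx A) : Q -> Q)).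
    by rewrite -!GL_actM ?NL // mulmxV // !GL_act1 ?NL.
  rewrite eqEcard card_in_imset // leqnn andbT; apply/subsetP/idP => [st|st _ /imsetP[x Nx ->]].
    apply/row_subP => i; rewrite row_mul; set u := row i _.
    have gN' : g u \in N by rewrite memN ?gL // gK row_sub.
    have : GL_act A (g u) \in N by apply: st; apply: imset_f.
    by rewrite memN ?GL_act_sub ?gL // TA ?gL // gK.
  rewrite memN ?GL_act_sub ?NL // TA ?NL //; apply: submx_trans (submxMr _ _) st.
  by rewrite -memN ?NL.
rewrite -(card_in_imset (_ : {in _ &, injective subspace_of})); last first.
  by move=> N N' /setIdP[NN _] /setIdP[NN' _]; apply: subspace_inj.
apply: eq_card => W; rewrite !inE; apply/imsetP/andP => [[N /setIdP[NN st] ->]|[/eqP gW st]].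
  by rewrite genmx_id eqxx -stE.
by have [N NN e] := subspace_surj gW; exists N => //; rewrite inE NN stE ?e.
Qed.

End Coordinates.

(** * Counting orbits *)

Section OrbitCount.
Local Open Scope group_scope.
Variables (p : nat) (p_pr : prime p) (d k : nat).
Local Notation n := k.+2.
Local Notation Q := (free_quotient p_pr d.+1 n.+1).
Local Notation L i := (lower_quotient p_pr d.+1 n i).
Local Notation X := (normal_subs p_pr d.+1 n).
Local Notation gT := {'GL_d.+1['F_p]}.
Implicit Types (A B : 'M['F_p]_d.+1) (N : {set Q}).

Definition sub_act A N : {set Q} := GL_act A @: N.
Definition fixed_subs A : {set {set Q}} := [set N in X | sub_act A N == N].

Let n0 : 0 < n. Proof. by []. Qed.

Lemma sub_actM A B N : A \in unitmx -> B \in unitmx -> N \in X ->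
  sub_act (A *m B)%R N = sub_act B (sub_act A N).
Proof.
move=> Au Bu /normal_subsP[_ /subsetP NL]; rewrite /sub_act -imset_comp.
by apply: eq_in_imset => x Nx /=; rewrite GL_actM ?NL.
Qed.

Lemma sub_act1 N : N \in X -> sub_act 1%:M%R N = N.
Proof.
move=> /normal_subsP[_ /subsetP NL]; rewrite -[RHS]imset_id.
by apply: eq_in_imset => x Nx /=; rewrite GL_act1 ?NL.
Qed.

Lemma sub_act_mem A N : A \in unitmx -> N \in X -> sub_act A N \in X.
Proof.
move=> Au NX; have [gN /subsetP NL] := normal_subsP NX.
have [aM _] := GL_actP p_pr n0 Au; have /group_setP[N1 NM] := gN.
have gA : group_set (sub_act A N).
  apply/group_setP; split.
    by apply/imsetP; exists 1; rewrite ?(mulg_morph1 aM).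
  move=> _ _ /imsetP[x Nx ->] /imsetP[y Ny ->].
  by apply/imsetP; exists (x * y); [exact: NM | rewrite aM].
have sL : sub_act A N \subset L n.
  by apply/subsetP => _ /imsetP[x Nx ->]; rewrite GL_act_sub ?NL.
rewrite inE gA sL andbT /=; apply: (@sub_center_normal _ (Group gA)).
apply/subsetP => x /(subsetP sL) Lx; apply/centerP; split; first by rewrite inE.
move=> y _; apply/commgP.
by have := lower_quotientR y (i := k.+1) Lx; rewrite lower_quotient_last inE.
Qed.

(** Extended by the identity to all sets of elements, in order to be an action
    of the matrix group on a type. *)
Definition act_fun N (u : gT) : {set Q} :=
  if N \in X then sub_act (GLval u) N else N.

Lemma act_fun_is_action : is_action [set: gT] act_fun.
Proof.
apply: is_total_action => [N|N u v]; rewrite /act_fun.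
  by case: ifP => // NX; rewrite sub_act1.
case: ifP => NX; last by rewrite NX.
have uu := GL_unitmx u; have vu := GL_unitmx v.
by rewrite sub_act_mem // -sub_actM.
Qed.
Canonical sub_action := Action act_fun_is_action.

Lemma GL_ofP A : A \in unitmx -> exists u : gT, GLval u = A.
Proof. by move=> Au; exists (insubd (1 : gT) A); rewrite val_insubd Au. Qed.

Lemma orbitsE : orbits p_pr d.+1 n = orbit sub_action [set: gT] @: X.
Proof.
apply: eq_in_imset => N NX; apply/setP => N'; apply/imsetP/imsetP => [[A + ->]|[u _ ->]].
  rewrite inE => /GL_ofP[u <-]; by exists u; [rewrite in_setT | rewrite /= /act_fun NX].
by exists (GLval u); [rewrite inE; exact: (GL_unitmx u) | rewrite /= /act_fun NX].
Qed.

Lemma card_GLE : #|GL p d.+1| = #|[set: gT]|.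
Proof.
rewrite -(card_imset [set: gT] (@val_inj _ _ _)); apply: eq_card => A; rewrite inE.
by apply/idP/imsetP => [/GL_ofP[u <-]|[u _ ->]]; [exists u | exact: (GL_unitmx u)].
Qed.

Lemma sum_fixed :
  (\sum_(A in GL p d.+1) #|fixed_subs A| = #|orbits p_pr d.+1 n| * #|GL p d.+1|)%N.
Proof.
rewrite orbitsE card_GLE -(@Frobenius_Cauchy _ _ _ sub_action); last first.
  apply/actsP => u _ N /=; rewrite /act_fun; case: ifP => [NX|->] //.
  by apply: sub_act_mem => //; exact: (GL_unitmx u).
have -> : GL p d.+1 = val @: [set: gT].
  apply/setP => A; rewrite inE.
  by apply/idP/imsetP => [/GL_ofP[u <-]|[u _ ->]]; [exists u | exact: (GL_unitmx u)].
have inj_val : {in [set: gT] &, injective (val : gT -> 'M['F_p]_d.+1)}.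
  by move=> u v _ _; apply: val_inj.
rewrite (big_imset _ inj_val) /=.
apply: eq_bigr => u _; apply: eq_card => N; rewrite !inE.
apply: andb_id2l => NX; rewrite sub1set inE /= /act_fun.
by move: NX; rewrite inE => ->.
Qed.

Lemma fixed_subs1 : fixed_subs 1%:M%R = X.
Proof.
by apply/setP => N; rewrite inE; case: (boolP (N \in X)) => //= NX; rewrite sub_act1 ?eqxx.
Qed.

(** Every subspace with trivial stabilizer lies in a regular orbit, because
    the stabilizers along an orbit are conjugate; every other one is fixed by
    some A <> 1. *)
Lemma card_subs_le_regular :
  (#|X| <= #|regular_orbits p_pr d.+1 n| * #|GL p d.+1| +
    \sum_(A in GL p d.+1 | A != 1%:M%R) #|fixed_subs A|)%N.
Proof.
pose Y := [set N in X | GL_stab N == [set 1%:M%R]].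
have sX : X \subset Y :|: \bigcup_(A in GL p d.+1 | A != 1%:M%R) fixed_subs A.
  apply/subsetP => N NX; rewrite inE [N \in Y]inE NX /=.
  have [//|nst] := eqVneq (GL_stab N) _; apply/bigcupP.
  have : ~~ (GL_stab N \subset [set 1%:M%R]).
    apply: contra nst => sub; rewrite eqEsubset sub sub1set !inE unitmx1 /=.
    by apply/eqP; apply: sub_act1.
  case/subsetPn => A; rewrite !inE => /andP[Au fixA] A1.
  exists A; first by rewrite inE Au.
  by rewrite inE NX.
apply: (leq_trans (subset_leq_card sX)); apply: (leq_trans (leq_card_setU _ _)).
apply: leq_add; last by apply: leq_card_bigcup.
have sY : Y \subset \bigcup_(O in regular_orbits p_pr d.+1 n) O.
  apply/subsetP => N; rewrite inE => /andP[NX /eqP st]; apply/bigcupP.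
  exists (GL_orbit N); last first.
    by apply/imsetP; exists 1%:M%R; rewrite ?inE ?unitmx1 // -/(sub_act _ N) sub_act1.
  rewrite inE; apply/andP; split; first exact: imset_f.
  apply/forall_inP => _ /imsetP[B + ->]; rewrite inE => Bu.
  rewrite -/(sub_act B N) eqEsubset; apply/andP; split; last first.
    rewrite sub1set !inE unitmx1 -/(sub_act _ (sub_act B N)) /=.
    by rewrite sub_act1 // sub_act_mem.
  apply/subsetP => A; rewrite [A \in GL_stab _]inE inE => /andP[Au /eqP fixA].
  have BVu : invmx B \in unitmx by rewrite unitmx_inv.
  have : (B *m A *m invmx B)%R \in GL_stab N.
    rewrite !inE !unitmx_mul Bu Au BVu /= -/(sub_act _ N).
    rewrite !sub_actM ?unitmx_mul ?Bu ?Au // /sub_act fixA -/(sub_act B N) -/(sub_act _ _).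
    by rewrite -sub_actM // mulmxV // sub_act1.
  rewrite st inE => /eqP h; rewrite inE; apply/eqP.
  by rewrite -[A](mulKmx Bu) -[(B *m A)%R](mulmxKV Bu) h mul1mx mulVmx.
apply: (leq_trans (subset_leq_card sY)); apply: (leq_trans (leq_card_bigcup _ _)).
rewrite -sum_nat_const; apply: leq_sum => O; rewrite inE => /andP[/imsetP[N _ ->] _].
exact: leq_imset_card.
Qed.

End OrbitCount.

(** * The constants C(q) and D(q) *)

From mathcomp Require Import all_classical all_reals all_analysis.

Section Constants.
Local Open Scope ring_scope.
Local Open Scope classical_set_scope.
Variables (R : realType) (q : R).
Hypothesis q2 : 2 <= q.

Let q0 : 0 < q. Proof. by apply: lt_le_trans q2. Qed.
Let q1 : 1 < q. Proof. by apply: lt_le_trans q2; lra. Qed.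

(** Induction: (1 / 4 + y) (1 - y) >= 1 / 4 + y / 2 for 0 <= y <= 1 / 4,
    applied to y = 2^(- k - 2). *)
Lemma euler_prod_inv_ge k : 4^-1 + 2^-1 ^+ k.+2 <= \prod_(1 <= j < k.+2) (1 - q ^- j).
Proof.
elim: k => [|k IH].
  rewrite big_nat1 expr1; have : q^-1 <= 2^-1 by rewrite lef_pV2 ?posrE.
  lra.
rewrite big_nat_recr //=.
have h : 1 - 2^-1 ^+ k.+2 <= 1 - q ^- k.+2.
  by rewrite lerD2l lerN2 exprVn lef_pV2 ?posrE ?exprn_gt0 // lerXn2r ?nnegrE ?(ltW q0).
have x2 : 2^-1 ^+ k.+2 <= 4^-1 :> R.
  rewrite !exprS mulrA -[leRHS]mulr1 ler_pM ?mulr_ge0 ?exprn_ge0 //; first lra.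
  by apply: exprn_ile1; lra.
have x0 : 0 < 2^-1 ^+ k.+2 :> R by rewrite exprn_gt0.
apply: le_trans (ler_pM _ _ IH h); last first.
- by lra.
- by rewrite addr_ge0 // ltW.
rewrite [2^-1 ^+ k.+3]exprS; move: (2^-1 ^+ k.+2) x0 x2 => x x0 x2; nra.
Qed.

Lemma euler_prod_le4 k : euler_prod q k <= 4.
Proof.
case: k => [|k]; first by rewrite /euler_prod big_geq //; lra.
have e : euler_prod q k.+1 = (\prod_(1 <= j < k.+2) (1 - q ^- j))^-1.
  by rewrite /euler_prod -prodfV.
have := euler_prod_gt0 k.+1 q1; rewrite e invr_gt0 => pos.
rewrite -[leRHS]invrK lef_pV2 ?posrE ?invr_gt0 //.
by apply: le_trans (euler_prod_inv_ge k); rewrite lerDl exprn_ge0.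
Qed.

(** The partial products increase and are bounded, so their limit is their
    supremum. *)
Lemma euler_prod_le_Dfun k : euler_prod q k <= Dfun q.
Proof.
have nd : nondecreasing_seq (euler_prod q).
  apply/nondecreasing_seqP => n; rewrite euler_prodS ler_peMr //.
    by rewrite ltW // euler_prod_gt0.
  rewrite invf_ge1 ?euler_factor_gt0 // lerBlDl lerDr.
  by rewrite invr_ge0 exprn_ge0 // ltW.
apply: (@nondecreasing_cvgn_le R (euler_prod q)) => //.
apply: nondecreasing_is_cvgn => //.
by exists 4 => _ [n _ <-]; exact: euler_prod_le4.
Qed.

Definition int_range N : seq int :=
  [seq Posz i | i <- iota 0 N] ++ [seq Negz i | i <- iota 0 N].

Lemma int_range_uniq N : uniq (int_range N).
Proof.
rewrite cat_uniq !map_inj_uniq ?iota_uniq ?andbT /=; try by move=> i j [].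
by apply/hasPn => _ /mapP[i _ ->]; apply/mapP => -[].
Qed.

Lemma gauss_sum_int N : \sum_(r <- int_range N) q ^ (- r ^+ 2) = gauss_sum q N.
Proof.
rewrite big_cat !big_map /gauss_sum /= -[N in iota 0 N]subn0 -/(index_iota 0 N) !big_mkord.
congr (_ + _); apply: eq_bigr => i _.
  by rewrite expr2 -PoszM mulnn -exprnN.
Qed.

Lemma gauss_sum_le3 N : gauss_sum q N <= 3.
Proof.
have pow2 (i k : nat) : (i <= k)%N -> q ^- k <= 2^-1 ^+ i.
  move=> ik; rewrite exprVn lef_pV2 ?posrE ?exprn_gt0 //.
  apply: (@le_trans _ _ (q ^+ i)); first by rewrite lerXn2r ?nnegrE ?(ltW q0).
  by rewrite ler_eXn2l.
have geo n : \sum_(i < n) 2^-1 ^+ i = 2 - 2 * 2^-1 ^+ n :> R.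
  elim: n => [|n IH]; first by rewrite big_ord0 expr0; lra.
  by rewrite big_ord_recr /= IH exprS; move: (2^-1 ^+ n) => x; lra.
have x0 : 0 <= 2^-1 ^+ N :> R by rewrite exprn_ge0.
apply: (@le_trans _ _ (\sum_(i < N) 2^-1 ^+ i + \sum_(i < N) 2^-1 * 2^-1 ^+ i)).
  apply: lerD; apply: ler_sum => i _; first by apply: pow2; nia.
  by rewrite -exprS; apply: pow2; nia.
by rewrite -mulr_sumr geo; lra.
Qed.

Lemma sum_uniq_le3 (s : seq int) : uniq s -> \sum_(r <- s) q ^ (- r ^+ 2) <= 3.
Proof.
move=> us; pose M := (\max_(r <- s) absz r).+1.
have sub : {subset s <= int_range M}.
  move=> r rs; rewrite mem_cat.
  have : (absz r < M)%N by rewrite ltnS; exact: (@leq_bigmax_seq _ _ xpredT absz).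
  case: r {rs} => r rM; apply/orP; [left|right].
    by apply: map_f; rewrite mem_iota.
  by apply: map_f; rewrite mem_iota /= (ltn_trans _ rM).
have perm : perm_eq s [seq r <- int_range M | r \in s].
  apply: uniq_perm; rewrite ?filter_uniq ?int_range_uniq //.
  by move=> r; rewrite mem_filter; case: (boolP (r \in s)) => //= /sub ->.
rewrite (perm_big _ perm) big_filter.
apply: le_trans (gauss_sum_le3 M); rewrite -gauss_sum_int [leLHS]big_mkcond.
by apply: ler_sum => r _; case: ifP => // _; rewrite exprz_ge0 // ltW.
Qed.

(** The sum over all integers is finite, by [sum_uniq_le3]; this matters
    because [fine] would turn an infinite value into 0. *)
Lemma gauss_sum_le_Cfun N : gauss_sum q N <= Cfun q.
Proof.
pose f (r : int) : \bar R := (q ^ (- r ^+ 2))%:E.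
have fge0 r : (0 <= f r)%E by rewrite lee_fin exprz_ge0 // ltW.
have sumE s : (\sum_(r <- s) f r = (\sum_(r <- s) q ^ (- r ^+ 2))%:E)%E.
  by rewrite sumEFin.
have le3 : (\esum_(r in [set: int]) f r <= 3%:E)%E.
  apply: ub_ereal_sup => _ [X [finX _] <-]; rewrite fsbig_finite //=.
  by rewrite sumE lee_fin; apply: sum_uniq_le3; exact: finmap.fset_uniq.
have ge : ((gauss_sum q N)%:E <= \esum_(r in [set: int]) f r)%E.
  apply: esum_ge; exists [set` int_range N]; first by split=> //; exact: finite_seq.
  by rewrite -fsbig_seq ?int_range_uniq //= sumE gauss_sum_int.
rewrite -lee_fin /Cfun fineK // ge0_fin_numE; last by apply: esum_ge0 => r _; exact: fge0.
by apply: le_lt_trans le3 _; rewrite ltry.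
Qed.

End Constants.

(** * The fixed subspaces of a nonidentity matrix *)

Local Open Scope ring_scope.

(** Add the bounds of [card_between_ge] for the subspaces between 0 and the
    whole space. *)
Lemma theta_le_card_subs (R : realFieldType) (F : finFieldType) m :
  theta (#|F|%:R : R) m <= #|[set W : 'M[F]_m | <<W>>%MS == W]|%:R.
Proof.
have -> : #|[set W : 'M[F]_m | <<W>>%MS == W]| =
    (\sum_(r < m.+1) #|between r (0 : 'M[F]_m) 1%:M|)%N.
  rewrite card_by_rank; apply: eq_bigr => r _; apply: eq_card => W.
  by rewrite !inE sub0mx submx1 !andbT.
rewrite natr_sum; apply: ler_sum => r _; rewrite -natrX ler_nat.
have rm : (r <= m)%N by rewrite -ltnS.
have r0 : (\rank (0%R : 'M[F]_m) <= r)%N by rewrite mxrank0.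
by have := card_between_ge r0 rm; rewrite mxrank0 subn0 mulnC.
Qed.

(** By hypothesis nOrb nGL = nC + S <= (1 + kappa) nC and nReg nGL >= nC - S
    >= (1 - kappa) nC; the quotient of the two gives the second part. *)
Lemma orbit_ratio_bounds (R : realType) (kappa nC nGL nOrb nReg S : R) :
  0 < nC -> 0 < nGL -> 0 <= S -> S <= kappa * nC -> 0 <= nReg -> nReg <= nOrb ->
  nOrb * nGL = nC + S -> nC <= nReg * nGL + S ->
  1 <= nOrb * nGL / nC <= 1 + kappa
  /\ ((kappa < 1 -> 1 <= nOrb / nReg <= (1 + kappa) / (1 - kappa))
      /\ (0 < nReg -> 1 <= nOrb / nReg)).
Proof.
move=> C0 G0 S0 Sk R0 RO e1 e2; split; last split.
- by rewrite e1 ler_pdivlMr // ler_pdivrMr //; apply/andP; split; lra.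
- move=> k1; have Rpos : 0 < nReg.
    rewrite -(pmulr_lgt0 _ G0) (@lt_le_trans _ _ (nC * (1 - kappa))) ?mulr_gt0 ?subr_gt0 //.
    lra.
  rewrite ler_pdivlMr // mul1r RO /= ler_pdivrMr // mulrAC ler_pdivlMr ?subr_gt0 //.
  rewrite -(ler_pM2r G0) mulrAC e1 -mulrA.
  have h : nC * (1 - kappa) <= nReg * nGL by lra.
  have k0 : 0 <= kappa by rewrite -(pmulr_lge0 _ C0) (le_trans S0).
  have : (nC + S) * (1 - kappa) <= nC * (1 + kappa) * (1 - kappa).
    by rewrite ler_wpM2r ?subr_ge0 ?(ltW k1) //; lra.
  move/le_trans; apply.
  have := ler_wpM2l (_ : 0 <= 1 + kappa) h; rewrite addr_ge0 // => /(_ isT).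
  by lra.
- by move=> Rpos; rewrite ler_pdivlMr // mul1r.
Qed.

Lemma card_GL_le p d : prime p -> (#|GL p d| <= p ^ (d * d))%N.
Proof.
move=> p_pr; have <- : #|{: 'M['F_p]_d}| = (p ^ (d * d))%N by rewrite card_mx card_Fp.
exact: max_card.
Qed.

Section FixedSubspaces.
Variables (R : realType) (p : nat) (p_pr : prime p) (d k : nat).
Local Notation n := k.+2.
Local Notation m := (lower_rank p_pr d.+1 n).
Local Notation P := (p%:R : R).

Let P2 : 2 <= P. Proof. by rewrite ler_nat prime_gt1. Qed.
Let cardF : #|'F_p|%:R = P. Proof. by rewrite card_Fp. Qed.
Let t := P `^ (1 / 4).
Let t0 : 0 < t. Proof. by apply: powR_gt0; apply: lt_le_trans P2. Qed.
Let t4 : t ^+ 4 = P.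
Proof.
rewrite -powR_mulrn ?ltW // -powRrM (_ : 1 / 4 * 4 = 1); last by lra.
by rewrite powRr1.
Qed.

Lemma lower_rank_ge : (d.+1 * d.+2 <= 2 * m)%N.
Proof.
have [f [g fg]] := coordinates_exist p_pr k (ltn0Sn d).
have [T TA _] := acts_by_exists fg (unitmx1 _ d.+1).
by have [_ h _] := lower_rank_ge_and_eigenspace_le fg (unitmx1 _ _) TA.
Qed.

Lemma card_subs_theta : theta P m <= #|normal_subs p_pr d.+1 n|%:R.
Proof.
have [f [g fg]] := coordinates_exist p_pr k (ltn0Sn d).
by rewrite (card_normal_subs fg) -cardF theta_le_card_subs.
Qed.

(** T is not scalar: its eigenspaces have codimension at least d, which is
    positive. The fourth root t of p makes the exponents of p integral. *)
Lemma fixed_bound_high (A : 'M['F_p]_d.+1) : (2 <= d)%N -> A \in unitmx -> A != 1%:M ->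
  t ^+ (2 * m) * #|fixed_subs p_pr k A|%:R <=
    Cfun P ^+ 2 * Dfun P * t ^+ 3 * #|normal_subs p_pr d.+1 n|%:R.
Proof.
move=> d2 Au A1.
have [f [g fg]] := coordinates_exist p_pr k (ltn0Sn d).
have [T TA Tu] := acts_by_exists fg Au.
have [dm _ /(_ A1) far] := lower_rank_ge_and_eigenspace_le fg Au TA.
rewrite (card_fixed_subs fg Au TA).
have nonscal : ~~ scalar_on T 1%:M.
  apply/negP => /existsP[c /mxrankS]; rewrite mxrank1 => full.
  have : (m + d <= m + 0)%N by rewrite addn0; apply: leq_trans (far c); rewrite leq_add2r.
  by rewrite leq_add2l leqn0 => /eqP d0; rewrite d0 in d2.
have De k' : euler_prod (#|'F_p|%:R : R) k' <= Dfun P by rewrite cardF euler_prod_le_Dfun.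
have m3 : (3 <= m)%N by apply: leq_trans dm.
have := card_stable_le De nonscal m3 Tu; rewrite cardF => h1.
have h2 := theta_ratio_le P2 (gauss_sum_le_Cfun P2) t0 t4 m3.
have D0 : 0 <= Dfun P.
  by have := De 0; rewrite /euler_prod big_geq // => /(le_trans ler01).
apply: (@le_trans _ _ (t ^+ (2 * m) * (4 * theta P m.-1) * Dfun P)).
  rewrite -mulrA ler_wpM2l ?exprn_ge0 ?(ltW t0) //; apply: (le_trans h1).
  by rewrite mulrAC.
apply: le_trans (ler_wpM2r D0 h2) _.
rewrite (_ : _ * theta P m * _ = Cfun P ^+ 2 * Dfun P * t ^+ 3 * theta P m); last by ring.
apply: ler_wpM2l card_subs_theta.
by apply: mulr_ge0; [apply: mulr_ge0 (sqr_ge0 _) D0 | rewrite exprn_ge0 ?(ltW t0)].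
Qed.

(** The eigenspaces have codimension at least d >= 9, and m >= (d + 1) (d + 2)
    / 2 >= 55. *)
Lemma fixed_bound_two (A : 'M['F_p]_d.+1) : (9 <= d)%N -> A \in unitmx -> A != 1%:M ->
  P ^+ (2 * m) * #|fixed_subs p_pr k A|%:R <=
    Cfun P ^+ 5 * Dfun P ^+ 4 * (P ^+ 4 * t) * #|normal_subs p_pr d.+1 n|%:R.
Proof.
move=> d9 Au A1.
have [f [g fg]] := coordinates_exist p_pr k (ltn0Sn d).
have [T TA Tu] := acts_by_exists fg Au.
have [dm dm2 /(_ A1) far] := lower_rank_ge_and_eigenspace_le fg Au TA.
rewrite (card_fixed_subs fg Au TA).
have De k' : euler_prod (#|'F_p|%:R : R) k' <= Dfun P by rewrite cardF euler_prod_le_Dfun.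
have D1 : 1 <= Dfun P by have := De 0; rewrite /euler_prod big_geq.
have C1 : 1 <= Cfun P by exact: (gauss_bound_ge1 P2 (gauss_sum_le_Cfun P2)).
have m55 : (55 <= m)%N by move: dm2 d9; clear; nia.
have far9 c : (\rank (eigenspace T c) + 9 <= m)%N.
  by apply: leq_trans (far c); rewrite leq_add2l.
have m37 : (37 <= m)%N by apply: leq_trans m55.
have := card_stable_far_le De Tu far9 m37; rewrite cardF => h1.
have h2 := far_bound_le P2 (gauss_sum_le_Cfun P2) t0 t4 D1 m55.
apply: le_trans (ler_wpM2l _ h1) (le_trans h2 _); first by rewrite exprn_ge0.
rewrite ler_wpM2l ?card_subs_theta //.
have [C0 D0 P0] := And3 (le_trans ler01 C1) (le_trans ler01 D1) (le_trans (ler0n R 2) P2).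
by do !apply: mulr_ge0; rewrite ?exprn_ge0 ?(ltW t0).
Qed.

Local Notation nC := (#|normal_subs p_pr d.+1 n|%:R : R).
Local Notation S :=
  ((\sum_(A in GL p d.+1 | A != 1%:M) #|fixed_subs p_pr k A|)%:R : R).

Lemma fixed_sum_le (K c : R) : 0 <= c ->
  (forall A : 'M['F_p]_d.+1, A \in unitmx -> A != 1%:M ->
     K * #|fixed_subs p_pr k A|%:R <= c) ->
  K * S <= P ^+ (d.+1 * d.+1) * c.
Proof.
move=> c0 h; rewrite natr_sum mulr_sumr.
apply: (@le_trans _ _ (\sum_(A in GL p d.+1) c)).
  rewrite big_mkcondr /=; apply: ler_sum => A; rewrite inE => Au.
  by case: ifP => // A1; apply: h.
rewrite sumr_const -[leLHS]mulr_natl ler_wpM2r // -natrX ler_nat.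
exact: card_GL_le.
Qed.

Let P0 : 0 < P := lt_le_trans (ltr0Sn R 1) P2.
Let D0 : 0 <= Dfun P.
Proof.
by have := euler_prod_le_Dfun P2 0; rewrite /euler_prod big_geq // => /(le_trans ler01).
Qed.
Let C0 : 0 <= Cfun P := le_trans ler01 (gauss_bound_ge1 P2 (gauss_sum_le_Cfun P2)).
Let powP (j : nat) : P `^ j%:R = P ^+ j. Proof. by rewrite powR_mulrn // ltW. Qed.

Lemma fixed_sum_high : (2 <= d)%N ->
  S <= Cfun P ^+ 2 * Dfun P * P `^ (3 / 4) * P `^ (d.+1%:R ^+ 2 - m%:R / 2) * nC.
Proof.
move=> d2; have c0 : 0 <= Cfun P ^+ 2 * Dfun P * t ^+ 3 * nC.
  by do !apply: mulr_ge0; rewrite ?exprn_ge0 ?(ltW t0).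
have := fixed_sum_le c0 (fun A => @fixed_bound_high A d2).
have -> : P `^ (3 / 4) = t ^+ 3.
  by rewrite -powR_mulrn ?(ltW t0) // -powRrM; congr (_ `^ _); lra.
have -> : P `^ (d.+1%:R ^+ 2 - m%:R / 2) = P ^+ (d.+1 * d.+1) / t ^+ (2 * m).
  rewrite powRD ?(gt_eqF P0) ?implybT // powRN; congr (_ / _).
    by rewrite -natrX powP mulnn.
  by rewrite -powR_mulrn ?(ltW t0) // -powRrM natrM; congr (_ `^ _); lra.
move=> h; rewrite mulrA -[leRHS]mulrA [_^-1 * _]mulrC mulrA ler_pdivlMr ?exprn_gt0 //.
by rewrite mulrC (le_trans h) // mulrCA mulrA.
Qed.

(** The saving p^(-2m) against the p^((d + 1)^2) matrices leaves p^(-(d + 1)),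
    because 2m >= (d + 1) (d + 2). *)
Lemma fixed_sum_two : (9 <= d)%N ->
  S <= Cfun P ^+ 5 * Dfun P ^+ 4 * P `^ (17 / 4) * P `^ (- d.+1%:R) * nC.
Proof.
move=> d9; have c0 : 0 <= Cfun P ^+ 5 * Dfun P ^+ 4 * (P ^+ 4 * t) * nC.
  by do !apply: mulr_ge0; rewrite ?exprn_ge0 ?(ltW t0) ?(ltW P0).
have := fixed_sum_le c0 (fun A => @fixed_bound_two A d9).
have -> : P `^ (17 / 4) = P ^+ 4 * t.
  rewrite (_ : 17 / 4 = 4%:R + 1 / 4); last by lra.
  by rewrite powRD ?powP // (gt_eqF P0) implybT.
move=> h; rewrite powRN powP [leRHS]mulrAC ler_pdivlMr ?exprn_gt0 //.
rewrite -(ler_pM2l (exprn_gt0 (d.+1 * d.+1) P0)); apply: le_trans h.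
rewrite mulrCA mulrC -exprD ler_wpM2r // ler_weXn2l ?(le_trans _ P2) ?ler1n //.
by move: lower_rank_ge; clear; lia.
Qed.

End FixedSubspaces.

Theorem theorem1p4 (R : realType) (p : nat) (p_pr : prime p) (d n : nat)
    (dnP : (n = 2 /\ 10 <= d)%N \/ (3 <= n /\ 3 <= d)%N) :
  let P : R := p%:R in
  let K : R :=
    if (n == 2)%N then Cfun P ^+ 5 * Dfun P ^+ 4 * P `^ (17 / 4)
    else Cfun P ^+ 2 * Dfun P * P `^ (3 / 4) in
  let x : R :=
    if (n == 2)%N then - d%:R else d%:R ^+ 2 - (lower_rank p_pr d n)%:R / 2 in
  let nC : R := #|normal_subs p_pr d n|%:R in
  let nGL : R := #|GL p d|%:R in
  let nOrb : R := #|orbits p_pr d n|%:R in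
  let nReg : R := #|regular_orbits p_pr d n|%:R in
  1 <= nOrb * nGL / nC <= 1 + K * P `^ x
  /\ ((K * P `^ x < 1 ->
        1 <= nOrb / nReg <= (1 + K * P `^ x) / (1 - K * P `^ x))
      /\ (0 < nReg -> 1 <= nOrb / nReg)).
Proof.
move=> P K x nC nGL nOrb nReg.
have P2 : 2 <= P by rewrite ler_nat prime_gt1.
have P0 : 0 < P by apply: lt_le_trans P2.
have [k nE] : exists k, n = k.+2 by exists n.-2; case: dnP => -[]; lia.
have [d' dE] : exists d', d = d'.+1 by exists d.-1; case: dnP => -[]; lia.
subst n d.
pose S : nat := (\sum_(A in GL p d'.+1 | A != 1%:M) #|fixed_subs p_pr k A|)%N.
have nC0 : 0 < nC.
  apply: lt_le_trans (card_subs_theta R p_pr d' k).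
  rewrite /theta big_ord_recl mul0n expr0 ltr_pwDl //.
  by apply: sumr_ge0 => i _; rewrite exprn_ge0.
apply: (@orbit_ratio_bounds R (K * P `^ x) nC nGL nOrb nReg S%:R) => //.
- rewrite ltr0n; apply/card_gt0P; exists 1%:M; rewrite inE unitmx1 //.
- rewrite /K /x; case: (eqVneq k.+2 2%N) => [k0|kn0].
    by apply: fixed_sum_two; move: dnP k0; clear; lia.
  by apply: fixed_sum_high; move: dnP kn0; clear; lia.
- rewrite ler_nat; apply: subset_leq_card; apply/fintype.subsetP => O; by rewrite inE => /andP[].
- rewrite -natrM -sum_fixed -natrD; congr (_%:R).
  by rewrite (bigD1 1%:M) ?inE ?unitmx1 //= fixed_subs1.
- by rewrite -natrM -natrD ler_nat; apply: card_subs_le_regular.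
Qed.
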